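(* Let $(A,\mathscr{A},\mu)$ and $(B,\mathscr{B},\nu)$ be probability spaces, let $\mathscr{F}$ be a sub-$\sigma$-algebra of the product $\sigma$-algebra $\mathscr{A}\times\mathscr{B}$ on $A\times B$, and let $1<p\le\infty$ and $1<q\le\infty$. Suppose that the canonical mapping $f\mapsto\phi_f$ establishes an isomorphism of Banach spaces $$L^p_{\mathscr{F}}(\mu;L^q(\nu))\simeq \big(L^{p'}_{\mathscr{F}}(\mu;L^{q'}(\nu))\big)^*.$$ Then for any Banach space $X$ the conditional expectation operator $\mathbb{E}(\cdot|\mathscr{F})$ on $L^1(\mu\times\nu;X)$ restricts to a bounded projection on $L^p(\mu;L^q(\nu;X))$.
   Context: For a Banach space $X$ and $1\le p,q\le\infty$, $L^p(\mu;L^q(\nu;X))$ is the mixed-norm Lebesgue–Bochner space, and $L^q(\nu)$ is the scalar-valued space. Elements of $L^p(\mu;L^q(\nu;X))$ are identified with elements of $L^1(\mu\times\nu;X)$, i.e. with functions on $A\times B$. The space $L^p_{\mathscr{F}}(\mu;L^q(\nu;X))$ is the closed subspace of $L^p(\mu;L^q(\nu;X))$ consisting of those functions that have a strongly $\mathscr{F}$-measurable representative; when $X$ is the scalar field it is written $L^p_{\mathscr{F}}(\mu;L^q(\nu))$. The conjugate exponents $1\le p',q'\le\infty$ are defined by $\frac1p+\frac1{p'}=1$ and $\frac1q+\frac1{q'}=1$. For $f\in L^p_{\mathscr{F}}(\mu;L^q(\nu))$, $\phi_f\in (L^{p'}_{\mathscr{F}}(\mu;L^{q'}(\nu)))^*$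 is the canonically induced functional $\phi_f(g)=\int_{A\times B} fg\,\mathrm{d}(\mu\times\nu)$; the map $f\mapsto\phi_f$ is contractive. ''Isomorphism of Banach spaces'' means a bounded linear bijection with bounded inverse (not necessarily isometric). $\mathbb{E}(\cdot|\mathscr{F})$ denotes the (Bochner) conditional expectation on $L^1(\mu\times\nu;X)$ with respect to $\mathscr{F}$. *)

(* Defs.v *)
From HB Require Import structures.
From mathcomp Require Import all_boot all_order all_algebra.
From mathcomp Require Import complex.
From mathcomp Require Import all_classical all_reals all_analysis.

Set Implicit Arguments.
Unset Strict Implicit.
Unset Printing Implicit Defensive.

Import Order.TTheory GRing.Theory Num.Theory.
Import numFieldNormedType.Exports.

Local Open Scope classical_set_scope.
Local Open Scope ring_scope.

(* Banach spaces may be real or complex.  Norms of a normedModType K take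
   their values in K, so for K = R[i] the real norm is the real part. *)
Variant scalar_kind := RealScalars | ComplexScalars.

Definition scalars (R : realType) (k : scalar_kind) : numFieldType :=
  match k with RealScalars => R | ComplexScalars => (R[i])%C end.

Definition to_real (R : realType) (k : scalar_kind) : scalars R k -> R :=
  match k with RealScalars => id | ComplexScalars => @complex.Re R end.

Definition of_real (R : realType) (k : scalar_kind) : R -> scalars R k :=
  match k with RealScalars => id | ComplexScalars => real_complex R end.

Definition rnorm (R : realType) (k : scalar_kind)
  (X : normedModType (scalars R k)) (x : X) : R := @to_real R k `|x|.

Definition enorm (R : realType) (k : scalar_kind)
  (X : normedModType (scalars R k)) (x : X) : \bar R := (rnorm x)%:E.

(* [G] is a sigma-algebra on [T], possibly smaller than the canonical one. *)
Definition simple_for (T Y : Type) (G : set (set T)) (s : T -> Y) : Prop :=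
  finite_set (range s) /\ forall y, G (s @^-1` [set y]).

Definition strongly_measurable (R : realType) (k : scalar_kind)
    (X : normedModType (scalars R k)) (T : Type) (G : set (set T))
    (f : T -> X) : Prop :=
  exists s : nat -> T -> X, (forall n, simple_for G (s n)) /\
    forall t, s n t @[n --> \oo] --> f t.

Section bochner.
Context (R : realType) (k : scalar_kind) (X : normedModType (scalars R k)).
Context (d : measure_display) (T : measurableType d).
Variable m : {measure set T -> \bar R}.

Definition bochner_integrable (f : T -> X) : Prop :=
  strongly_measurable measurable f /\ (\int[m]_t enorm (f t) < +oo)%E.

(* Only used for finite measures, for which [fine] loses nothing. *)
Definition simple_integral (s : T -> X) : X :=
  \sum_(x \in range s) of_real k (fine (m (s @^-1` [set x]))) *: x.

Definition has_bochner_integral (f : T -> X) (v : X) : Prop :=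
  exists s : nat -> T -> X,
    [/\ forall n, simple_for measurable (s n),
        (\int[m]_t enorm (f t - s n t)%R)%E @[n --> \oo] --> (0 : \bar R) &
        simple_integral (s n) @[n --> \oo] --> v].

Definition bochner_integral (f : T -> X) : X :=
  xget 0 [set v | has_bochner_integral f v].

Definition is_condexp (F : set (set T)) (f g : T -> X) : Prop :=
  [/\ bochner_integrable g, strongly_measurable F g &
      forall C, F C ->
        bochner_integral (patch (cst 0) C g) =
        bochner_integral (patch (cst 0) C f)].

Definition condexp (F : set (set T)) (f : T -> X) : T -> X :=
  xget (cst 0) [set g | is_condexp F f g].

Definition in_Lq (q : \bar R) (f : T -> X) : Prop :=
  strongly_measurable measurable f /\
  (Lnorm m q (fun t => enorm (f t)) < +oo)%E.

End bochner.

(* All spaces below consist of functions on [A * B]; their elements in the usual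
   sense are the classes of such functions modulo equality [mu \x nu]-a.e. *)
Section mixed_norm.
Context (R : realType) (k : scalar_kind).
Context (dA dB : measure_display).
Context (A : measurableType dA) (B : measurableType dB).
Variables (mu : probability A R) (nu : probability B R).

Section vector_valued.
Variable X : normedModType (scalars R k).

Definition mixed_norm (p q : \bar R) (f : A * B -> X) : \bar R :=
  Lnorm mu p (fun a => Lnorm nu q (fun b => enorm (f (a, b)))).

(* Strong measurability of [a |-> f (a, .)] as an [L^q(nu; X)]-valued map.  It
   follows from strong measurability of [f] when [q < +oo], but not when
   [q = +oo], where it forces an essentially separable range. *)
Definition strongly_measurable_sections (q : \bar R) (f : A * B -> X) : Prop :=
  exists s : nat -> A -> (B -> X),
    [/\ forall n, simple_for measurable (s n),
        forall n a, in_Lq nu q (s n a) &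
        \forall a \ae mu,
          Lnorm nu q (fun b => enorm (f (a, b) - s n a b)) @[n --> \oo]
            --> (0 : \bar R)].

Definition in_Lpq (p q : \bar R) (f : A * B -> X) : Prop :=
  [/\ strongly_measurable measurable f,
      strongly_measurable_sections q f &
      (mixed_norm p q f < +oo)%E].

Definition in_LpqF (F : set (set (A * B))) (p q : \bar R)
    (f : A * B -> X) : Prop :=
  in_Lpq p q f /\
  exists g : A * B -> X,
    strongly_measurable F g /\ \forall z \ae (mu \x nu)%E, f z = g z.

Definition restricts_to_bounded_projection (E : (A * B -> X) -> (A * B -> X))
    (p q : \bar R) : Prop :=
  [/\ forall f, in_Lpq p q f -> in_Lpq p q (E f),
      forall (c : scalars R k) f g, in_Lpq p q f -> in_Lpq p q g ->
        \forall z \ae (mu \x nu)%E,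
          E (fun z' => c *: f z' + g z') z = c *: E f z + E g z,
      forall f, in_Lpq p q f ->
        \forall z \ae (mu \x nu)%E, E (E f) z = E f z &
      exists C : R, forall f, in_Lpq p q f ->
        (mixed_norm p q (E f) <= C%:E * mixed_norm p q f)%E].

End vector_valued.

Local Notation K := (scalars R k).

(* Values of a functional outside [L^p_F(mu; L^q(nu))] are irrelevant.
   Boundedness makes it invariant under a.e. equality. *)
Definition in_dual (F : set (set (A * B))) (p q : \bar R)
    (phi : (A * B -> K^o) -> K^o) : Prop :=
  (forall (c : K) g h, in_LpqF F p q g -> in_LpqF F p q h ->
     phi (fun z => c *: g z + h z) = c *: phi g + phi h) /\
  exists C : R, forall g, in_LpqF F p q g ->
    (enorm (phi g) <= C%:E * mixed_norm p q g)%E.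

Definition dual_norm (F : set (set (A * B))) (p q : \bar R)
    (phi : (A * B -> K^o) -> K^o) : \bar R :=
  ereal_sup [set enorm (phi g) |
    g in [set g | in_LpqF F p q g /\ (mixed_norm p q g <= 1)%E]].

(* No complex conjugation: the pairing is bilinear. *)
Definition pairing (f g : A * B -> K^o) : K^o :=
  bochner_integral (mu \x nu)%E (fun z => (f z * g z : K^o)).

Definition canonical_isomorphism (F : set (set (A * B))) (p q : \bar R) : Prop :=
  let p' := hoelder_conjugate p in
  let q' := hoelder_conjugate q in
  [/\ (forall f, in_LpqF F p q f -> in_dual F p' q' (pairing f)),
      (forall (c : K) f1 f2 g,
         in_LpqF F p q f1 -> in_LpqF F p q f2 -> in_LpqF F p' q' g ->
         pairing (fun z => c *: f1 z + f2 z) g =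
         c *: pairing f1 g + pairing f2 g),
      (forall f1 f2, in_LpqF F p q f1 -> in_LpqF F p q f2 ->
         (forall g, in_LpqF F p' q' g -> pairing f1 g = pairing f2 g) ->
         \forall z \ae (mu \x nu)%E, f1 z = f2 z),
      (forall phi, in_dual F p' q' phi ->
         exists2 f, in_LpqF F p q f &
           forall g, in_LpqF F p' q' g -> phi g = pairing f g) &
      (exists C : R, forall f, in_LpqF F p q f ->
         (dual_norm F p' q' (pairing f) <= C%:E * mixed_norm p q f)%E /\
         (mixed_norm p q f <= C%:E * dual_norm F p' q' (pairing f))%E)].

End mixed_norm.

(* Main.v *)
Require Import Defs.
From HB Require Import structures.
From mathcomp Require Import all_boot all_order all_algebra.
From mathcomp Require Import complex.
From mathcomp Require Import all_classical all_reals all_analysis.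
From mathcomp Require Import measurable_realfun ess_sup_inf.
From mathcomp Require Import lra.

Set Implicit Arguments.
Unset Strict Implicit.
Unset Printing Implicit Defensive.

Import Order.TTheory GRing.Theory Num.Theory.
Import numFieldNormedType.Exports.

Local Open Scope classical_set_scope.
Local Open Scope ring_scope.

(** Write [m] for the product of [mu] and [nu].  The proof never uses a
    Radon-Nikodym theorem: the assumed duality itself produces the conditional
    expectations, and the scalar bound it gives is transferred to [X].

    Uniqueness and the [L^1] bound.  If [g] is strongly [F]-measurable and has
    the same integral as [f] over every member of [F], then the integral of the
    norm of [g] is at most that of [f] ([integral_enorm_condexp]): approximate
    [g] by an [F]-simple function and apply the triangle inequality on each of
    its level sets.  Hence conditional expectations are unique almost
    everywhere and contract the [L^1] norm, on all of [A * B] as well as on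
    each member of [F] ([is_condexp_unique], [condexp_contraction]).

    Existence.  A scalar function [u] of finite mixed norm induces, by
    Hoelder's inequality for mixed norms, a bounded functional on
    [L^p'_F(L^q')].  The function [h] of [L^p_F(L^q)] representing it has the
    same integral as [u] over each [C] in [F], as one sees by testing on the
    indicator of [C]; thus [h] is a conditional expectation of [u], and the
    boundedness of the inverse isomorphism gives a constant [c] with
    [||h|| <= c ||u||] ([dual_representer]).  This applies to indicators of
    measurable sets; by linearity it extends to [X]-valued simple functions, and
    by the [L^1] contraction together with the completeness of [L^1] to all
    integrable [X]-valued functions ([condexp_exists]).

    Boundedness.  The norm of a conditional expectation of [f] is almost
    everywhere at most that of a conditional expectation of the scalar function
    [rnorm f]: integrate over members of [F] and compare level sets
    ([condexp_rnorm_le]).  So the scalar bound passes to [X] with the same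
    constant ([condexp_bounded]).

    Membership.  It remains to see that [a |-> g (a, .)], for [g] a conditional
    expectation of [f], is strongly measurable as a map into [L^q(nu; X)].  By
    [separable_sections_sm] this is a question of separability, and for finite
    [q] it always holds ([sm_separable_sections]).  For [q = oo] it is again the
    duality that helps.  The indicator of [C] in [F] is its own conditional
    expectation, hence agrees almost everywhere with a member of
    [L^p_F(L^oo)]; since the indicators of sets that differ by a set of
    positive measure are at [L^oo] distance one, [C] has, up to null sets,
    only countably many sections ([canonical_countable_sections]).  The same
    must be deduced for a function [idx] on [A * B] with values in [nat] all of
    whose preimages belong to [F] ([countable_sections_index]).  For this, join
    [n] and [j] by an edge of the graph attached to [(a, a')] when
    [idx (a, b) = n] and [idx (a', b) = j] for a set of [b] of positive measure.
    A greedy colouring of [nat] with two colours is such that almost every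
    graph with infinitely many edges has an edge joining vertices of different
    colours ([ae_greedy_colouring]).  The set of points where [idx] has the
    first colour is in [F], so has countably many sections; if [a] and [a']
    give the same one, no edge joins different colours, so for almost all such
    pairs the graph is finite, which means that the sections of [idx] at [a]
    and [a'] differ only where both values are below some bound.  There are
    countably many ways to fill in these values, because each
    [idx @^-1` [set n]] has countably many sections.  Approximating [g]
    uniformly by functions with countably many values finishes the proof
    ([countable_separable_sections]). *)

(** * Real norms and completeness *)

Section scalars.
Context (R : realType) (k : scalar_kind).
Local Notation K := (scalars R k).

Lemma of_realK (x : R) : to_real (of_real k x) = x.
Proof. by case: k. Qed.

Lemma to_realK (x : K) : 0 <= x -> of_real k (to_real x) = x.
Proof.
case: k x => //= -[a b]; rewrite lecE /= => /andP[/eqP -> _].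
by [].
Qed.

Lemma of_realD (x y : R) : of_real k (x + y) = of_real k x + of_real k y.
Proof. by case: k => //=; rewrite rmorphD. Qed.

Lemma of_realM (x y : R) : of_real k (x * y) = of_real k x * of_real k y.
Proof. by case: k => //=; rewrite rmorphM. Qed.

Lemma of_real0 : of_real k (0 : R) = 0.
Proof. by case: k. Qed.

Lemma of_real1 : of_real k (1 : R) = 1.
Proof. by case: k. Qed.

Lemma ler_of_real (x y : R) : (of_real k x <= of_real k y) = (x <= y).
Proof. by case: k => //=; rewrite lecR. Qed.

Lemma ltr_of_real (x y : R) : (of_real k x < of_real k y) = (x < y).
Proof. by case: k => //=; rewrite ltcR. Qed.

Lemma norm_of_real (x : R) : `|of_real k x| = of_real k `|x|.
Proof. by case: k => //=; rewrite normc_def /= expr0n addr0 sqrtr_sqr. Qed.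

End scalars.

Section rnorm.
Context (R : realType) (k : scalar_kind) (X : normedModType (scalars R k)).
Local Notation K := (scalars R k).
Implicit Types x y : X.

Lemma rnormK x : of_real k (rnorm x) = `|x|.
Proof. exact: to_realK. Qed.

Lemma rnorm_ge0 x : 0 <= rnorm x.
Proof. by rewrite -(ler_of_real k) rnormK of_real0. Qed.

Lemma rnorm0 : rnorm (0 : X) = 0.
Proof. by rewrite /rnorm normr0 -(of_real0 R k) of_realK. Qed.

Lemma rnorm_eq0 x : rnorm x = 0 -> x = 0.
Proof. by move=> x0; apply/eqP; rewrite -normr_eq0 -rnormK x0 of_real0. Qed.

Lemma rnormN x : rnorm (- x) = rnorm x.
Proof. by rewrite /rnorm normrN. Qed.

Lemma rnormB x y : rnorm (x - y) = rnorm (y - x).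
Proof. by rewrite -rnormN opprB. Qed.

Lemma ler_rnormD x y : rnorm (x + y) <= rnorm x + rnorm y.
Proof. by rewrite -(ler_of_real k) of_realD !rnormK ler_normD. Qed.

Lemma rnorm_tri z x y : rnorm (x - y) <= rnorm (x - z) + rnorm (z - y).
Proof. by rewrite (le_trans _ (ler_rnormD _ _))// addrA subrK. Qed.

Lemma rnorm_tri_r z x y : rnorm (x - y) <= rnorm (x - z) + rnorm (y - z).
Proof. by rewrite (rnormB y); exact: rnorm_tri. Qed.

Lemma ler_rnorm_sub x y : rnorm x <= rnorm (x - y) + rnorm y.
Proof. by rewrite -{1}(subrK y x) ler_rnormD. Qed.

Lemma rnormZr (c : R) x : rnorm (of_real k c *: x) = `|c| * rnorm x.
Proof.
by rewrite {1}/rnorm normrZ norm_of_real -rnormK -of_realM of_realK.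
Qed.

(** Convergence in [X], expressed with the real-valued norm. *)
Lemma cvg_rnormP (s : nat -> X) x :
  s n @[n --> \oo] --> x <-> (rnorm (s n - x) @[n --> \oo] --> (0 : R)).
Proof.
split.
  move=> /cvgrPdist_lt sx; apply/cvgrPdist_lt => e e0.
  have := sx (of_real k e); rewrite -(of_real0 R k) ltr_of_real => /(_ e0).
  apply: filterS => n; rewrite -rnormK ltr_of_real sub0r normrN.
  by rewrite ger0_norm ?rnorm_ge0// rnormB.
move=> /cvgrPdist_lt sx; apply/cvgrPdist_lt => e e0.
have e1 : of_real k (to_real e) = e by rewrite to_realK// ltW.
have := sx (to_real e); rewrite -(ltr_of_real k) e1 of_real0 => /(_ e0).
apply: filterS => n; rewrite -(ltr_of_real k) e1 sub0r normrN.
by rewrite ger0_norm ?rnorm_ge0// rnormK distrC.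
Qed.

(** Completeness of a normed space, phrased for sequences and real norms. *)
Definition seq_complete :=
  forall s : nat -> X,
    (forall e : R, 0 < e -> exists N, forall n m, (N <= n)%N -> (N <= m)%N ->
       rnorm (s n - s m) < e) ->
    exists x, s n @[n --> \oo] --> x.

End rnorm.
Arguments seq_complete {R k} X.

Lemma rnormZ (R : realType) (k : scalar_kind)
  (X : normedModType (scalars R k)) (c : scalars R k) (x : X) :
  rnorm (c *: x) = rnorm (c : (scalars R k)^o) * rnorm x.
Proof.
have e : of_real k (rnorm (c : (scalars R k)^o)) = `|c| by rewrite rnormK.
rewrite -[RHS](of_realK k) of_realM e rnormK.
by rewrite /rnorm normrZ.
Qed.

Lemma Banach_seq_complete (R : realType) (k : scalar_kind)
  (X : completeNormedModType (scalars R k)) : seq_complete X.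
Proof.
move=> s Cs; apply/cvg_ex; apply/cauchy_cvgP.
apply/cauchyP => e e0.
have e1 : of_real k (to_real e) = e by rewrite to_realK// ltW.
have [|N HN] := Cs (to_real e); first by rewrite -(ltr_of_real k) e1 of_real0.
exists (s N); exists N => // n /= Nn.
rewrite -ball_normE /ball_ /= -rnormK -e1 ltr_of_real.
exact: HN.
Qed.

Lemma scalars_seq_complete (R : realType) (k : scalar_kind) :
  seq_complete ((scalars R k)^o : normedModType (scalars R k)).
Proof.
case: k.
  have -> : ((scalars R RealScalars)^o : normedModType (scalars R RealScalars)) = (R^o : normedModType R) by [].
  exact: (@Banach_seq_complete R RealScalars R^o).
have normE (z : (scalars R ComplexScalars)^o) :
    rnorm z = Num.sqrt ((complex.Re z) ^+ 2 + (complex.Im z) ^+ 2).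
  change (complex.Re (`|z : R[i]|) =
    Num.sqrt ((complex.Re z) ^+ 2 + (complex.Im z) ^+ 2)).
  by rewrite normc_def.
have Re_norm (z : (scalars R ComplexScalars)^o) : `|complex.Re z| <= rnorm z.
  by rewrite normE -sqrtr_sqr ler_wsqrtr// lerDl sqr_ge0.
have Im_norm (z : (scalars R ComplexScalars)^o) : `|complex.Im z| <= rnorm z.
  by rewrite normE -sqrtr_sqr ler_wsqrtr// lerDr sqr_ge0.
have norm_le (z : (scalars R ComplexScalars)^o) :
    rnorm z <= `|complex.Re z| + `|complex.Im z|.
  rewrite normE -[leRHS]ger0_norm ?addr_ge0// -(sqrtr_sqr (_ + _)) ler_wsqrtr//.
  rewrite sqrrD -!normrX (ger0_norm (sqr_ge0 _)) (ger0_norm (sqr_ge0 (complex.Im z))).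
  by rewrite lerD2r lerDl mulrn_wge0// mulr_ge0.
move=> s Cs.
have ReB (z w : (scalars R ComplexScalars)^o) :
    complex.Re (z - w) = complex.Re z - complex.Re w by case: z w => [a b] [c d].
have ImB (z w : (scalars R ComplexScalars)^o) :
    complex.Im (z - w) = complex.Im z - complex.Im w by case: z w => [a b] [c d].
have [a sa] : exists x, complex.Re (s n) @[n --> \oo] --> (x : R^o).
  apply: (@Banach_seq_complete R RealScalars R^o) => e /Cs[N HN].
  exists N => n m Nn Nm; apply: le_lt_trans (HN n m Nn Nm).
  by rewrite -ReB; exact: Re_norm.
have [b sb] : exists x, complex.Im (s n) @[n --> \oo] --> (x : R^o).
  apply: (@Banach_seq_complete R RealScalars R^o) => e /Cs[N HN].
  exists N => n m Nn Nm; apply: le_lt_trans (HN n m Nn Nm).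
  by rewrite -ImB; exact: Im_norm.
exists (Complex a b); apply/cvg_rnormP.
apply: (@squeeze_cvgr _ _ _ _ (cst 0)
  (fun n => `|complex.Re (s n) - a| + `|complex.Im (s n) - b|)).
- apply: nearW => n; rewrite rnorm_ge0/=.
  by rewrite (le_trans (norm_le _))// ReB ImB.
- exact: cvg_cst.
- rewrite -[X in _ --> X](addr0 0); apply: cvgD.
    by apply/norm_cvg0P; apply/subr_cvg0.
  by apply/norm_cvg0P; apply/subr_cvg0.
Qed.

(** * Strong measurability with respect to a sub-sigma-algebra *)

Section sigma_algebra_sets.
Context (T : Type) (G : set (set T)).
Hypothesis HG : sigma_algebra [set: T] G.

Lemma sa_set0 : G set0. Proof. by case: HG. Qed.

Lemma sa_setC A : G A -> G (~` A).
Proof. by case: HG => _ + _ => /[apply]; rewrite setTD. Qed.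

Lemma sa_setT : G setT.
Proof. by rewrite -setC0; exact/sa_setC/sa_set0. Qed.

Lemma sa_bigcup (A : nat -> set T) : (forall n, G (A n)) -> G (\bigcup_n A n).
Proof. by case: HG => _ _; apply. Qed.

Lemma sa_bigcap (A : nat -> set T) : (forall n, G (A n)) -> G (\bigcap_n A n).
Proof.
move=> GA; rewrite -[X in G X]setCK setC_bigcap; apply: sa_setC.
by apply: sa_bigcup => n; exact: sa_setC.
Qed.

Lemma sa_setU A B : G A -> G B -> G (A `|` B).
Proof.
move=> GA GB; rewrite -bigcup2E; apply: sa_bigcup => -[|[|n]] //=.
exact: sa_set0.
Qed.

Lemma sa_setI A B : G A -> G B -> G (A `&` B).
Proof.
move=> GA GB; rewrite -[X in G X]setCK setCI; apply: sa_setC.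
by apply: sa_setU; exact: sa_setC.
Qed.

Lemma sa_setD A B : G A -> G B -> G (A `\` B).
Proof. by move=> GA GB; rewrite setDE; apply: sa_setI => //; exact: sa_setC. Qed.

Lemma sa_fin_bigcup (I : choiceType) (D : set I) (A : I -> set T) :
  finite_set D -> (forall i, D i -> G (A i)) -> G (\bigcup_(i in D) A i).
Proof.
move=> /finite_seqP[l ->]; elim: l => [|a l IH] GA.
  by rewrite bigcup0//; exact: sa_set0.
rewrite (_ : \bigcup_(i in _) _ = A a `|` \bigcup_(i in [set` l]) A i).
  apply: sa_setU; first by apply: GA; rewrite /= inE eqxx.
  by apply: IH => i il; apply: GA; rewrite /= inE; apply/orP; right.
apply/seteqP; split => t.
  move=> [i /=]; rewrite inE => /orP[/eqP ->|il] At; [by left|].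
  by right; exists i.
move=> [At|[i /= il At]]; first by exists a => //=; rewrite inE eqxx.
by exists i => //=; rewrite inE; apply/orP; right.
Qed.

End sigma_algebra_sets.

Lemma sigma_algebra_measurable d (T : measurableType d) :
  sigma_algebra [set: T] (@measurable d T).
Proof.
split; first exact: measurable0.
- by move=> A mA; rewrite setTD; exact: measurableC.
- by move=> A mA; exact: bigcupT_measurable.
Qed.
#[local] Hint Resolve sigma_algebra_measurable : core.

Section simple_functions.
Context (T : Type) (G : set (set T)).
Hypothesis HG : sigma_algebra [set: T] G.

Lemma simple_cst (Y : Type) (y : Y) : simple_for G (fun _ : T => y).
Proof.
split.
  apply: (@sub_finite_set _ _ [set y]); last exact: finite_set1.
  by move=> _ [t _ <-].
move=> z; have [->|yz] := pselect (y = z).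
  rewrite (_ : _ @^-1` _ = setT); first exact: sa_setT.
  by apply/seteqP; split.
rewrite (_ : _ @^-1` _ = set0); first exact: sa_set0.
by apply/seteqP; split.
Qed.

Lemma simple_preimage (Y : choiceType) (s : T -> Y) (P : set Y) :
  simple_for G s -> G (s @^-1` P).
Proof.
move=> [fs Gs].
rewrite (_ : _ @^-1` _ = \bigcup_(y in range s `&` P) (s @^-1` [set y])).
  apply: sa_fin_bigcup => //.
  by apply: (sub_finite_set _ fs); exact: subIsetl.
apply/seteqP; split => t /=; first by move=> Pt; exists (s t).
by move=> [y [_ Py] ->].
Qed.

Lemma simple_comp (Y Z : choiceType) (s : T -> Y) (h : Y -> Z) :
  simple_for G s -> simple_for G (h \o s).
Proof.
move=> ss; split.
  rewrite (_ : range _ = h @` range s).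
    by case: ss => fs _; exact: finite_image.
  by rewrite image_comp.
by move=> z; rewrite comp_preimage; exact: simple_preimage.
Qed.

Lemma simple_pair (Y Z : choiceType) (s : T -> Y) (s' : T -> Z) :
  simple_for G s -> simple_for G s' -> simple_for G (fun t => (s t, s' t)).
Proof.
move=> [fs Gs] [fs' Gs']; split.
  apply: (@sub_finite_set _ _ (range s `*` range s')).
    by move=> _ [t _ <-]; split => /=; exists t.
  exact: finite_setX.
move=> [a b].
rewrite (_ : _ @^-1` _ = s @^-1` [set a] `&` s' @^-1` [set b]).
  exact: sa_setI.
by apply/seteqP; split => t /= [-> ->].
Qed.

Lemma simple_comp2 (Y Z W : choiceType) (s : T -> Y) (s' : T -> Z)
    (h : Y -> Z -> W) :
  simple_for G s -> simple_for G s' -> simple_for G (fun t => h (s t) (s' t)).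
Proof.
move=> ss ss'.
exact: (@simple_comp _ _ _ (fun x : Y * Z => h x.1 x.2) (simple_pair ss ss')).
Qed.

Lemma simple_bool (C : set T) : G C -> simple_for G (fun t => t \in C).
Proof.
move=> GC; split.
  apply: (@sub_finite_set _ _ [set true; false]).
    by move=> b _; case: b; [left|right].
  by rewrite finite_setU; split; exact: finite_set1.
case.
  rewrite (_ : _ @^-1` _ = C)//.
  by apply/seteqP; split => t /=; [move/set_mem|move/mem_set].
rewrite (_ : _ @^-1` _ = ~` C); first exact: sa_setC.
apply/seteqP; split => t /=.
  by move=> /negbT; rewrite notin_setE.
by move=> nC; apply/negbTE; rewrite notin_setE.
Qed.

Lemma simple_patch (Y : choiceType) (s s' : T -> Y) C :
  G C -> simple_for G s -> simple_for G s' -> simple_for G (patch s' C s).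
Proof.
move=> GC ss ss'.
exact: (@simple_comp2 bool (Y * Y)%type Y (fun t => t \in C) _
  (fun b x => if b then x.1 else x.2)
  (simple_bool GC) (simple_pair ss ss')).
Qed.

End simple_functions.

(** The indicator function of a set, as a scalar-valued function. *)
Definition indicK (R : realType) (k : scalar_kind) (T : Type) (E : set T) :
  T -> (scalars R k)^o := patch (cst 0) E (cst 1).

Section strong_measurability.
Context (R : realType) (k : scalar_kind) (T : Type) (G : set (set T)).
Hypothesis HG : sigma_algebra [set: T] G.
Local Notation K := (scalars R k).

Lemma simple_sm (X : normedModType K) (s : T -> X) :
  simple_for G s -> strongly_measurable G s.
Proof. by move=> ss; exists (fun _ => s); split => // t; exact: cvg_cst. Qed.

Lemma sm_cst (X : normedModType K) (x : X) :
  strongly_measurable G (fun _ : T => x).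
Proof. exact/simple_sm/simple_cst. Qed.

Lemma sm_comp2 (X Y Z : normedModType K) (h : X -> Y -> Z)
    (f : T -> X) (g : T -> Y) :
  (forall s x s' y, s n @[n --> \oo] --> x -> s' n @[n --> \oo] --> y ->
     h (s n) (s' n) @[n --> \oo] --> h x y) ->
  strongly_measurable G f -> strongly_measurable G g ->
  strongly_measurable G (fun t => h (f t) (g t)).
Proof.
move=> hc [s [ss sf]] [s' [ss' sg]].
exists (fun n t => h (s n t) (s' n t)); split; last by move=> t; exact: hc.
by move=> n; exact: simple_comp2.
Qed.

Lemma sm_D (X : normedModType K) (f g : T -> X) :
  strongly_measurable G f -> strongly_measurable G g ->
  strongly_measurable G (fun t => f t + g t).
Proof. by apply: (@sm_comp2 _ _ _ +%R) => *; exact: cvgD. Qed.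

Lemma sm_B (X : normedModType K) (f g : T -> X) :
  strongly_measurable G f -> strongly_measurable G g ->
  strongly_measurable G (fun t => f t - g t).
Proof. by apply: (@sm_comp2 _ _ _ (fun x y => x - y)) => *; exact: cvgB. Qed.

Lemma sm_Z (X : normedModType K) (h : T -> K^o) (f : T -> X) :
  strongly_measurable G h -> strongly_measurable G f ->
  strongly_measurable G (fun t => (h t : K) *: f t).
Proof.
by apply: (@sm_comp2 K^o _ _ (fun (c : K) x => c *: x)) => *; exact: cvgZ.
Qed.

Lemma sm_cstZ (X : normedModType K) (c : K) (f : T -> X) :
  strongly_measurable G f -> strongly_measurable G (fun t => c *: f t).
Proof. exact: (@sm_Z _ (fun _ => c) _ (sm_cst _)). Qed.

Lemma sm_M (f g : T -> K^o) :
  strongly_measurable G f -> strongly_measurable G g ->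
  strongly_measurable G (fun t => (f t * g t : K^o)).
Proof. exact: sm_Z. Qed.

Lemma sm_rnorm (X : normedModType K) (f : T -> X) :
  strongly_measurable G f ->
  strongly_measurable G (fun t => (of_real k (rnorm (f t)) : K^o)).
Proof.
move=> sf; apply: (@sm_comp2 X X K^o (fun x _ => of_real k (rnorm x)) f f _ sf sf).
move=> s x s' y /cvg_norm + _; rewrite -rnormK.
by under eq_cvg do rewrite -rnormK.
Qed.

Lemma sm_patch (X : normedModType K) (C : set T) (f g : T -> X) :
  G C -> strongly_measurable G f -> strongly_measurable G g ->
  strongly_measurable G (patch g C f).
Proof.
move=> GC [s [ss sf]] [s' [ss' sg]].
exists (fun n => patch (s' n) C (s n)); split.
  by move=> n; exact: simple_patch.
by move=> t; rewrite /patch; case: ifP.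
Qed.

Lemma sm_indic (C : set T) : G C ->
  strongly_measurable G (indicK R k C).
Proof. by move=> GC; apply: sm_patch => //; exact: sm_cst. Qed.

(** The range of [f] lies in the closure of a sequence. *)
Definition separable_range (X : normedModType K) (f : T -> X) (x : nat -> X) :=
  forall t (e : R), 0 < e -> exists i, rnorm (f t - x i) < e.

(** The preimages of open balls belong to [G]. *)
Definition ball_measurable (X : normedModType K) (f : T -> X) :=
  forall x (r : R), G [set t | rnorm (f t - x) < r].

Lemma limit_ball_measurable (X : normedModType K) (s : nat -> T -> X) f :
  (forall n, ball_measurable (s n)) ->
  (forall t, s n t @[n --> \oo] --> f t) -> ball_measurable f.
Proof.
move=> ss sf x r.
rewrite (_ : [set t | _] = \bigcup_m \bigcup_N \bigcap_n
  [set t | rnorm (s (N + n)%N t - x) < r - m.+1%:R^-1]).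
  apply: sa_bigcup => // m; apply: sa_bigcup => // N.
  by apply: sa_bigcap => // n; exact: ss.
apply/seteqP; split => t /=.
  move=> fr; have e0 : 0 < (r - rnorm (f t - x)) / 2.
    by rewrite divr_gt0// subr_gt0.
  have [m m_e] := ltr_add_invr e0.
  have /cvg_rnormP /cvgrPdist_lt /(_ _ e0)[N _ HN] := sf t.
  exists m => //; exists N => // n _ /=.
  have := HN (N + n)%N (leq_addr _ _); rewrite /= sub0r normrN.
  rewrite ger0_norm ?rnorm_ge0// => sn.
  have tri := rnorm_tri (f t) (s (N + n)%N t) x.
  rewrite add0r in m_e; move: m_e sn tri.
  set u := m.+1%:R^-1; move=> m_e sn tri; lra.
move=> [m _ [N _ H]].
have m0 : (0 : R) < m.+1%:R^-1 by rewrite invr_gt0.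
have /cvg_rnormP /cvgrPdist_lt /(_ _ m0)[M _ HM] := sf t.
have := HM (N + M)%N (leq_addl _ _); rewrite /= sub0r normrN.
rewrite ger0_norm ?rnorm_ge0// rnormB => sn.
have tri := rnorm_tri (s (N + M)%N t) (f t) x.
by move: (H M I) sn tri => /=; set u := m.+1%:R^-1 => HM' sn tri; lra.
Qed.

Lemma simple_ball_measurable (X : normedModType K) (s : T -> X) :
  simple_for G s -> ball_measurable s.
Proof.
move=> ss x r.
exact: (@simple_preimage _ _ HG _ s [set y | rnorm (y - x) < r]).
Qed.

Lemma sm_ball_measurable (X : normedModType K) (f : T -> X) :
  strongly_measurable G f -> ball_measurable f.
Proof.
move=> [s [ss sf]]; apply: limit_ball_measurable sf => n.
exact: simple_ball_measurable.
Qed.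

Lemma limit_separable_range (X : normedModType K) (s : nat -> T -> X) f :
  (forall n, exists x, separable_range (s n) x) ->
  (forall t, s n t @[n --> \oo] --> f t) -> exists x, separable_range f x.
Proof.
move=> /choice[x Hx] sf.
exists (fun i => if unpickle i is Some (n, j) then x n j else 0) => t e e0.
have e20 : 0 < e / 2 by rewrite divr_gt0.
have /cvg_rnormP /cvgrPdist_lt /(_ _ e20)[N _ HN] := sf t.
have [j Hj] := Hx N t _ e20.
exists (pickle (N, j)); rewrite pickleK.
have := HN N (leqnn _); rewrite /= sub0r normrN.
rewrite ger0_norm ?rnorm_ge0// rnormB => sn.
by have tri := rnorm_tri (s N t) (f t) (x N j); lra.
Qed.

Lemma simple_separable_range (X : normedModType K) (s : T -> X) :
  simple_for G s -> exists x, separable_range s x.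
Proof.
move=> [/finite_seqP[l rl] _]; exists (fun i => nth 0 l i) => t e e0.
have : s t \in l by have : range s (s t) by []; rewrite rl.
by move=> /(nthP 0)[i _ il]; exists i; rewrite il subrr rnorm0.
Qed.

Lemma sm_separable_range (X : normedModType K) (f : T -> X) :
  strongly_measurable G f -> exists x, separable_range f x.
Proof.
move=> [s [ss sf]]; apply: limit_separable_range sf => n.
exact: simple_separable_range.
Qed.

(** [nearest f x n t] is, among [0, x 0, ..., x n.-1], a point nearest to
    [f t]. *)
Fixpoint nearest (X : normedModType K) (f : T -> X) (x : nat -> X) n t : X :=
  if n is m.+1 then
    if rnorm (f t - x m) < rnorm (f t - nearest f x m t) then x m
    else nearest f x m t
  else 0.

Lemma nearest_dist (X : normedModType K) (f : T -> X) x n m t : (m < n)%N ->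
  rnorm (f t - nearest f x n t) <= rnorm (f t - x m).
Proof.
elim: n => // n IH; rewrite ltnS leq_eqVlt => /predU1P[->|mn] /=.
  by case: ltP.
case: ltP => [h|_]; last exact: IH.
by rewrite (le_trans (ltW h))// IH.
Qed.

Lemma nearest_dist0 (X : normedModType K) (f : T -> X) x n t :
  rnorm (f t - nearest f x n t) <= rnorm (f t).
Proof.
elim: n => [|n IH] /=; first by rewrite subr0.
by case: ltP => [h|_//]; rewrite (le_trans (ltW h)).
Qed.

Lemma nearest_cvg (X : normedModType K) (f : T -> X) x t :
  separable_range f x -> nearest f x n t @[n --> \oo] --> f t.
Proof.
move=> fx; apply/cvg_rnormP/cvgrPdist_lt => e e0.
have [i Hi] := fx t e e0; exists i.+1 => // n /= ni.
rewrite sub0r normrN ger0_norm ?rnorm_ge0// rnormB.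
exact: le_lt_trans (nearest_dist f x t ni) Hi.
Qed.

(** A rational number is interposed between the two distances. *)
Lemma ball_measurable_lt (X : normedModType K) (f : T -> X) x y :
  ball_measurable f -> G [set t | rnorm (f t - x) < rnorm (f t - y)].
Proof.
move=> bf.
rewrite (_ : [set t | _] = \bigcup_i (if (unpickle i : option rat) is Some q then
  [set t | rnorm (f t - x) < ratr q] `\` [set t | rnorm (f t - y) < ratr q]
  else set0)).
  apply: sa_bigcup => // i; case: unpickle => [q|]; last exact: sa_set0.
  by apply: sa_setD => //; exact: bf.
apply/seteqP; split => t /=.
  move=> /rat_in_itvoo[q]; rewrite in_itv/= => /andP[xq qy].
  exists (pickle q); first exact: I.
  by rewrite pickleK; split => //; apply/negP; rewrite -leNgt ltW.
move=> [i _]; case: unpickle => // q /= [xq /negP].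
by rewrite -leNgt; exact: lt_le_trans.
Qed.

Lemma nearest_simple (X : normedModType K) (f : T -> X) x n :
  ball_measurable f -> simple_for G (nearest f x n).
Proof.
move=> bf; elim: n => [|n IH] /=; first exact: simple_cst.
set C := [set t | rnorm (f t - x n) < rnorm (f t - nearest f x n t)].
have GC : G C.
  rewrite (_ : C = \bigcup_(y in range (nearest f x n))
    (nearest f x n @^-1` [set y] `&` [set t | rnorm (f t - x n) < rnorm (f t - y)])).
    apply: sa_fin_bigcup => //; first by case: IH.
    move=> y _; apply: sa_setI => //; first by case: IH.
    exact: ball_measurable_lt.
  apply/seteqP; split => t; last by move=> [y _ [/= <-]].
  by rewrite /C/= => h; exists (nearest f x n t).
rewrite (_ : (fun t => _) = patch (nearest f x n) C (cst (x n))).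
  by apply: simple_patch => //; exact: simple_cst.
apply/funext => t; rewrite /patch; case: ifPn => tC.
  by rewrite mem_set.
by rewrite memNset//; exact/negP.
Qed.

(** The Pettis-type characterization: strong measurability amounts to
    separability of the range and measurability of the preimages of balls. *)
Lemma sm_separableP (X : normedModType K) (f : T -> X) :
  strongly_measurable G f <->
  ball_measurable f /\ exists x, separable_range f x.
Proof.
split=> [sf|[bf [x fx]]].
  by split; [exact: sm_ball_measurable|exact: sm_separable_range].
exists (nearest f x); split; first by move=> n; exact: nearest_simple.
by move=> t; exact: nearest_cvg.
Qed.

Lemma sm_limit (X : normedModType K) (s : nat -> T -> X) f :
  (forall n, strongly_measurable G (s n)) ->
  (forall t, s n t @[n --> \oo] --> f t) -> strongly_measurable G f.
Proof.
move=> ss sf; apply/sm_separableP; split.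
  by apply: limit_ball_measurable sf => n; exact: sm_ball_measurable.
by apply: limit_separable_range sf => n; exact: sm_separable_range.
Qed.

(** Simple approximations that stay within [rnorm (f t)] of [f t], so that
    dominated convergence applies to them. *)
Lemma sm_dominated_approx (X : normedModType K) (f : T -> X) :
  strongly_measurable G f -> exists s : nat -> T -> X,
  [/\ forall n, simple_for G (s n),
      forall t, s n t @[n --> \oo] --> f t &
      forall n t, rnorm (f t - s n t) <= rnorm (f t)].
Proof.
move=> /sm_separableP[bf [x fx]]; exists (nearest f x); split.
- by move=> n; exact: nearest_simple.
- by move=> t; exact: nearest_cvg.
- by move=> n t; exact: nearest_dist0.
Qed.

Lemma sm_rnorm_lt (X : normedModType K) (f : T -> X) (r : R) :
  strongly_measurable G f -> G [set t | rnorm (f t) < r].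
Proof.
move=> /sm_ball_measurable/(_ 0 r).
by under eq_set do rewrite subr0.
Qed.

End strong_measurability.

Lemma sm_sub (R : realType) (k : scalar_kind) (X : normedModType (scalars R k))
    (T : Type) (G G' : set (set T)) (f : T -> X) :
  G `<=` G' -> strongly_measurable G f -> strongly_measurable G' f.
Proof.
move=> GG [s [ss sf]]; exists s; split => // n; have [fs Gs] := ss n.
by split => // y; apply: GG.
Qed.

Lemma sm_comp_measurable (R : realType) (k : scalar_kind)
    (X : normedModType (scalars R k)) d d' (T : measurableType d)
    (T' : measurableType d') (h : T -> T') (f : T' -> X) :
  measurable_fun setT h -> strongly_measurable measurable f ->
  strongly_measurable measurable (f \o h).
Proof.
move=> mh [s [ss sf]]; exists (fun n => s n \o h); split; last by move=> t; exact: sf.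
move=> n; have [fs Gs] := ss n; split.
  by apply: (sub_finite_set _ fs) => _ [t _ <-]; exists (h t).
by move=> y; rewrite comp_preimage -[X in measurable X]setTI; exact: mh.
Qed.

Lemma measurable_rnorm (R : realType) (k : scalar_kind)
    (X : normedModType (scalars R k)) d (T : measurableType d) (f : T -> X) :
  strongly_measurable measurable f -> measurable_fun setT (fun t => rnorm (f t)).
Proof.
move=> sf; apply: (measurability _ (RGenInftyO.measurableE R)) => //.
move=> _ [_ [r ->] <-]; rewrite setTI.
rewrite (_ : _ @^-1` _ = [set t | rnorm (f t) < r]).
  by apply: sm_rnorm_lt.
by apply/seteqP; split => t /=; rewrite in_itv.
Qed.

Lemma measurable_enorm (R : realType) (k : scalar_kind)
    (X : normedModType (scalars R k)) d (T : measurableType d) (f : T -> X) :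
  strongly_measurable measurable f -> measurable_fun setT (fun t => enorm (f t)).
Proof. by move=> /measurable_rnorm mf; exact/measurable_EFinP. Qed.

(** * The Bochner integral over a finite measure *)

Lemma fsbig_single (V : nmodType) (I : choiceType) (D : set I) (a : I)
    (F : I -> V) : finite_set D -> D a -> (forall i, i != a -> F i = 0) ->
  \sum_(i \in D) F i = F a.
Proof.
move=> fD Da F0; rewrite (fsbigD1 a)//= fsbig1 ?addr0// => i [_ /= ia].
by apply: F0; apply/eqP.
Qed.

Lemma fsbige_single (R : numDomainType) (I : choiceType) (D : set I) (a : I)
    (F : I -> \bar R) : finite_set D -> D a -> (forall i, i != a -> F i = 0%E) ->
  (\sum_(i \in D) F i = F a)%E.
Proof.
move=> fD Da F0; rewrite (fsbigD1 a)//= fsbig1 ?adde0// => i [_ /= ia].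
by apply: F0; apply/eqP.
Qed.

Lemma scaler_fsumr (A : pzRingType) (V : lmodType A) (I : choiceType)
    (D : set I) (c : A) (F : I -> V) : finite_set D ->
  c *: (\sum_(i \in D) F i) = \sum_(i \in D) c *: F i.
Proof. by move=> fD; rewrite !fsbig_finite// scaler_sumr. Qed.

Lemma scaler_fsuml (A : pzRingType) (V : lmodType A) (I : choiceType)
    (D : set I) (F : I -> A) (x : V) : finite_set D ->
  (\sum_(i \in D) F i) *: x = \sum_(i \in D) F i *: x.
Proof. by move=> fD; rewrite !fsbig_finite// scaler_suml. Qed.

(** Dominated convergence to zero, for real-valued functions. *)
Lemma integral_cvg0 (R : realType) d (T : measurableType d)
    (m : {measure set T -> \bar R}) (u : nat -> T -> R) (v : T -> R) :
  (forall n, measurable_fun setT (u n)) -> measurable_fun setT v ->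
  (forall n t, 0 <= u n t <= v t) -> (\int[m]_t (v t)%:E < +oo)%E ->
  (\forall t \ae m, u n t @[n --> \oo] --> (0 : R)) ->
  (\int[m]_t (u n t)%:E)%E @[n --> \oo] --> (0 : \bar R).
Proof.
move=> mu mv uv vfin u0.
have v0 t : 0 <= v t by have /andP[] := uv 0%N t; exact: le_trans.
have [|||||_ _] := @dominated_convergence _ _ _ m setT measurableT
  (fun n t => (u n t)%:E) (cst 0%E) (fun t => (v t)%:E).
- by move=> n; exact/measurable_EFinP.
- exact: measurable_cst.
- apply: filterS u0 => t ut _.
  by apply/fine_cvgP; split => //; exact: nearW.
- apply/integrableP; split; first exact/measurable_EFinP.
  by under eq_integral do rewrite gee0_abs ?lee_fin//.
- apply: aeW => t n _; have /andP[u0t utv] := uv n t.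
  by rewrite gee0_abs ?lee_fin.
by rewrite integral0.
Qed.

Section simple_integral.
Context (R : realType) (k : scalar_kind) d (T : measurableType d).
Variable m : {measure set T -> \bar R}.
Hypothesis mfin : (m setT < +oo)%E.
Local Notation K := (scalars R k).

Lemma fin_mass A : measurable A -> m A \is a fin_num.
Proof.
move=> mA; rewrite ge0_fin_numE//; apply: le_lt_trans mfin.
by rewrite le_measure ?inE.
Qed.

Lemma of_real_sum (I : choiceType) (D : set I) (F : I -> R) : finite_set D ->
  of_real k (\sum_(i \in D) F i) = \sum_(i \in D) of_real k (F i).
Proof.
move=> fD; rewrite !fsbig_finite//.
by elim/big_ind2 : _ => [|? ? ? ? <- <-|//]; rewrite ?of_real0 ?of_realD.
Qed.

Lemma fine_fsum (I : choiceType) (D : set I) (F : I -> \bar R) : finite_set D ->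
  (forall i, D i -> F i \is a fin_num) ->
  fine (\sum_(i \in D) F i)%E = \sum_(i \in D) fine (F i).
Proof.
move=> fD finF.
rewrite (eq_fsbigr (fun i => (fine (F i))%:E)); first by rewrite fsumEFin.
by move=> i; rewrite inE => /finF Fi; rewrite fineK.
Qed.

(** The integral of [h \o s] may be computed on the level sets of [s], which
    refine those of [h \o s]; with [s] a pair of simple functions this gives
    additivity. *)
Lemma simple_integral_comp (Y : choiceType) (X : normedModType K) (s : T -> Y)
    (h : Y -> X) : simple_for measurable s ->
  simple_integral m (h \o s) =
  \sum_(y \in range s) of_real k (fine (m (s @^-1` [set y]))) *: h y.
Proof.
move=> ss; have [fs ms] := ss.
have fhs : finite_set (range (h \o s)) by
  have [] := simple_comp (sigma_algebra_measurable T) h ss.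
rewrite /simple_integral.
transitivity (\sum_(x \in range (h \o s)) \sum_(y \in range s)
    (if y \in h @^-1` [set x] then of_real k (fine (m (s @^-1` [set y])))
     else 0) *: x).
  apply: eq_fsbigr => x _; rewrite -scaler_fsuml//; congr (_ *: _).
  rewrite -fsbig_mkcondr -of_real_sum; last exact: finite_setIl.
  congr of_real; rewrite -fine_fsum; last 2 first.
    exact: finite_setIl.
    by move=> y _; apply: fin_mass.
  congr fine; rewrite -measure_fin_bigcup//; last 2 first.
    exact: finite_setIl.
    by move=> a b _ _ [t [/= -> ->]].
  congr (m _); apply/seteqP; split => t /=.
    by move=> hx; exists (s t).
  by move=> [y [_ /= <-] ->].
rewrite exchange_fsbig//; apply: eq_fsbigr => y; rewrite inE => -[t _ <-].
etransitivity; first (apply: (@fsbig_single _ _ _ (h (s t))) => //).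
  by move=> x xh; rewrite memNset ?scale0r//= => hx; move/eqP: xh; rewrite hx.
by rewrite mem_set.
Qed.

Lemma integral_simple (Y : choiceType) (s : T -> Y) (h : Y -> R) :
  simple_for measurable s -> (forall y, 0 <= h y) ->
  (\int[m]_t (h (s t))%:E =
   (\sum_(y \in range s) fine (m (s @^-1` [set y])) * h y)%:E)%E.
Proof.
move=> [fs ms] h0.
transitivity (\int[m]_t \sum_(y \in range s)
    ((h y)%:E * (\1_(s @^-1` [set y]) t)%:E))%E.
  apply: eq_integral => t _; apply/esym.
  etransitivity; first (apply: (@fsbige_single _ _ _ (s t)) => //).
    by move=> y ys; rewrite indicE memNset ?mule0//= => e; move: ys; rewrite e eqxx.
  by rewrite indicE mem_set//= mule1.
rewrite ge0_integral_fsum//; last 2 first.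
- by move=> y; apply/measurable_EFinP; exact: measurable_funM.
- by move=> y t _; rewrite mule_ge0 ?lee_fin.
rewrite -fsumEFin//; apply: eq_fsbigr => y _.
rewrite ge0_integralZl_EFin//; last exact/measurable_EFinP.
by rewrite integral_indic// setIT EFinM fineK ?fin_mass// muleC.
Qed.

Section vector.
Variable X : normedModType K.

Lemma simple_integralD (s s' : T -> X) :
  simple_for measurable s -> simple_for measurable s' ->
  simple_integral m (fun t => s t + s' t) =
  simple_integral m s + simple_integral m s'.
Proof.
move=> ss ss'; have ssp := simple_pair (sigma_algebra_measurable _) ss ss'.
have fsp : finite_set (range (fun t => (s t, s' t))) by case: ssp.
rewrite (simple_integral_comp (fun z => z.1 + z.2) ssp).
rewrite (simple_integral_comp fst ssp) (simple_integral_comp snd ssp).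
rewrite -fsbig_split//=; apply: eq_fsbigr => z _.
by rewrite scalerDr.
Qed.

Lemma simple_integralZ (c : K) (s : T -> X) : simple_for measurable s ->
  simple_integral m (fun t => c *: s t) = c *: simple_integral m s.
Proof.
move=> ss; rewrite (simple_integral_comp (fun x => c *: x) ss) scaler_fsumr.
  by apply: eq_fsbigr => x _; rewrite !scalerA mulrC.
by case: ss.
Qed.

Lemma simple_integralZr (s : T -> K^o) (x : X) : simple_for measurable s ->
  simple_integral m (fun t => (s t : K) *: x) = (simple_integral m s : K) *: x.
Proof.
move=> ss; rewrite (simple_integral_comp (fun c : K^o => (c : K) *: x) ss).
rewrite scaler_fsuml; last by case: ss.
by apply: eq_fsbigr => y _; rewrite scalerA.
Qed.

Lemma simple_integralB (s s' : T -> X) :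
  simple_for measurable s -> simple_for measurable s' ->
  simple_integral m (fun t => s t - s' t) =
  simple_integral m s - simple_integral m s'.
Proof.
move=> ss ss'; rewrite -scaleN1r -simple_integralZ// -simple_integralD//.
  by congr (simple_integral m _); apply/funext => t; rewrite scaleN1r.
exact: (simple_comp (sigma_algebra_measurable T) (fun x => -1 *: x) ss').
Qed.

Lemma simple_integral_norm (s : T -> X) : simple_for measurable s ->
  ((rnorm (simple_integral m s))%:E <= \int[m]_t enorm (s t))%E.
Proof.
move=> ss; rewrite (integral_simple ss (@rnorm_ge0 _ _ X)) lee_fin.
rewrite /simple_integral !fsbig_finite; try by case: ss.
elim/big_ind2 : _ => [|x r y r' xr yr'|x _]; first by rewrite rnorm0.
  by rewrite (le_trans (ler_rnormD _ _))// lerD.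
by rewrite rnormZr ger0_norm// fine_ge0.
Qed.

End vector.
End simple_integral.

Lemma lee_cvg0 (R : realType) (x y : \bar R) (e : nat -> \bar R) :
  (0 <= y)%E -> (forall n, x <= y + e n)%E ->
  e n @[n --> \oo] --> (0 : \bar R) -> (x <= y)%E.
Proof.
move=> y0 xye e0.
have ye : (y + e n)%E @[n --> \oo] --> (y + 0)%E.
  apply: cvgeD; [|exact: cvg_cst|exact: e0].
  by rewrite fin_num_adde_defl.
rewrite -(adde0 y) -(cvg_lim _ ye)//; apply: lime_ge.
  by apply/cvg_ex; exists (y + 0)%E.
exact: nearW.
Qed.

Section bochner_integral.
Context (R : realType) (k : scalar_kind) d (T : measurableType d).
Variable m : {measure set T -> \bar R}.
Hypothesis mfin : (m setT < +oo)%E.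
Local Notation K := (scalars R k).
Let HT := sigma_algebra_measurable T.
Local Notation sm := (strongly_measurable measurable).

Section any_space.
Variable X : normedModType K.
Implicit Types f g h : T -> X.

Lemma ge0_le_integral_enorm f (u : T -> \bar R) : sm f ->
  measurable_fun setT u -> (forall t, enorm (f t) <= u t)%E ->
  (\int[m]_t enorm (f t) <= \int[m]_t u t)%E.
Proof.
move=> sf mu fu; apply: ge0_le_integral => //.
- by move=> t _; rewrite lee_fin rnorm_ge0.
- exact: measurable_enorm.
Qed.

Lemma integral_enorm_le f (Y : normedModType K) (g : T -> Y) : sm f -> sm g ->
  (forall t, rnorm (f t) <= rnorm (g t)) ->
  (\int[m]_t enorm (f t) <= \int[m]_t enorm (g t))%E.
Proof.
move=> sf sg fg; by apply: ge0_le_integral_enorm => //; exact: measurable_enorm.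
Qed.

Lemma integral_enormD f g h : sm f -> sm g -> sm h ->
  (forall t, rnorm (f t) <= rnorm (g t) + rnorm (h t)) ->
  (\int[m]_t enorm (f t) <= \int[m]_t enorm (g t) + \int[m]_t enorm (h t))%E.
Proof.
have e0 (h' : T -> X) t : setT t -> (0 <= enorm (h' t))%E.
  by rewrite lee_fin rnorm_ge0.
move=> sf sg sh fgh; have mg := measurable_enorm sg; have mh := measurable_enorm sh.
rewrite -(ge0_integralD _ measurableT (e0 g) mg (e0 h) mh).
by apply: ge0_le_integral_enorm => //; exact: emeasurable_funD.
Qed.

Lemma integral_enorm_tri g f h : sm f -> sm g -> sm h ->
  (\int[m]_t enorm (f t - h t)%R <=
   \int[m]_t enorm (f t - g t)%R + \int[m]_t enorm (g t - h t)%R)%E.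
Proof.
move=> sf sg sh; apply: integral_enormD; try exact: sm_B.
by move=> t; exact: rnorm_tri.
Qed.

Lemma integral_enorm_ge0 f : (0 <= \int[m]_t enorm (f t))%E.
Proof. by apply: integral_ge0 => t _; rewrite lee_fin rnorm_ge0. Qed.

Lemma integral_enormZ (c : K) f : sm f ->
  (\int[m]_t enorm (c *: f t)%R =
   (rnorm (c : K^o))%:E * \int[m]_t enorm (f t))%E.
Proof.
move=> sf; rewrite -ge0_integralZl_EFin ?rnorm_ge0//.
- by apply: eq_integral => t _; rewrite /enorm rnormZ EFinM.
- by move=> t _; rewrite lee_fin rnorm_ge0.
- exact: measurable_enorm.
Qed.

(** An integrable strongly [G]-measurable function is a limit in [L^1] of
    [G]-simple functions. *)
Lemma simple_approx_L1 f (G : set (set T)) : sigma_algebra setT G ->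
  G `<=` measurable -> strongly_measurable G f ->
  (\int[m]_t enorm (f t) < +oo)%E ->
  exists s : nat -> T -> X, (forall n, simple_for G (s n)) /\
    (\int[m]_t enorm (f t - s n t)%R)%E @[n --> \oo] --> (0 : \bar R).
Proof.
move=> HG Gm /[dup] /(sm_sub Gm) sf /(sm_dominated_approx HG)[s [ss sc sb]] fi.
have sms n : sm (s n) by apply: (sm_sub Gm); exact: simple_sm.
exists s; split => //.
apply: (@integral_cvg0 _ _ _ _ _ (fun t => rnorm (f t))) => //.
- by move=> n; apply: measurable_rnorm; exact: sm_B.
- exact: measurable_rnorm.
- by move=> n t; rewrite rnorm_ge0 sb.
apply: aeW => t; under eq_cvg do rewrite rnormB.
exact/cvg_rnormP.
Qed.

Lemma has_bochner_integral_norm f v : sm f -> has_bochner_integral m f v ->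
  ((rnorm v)%:E <= \int[m]_t enorm (f t))%E.
Proof.
move=> sf [s [ss fs sv]].
apply: (@lee_cvg0 _ _ _ (fun n => (\int[m]_t enorm (f t - s n t)%R +
  (rnorm (simple_integral m (s n) - v))%:E)%E)).
- exact: integral_enorm_ge0.
- move=> n.
  have sms : sm (s n) by apply: simple_sm.
  rewrite addeA.
  apply: (@le_trans _ _ ((rnorm (simple_integral m (s n)))%:E +
    (rnorm (simple_integral m (s n) - v))%:E)%E).
    by rewrite -EFinD lee_fin (rnormB _ v) addrC ler_rnorm_sub.
  rewrite leeD2r// (le_trans (simple_integral_norm mfin (ss n)))//.
  apply: integral_enormD => //; first exact: sm_B.
  by move=> t; rewrite (rnormB (f t)) addrC ler_rnorm_sub.
- rewrite -[X in _ --> X](adde0 0); apply: cvgeD => //.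
  by move/cvg_rnormP : sv => sv; apply/fine_cvgP; split => //; exact: nearW.
Qed.

Lemma has_bochner_integral_lin f g v w (c : K) : sm f -> sm g ->
  has_bochner_integral m f v -> has_bochner_integral m g w ->
  has_bochner_integral m (fun t => c *: f t + g t) (c *: v + w).
Proof.
move=> sf sg [s [ss fs sv]] [s' [ss' gs' sw]].
have sms n : sm (s n) by apply: simple_sm.
have sms' n : sm (s' n) by apply: simple_sm.
have scs n : simple_for measurable (fun t => c *: s n t).
  exact: (simple_comp HT (fun x => c *: x) (ss n)).
exists (fun n t => c *: s n t + s' n t); split.
- by move=> n; apply: (simple_comp2 HT).
- apply: (@squeeze_cvge _ _ _ _ (cst 0%E) _
    (fun n => ((rnorm (c : K^o))%:E * \int[m]_t enorm (f t - s n t)%R +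
               \int[m]_t enorm (g t - s' n t)%R)%E)).
  + apply: nearW => n; rewrite integral_enorm_ge0/=.
    rewrite -integral_enormZ; last exact: sm_B.
    apply: integral_enormD.
    * apply: sm_B => //; apply: sm_D => //; exact: sm_cstZ.
    * by apply: sm_cstZ => //; exact: sm_B.
    * exact: sm_B.
    move=> t; rewrite (le_trans _ (ler_rnormD _ _))// scalerBr.
    by rewrite opprD addrACA.
  + exact: cvg_cst.
  + rewrite -[X in _ --> X](adde0 0); apply: cvgeD => //.
    by rewrite -[X in _ --> X](mule0 (rnorm (c : K^o))%:E); exact: cvgeZl.
- under eq_cvg do rewrite (simple_integralD mfin (scs _) (ss' _))
    (simple_integralZ mfin c (ss _)).
  by apply: cvgD => //; exact: cvgZr.
Qed.

Lemma has_bochner_integral_unique f v w : sm f ->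
  has_bochner_integral m f v -> has_bochner_integral m f w -> v = w.
Proof.
move=> sf fv fw; have := has_bochner_integral_lin (-1) sf sf fv fw.
move=> /has_bochner_integral_norm; rewrite scaleN1r addrC => H.
apply/esym/subr0_eq/rnorm_eq0/eqP; rewrite eq_le rnorm_ge0 andbT -lee_fin.
rewrite (le_trans (H _))//.
  by apply: sm_D => //; exact: sm_cstZ.
under eq_integral do rewrite /enorm scaleN1r addNr rnorm0.
by rewrite integral0.
Qed.

Lemma bochner_integralE f v : sm f -> has_bochner_integral m f v ->
  bochner_integral m f = v.
Proof.
move=> sf fv; apply: (has_bochner_integral_unique sf _ fv).
by rewrite /bochner_integral; apply: xgetPex; exists v.
Qed.

Lemma has_bochner_integral_simple (s : T -> X) : simple_for measurable s ->
  has_bochner_integral m s (simple_integral m s).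
Proof.
move=> ss; exists (fun _ => s); split; [by []| |exact: cvg_cst].
rewrite [X in X @ \oo --> _](_ : _ = cst 0%E); first exact: cvg_cst.
apply/funext => n; under eq_integral do rewrite /enorm subrr rnorm0.
by rewrite integral0.
Qed.

Lemma bochner_integral_simple (s : T -> X) : simple_for measurable s ->
  bochner_integral m s = simple_integral m s.
Proof.
move=> ss; apply: bochner_integralE; first exact: simple_sm.
exact: has_bochner_integral_simple.
Qed.

Lemma has_bochner_integral_ex f : seq_complete X -> bochner_integrable m f ->
  exists v, has_bochner_integral m f v.
Proof.
move=> cX [sf fi].
have [s [ss s0]] := simple_approx_L1 HT (@subset_refl _ _) sf fi.
have sms n : sm (s n) by apply: simple_sm.
have [e e0|v sv] := cX (fun n => simple_integral m (s n)); last by exists v, s.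
have /fine_cvgP[[N0 _ HN0]] := s0.
have e20 : 0 < e / 2 by rewrite divr_gt0.
move=> /cvgrPdist_lt /(_ _ e20)[N1 _ HN1]; exists (maxn N0 N1) => i j.
rewrite !geq_max => /andP[iN0 iN1] /andP[jN0 jN1].
have sE i' : (N0 <= i')%N -> (N1 <= i')%N ->
    (\int[m]_t enorm (f t - s i' t)%R < (e / 2)%:E)%E.
  move=> iN0' iN1'; rewrite -(fineK (HN0 i' iN0')) lte_fin.
  have := HN1 i' iN1'; rewrite /= sub0r normrN ger0_norm//.
  by rewrite fine_ge0// integral_enorm_ge0.
rewrite -lte_fin -(simple_integralB mfin)//.
apply: le_lt_trans (simple_integral_norm mfin _) _.
  exact: (simple_comp2 HT (fun x y => x - y)).
apply: le_lt_trans (integral_enorm_tri (sms i) sf (sms j)) _.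
rewrite [e]splitr EFinD lteD ?sE//.
by under eq_integral do rewrite /enorm rnormB; exact: sE.
Qed.

Lemma bochner_integralP f : seq_complete X -> bochner_integrable m f ->
  has_bochner_integral m f (bochner_integral m f).
Proof.
move=> cX /(has_bochner_integral_ex cX) ex.
by rewrite /bochner_integral; exact: xgetPex.
Qed.

Lemma bochner_integrableD f g : bochner_integrable m f -> bochner_integrable m g ->
  bochner_integrable m (fun t => f t + g t).
Proof.
move=> [sf fi] [sg gi]; have sfg := sm_D HT sf sg; split => //.
apply: (@le_lt_trans _ _ (\int[m]_t enorm (f t) + \int[m]_t enorm (g t))%E).
  by apply: integral_enormD => // t; exact: ler_rnormD.
exact: lte_add_pinfty.
Qed.

Lemma bochner_integrableZ (c : K) f : bochner_integrable m f ->
  bochner_integrable m (fun t => c *: f t).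
Proof.
move=> [sf fi]; split; first exact: sm_cstZ.
by rewrite integral_enormZ// lte_mul_pinfty// ?lee_fin ?rnorm_ge0.
Qed.

Lemma bochner_integrableB f g : bochner_integrable m f -> bochner_integrable m g ->
  bochner_integrable m (fun t => f t - g t).
Proof.
move=> fi /(bochner_integrableZ (-1)) /(bochner_integrableD fi).
by under eq_fun do rewrite scaleN1r.
Qed.

Lemma bochner_integrable_patch f C : measurable C -> bochner_integrable m f ->
  bochner_integrable m (patch (cst 0) C f).
Proof.
move=> mC [sf fi]; have sp : sm (patch (cst 0) C f).
  by apply: sm_patch => //; exact: sm_cst.
split => //; apply: le_lt_trans fi; apply: integral_enorm_le => // t.
by rewrite /patch; case: ifP => // _; rewrite rnorm0 rnorm_ge0.
Qed.

Lemma bochner_integrable_bounded f (M : R) : sm f -> (forall t, rnorm (f t) <= M) ->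
  bochner_integrable m f.
Proof.
move=> sf fM; split => //.
apply: (@le_lt_trans _ _ (\int[m]_t M%:E)%E).
  by apply: ge0_le_integral_enorm => // t; rewrite lee_fin.
rewrite integral_cst//= lte_mul_pinfty// lee_fin.
exact: le_trans (rnorm_ge0 (f point)) (fM point).
Qed.

End any_space.
End bochner_integral.

Section bochner_integral_theory.
Context (R : realType) (k : scalar_kind) d (T : measurableType d).
Variable m : {measure set T -> \bar R}.
Hypothesis mfin : (m setT < +oo)%E.
Local Notation K := (scalars R k).
Let HT := sigma_algebra_measurable T.
Local Notation sm := (strongly_measurable measurable).

Section complete_space.
Variable X : normedModType K.
Hypothesis cX : seq_complete X.
Implicit Types f g h : T -> X.

Lemma bochner_integral_lin (c : K) f g :
  bochner_integrable m f -> bochner_integrable m g ->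
  bochner_integral m (fun t => c *: f t + g t) =
  c *: bochner_integral m f + bochner_integral m g.
Proof.
move=> fi gi; have [sf _] := fi; have [sg _] := gi.
apply: (bochner_integralE mfin).
  by apply: sm_D => //; exact: sm_cstZ.
by apply: (has_bochner_integral_lin mfin) => //; exact: (bochner_integralP mfin).
Qed.

Lemma bochner_integralB f g :
  bochner_integrable m f -> bochner_integrable m g ->
  bochner_integral m (fun t => f t - g t) =
  bochner_integral m f - bochner_integral m g.
Proof.
move=> fi gi; have := bochner_integral_lin (-1) gi fi.
rewrite scaleN1r addrC => <-; congr bochner_integral.
by apply/funext => t; rewrite scaleN1r addrC.
Qed.

Lemma bochner_integral_norm f : bochner_integrable m f ->
  ((rnorm (bochner_integral m f))%:E <= \int[m]_t enorm (f t))%E.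
Proof.
move=> fi; have [sf _] := fi.
by apply: (has_bochner_integral_norm mfin) => //; exact: (bochner_integralP mfin).
Qed.

Lemma integral_partition (Y : choiceType) (s : T -> Y) f :
  simple_for measurable s -> sm f ->
  (\sum_(y \in range s)
     \int[m]_t enorm (patch (cst 0%R) (s @^-1` [set y]) f t) =
   \int[m]_t enorm (f t))%E.
Proof.
move=> [fs ms] sf; rewrite -ge0_integral_fsum//; last 2 first.
- move=> y; apply: measurable_enorm; apply: sm_patch => //; exact: sm_cst.
- by move=> y t _; rewrite lee_fin rnorm_ge0.
apply: eq_integral => t _; etransitivity.
  apply: (@fsbige_single _ _ _ (s t)) => // y ys.
  by rewrite /patch memNset /enorm ?rnorm0//= => e; move: ys; rewrite e eqxx.
by rewrite /patch mem_set.
Qed.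

Lemma bochner_integral_simple_patch (s : T -> X) x : simple_for measurable s ->
  range s x ->
  bochner_integral m (patch (cst 0) (s @^-1` [set x]) s) =
  of_real k (fine (m (s @^-1` [set x]))) *: x.
Proof.
move=> ss sx; have [fs ms] := ss.
have e : patch (cst 0) (s @^-1` [set x]) s = (fun y => if y == x then y else 0) \o s.
  apply/funext => t; rewrite /patch/=; case: eqVneq => [<-|sx'].
    by rewrite mem_set.
  by rewrite memNset//=; apply/eqP.
rewrite e (bochner_integral_simple mfin); last exact: (simple_comp HT).
rewrite (simple_integral_comp mfin _ ss).
etransitivity; first (apply: (@fsbig_single _ _ _ x) => //).
  by move=> y /negbTE ->; rewrite scaler0.
by rewrite eqxx.
Qed.

End complete_space.

Lemma bochner_integrableZr (X : normedModType K) (h : T -> K^o) (x : X) :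
  bochner_integrable m h -> bochner_integrable m (fun t => (h t : K) *: x).
Proof.
move=> [sh hi]; split; first by apply: sm_Z => //; exact: sm_cst.
rewrite (_ : (fun t => _) = (fun t => (rnorm x)%:E * enorm (h t))%E).
  rewrite ge0_integralZl_EFin ?rnorm_ge0//.
  - by rewrite lte_mul_pinfty// ?lee_fin ?rnorm_ge0.
  - by move=> t _; rewrite lee_fin rnorm_ge0.
  - exact: measurable_enorm.
by apply/funext => t; rewrite /enorm rnormZ mulrC.
Qed.

Lemma bochner_integralZr (X : normedModType K) (h : T -> K^o) (x : X) :
  bochner_integrable m h ->
  bochner_integral m (fun t => (h t : K) *: x) =
  (bochner_integral m h : K) *: x.
Proof.
move=> hi; have [sh _] := hi.
have [s [ss hs sv]] := bochner_integralP mfin (@scalars_seq_complete R k) hi.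
have sms n : sm (s n) by apply: simple_sm.
apply: (bochner_integralE mfin); first by apply: sm_Z => //; exact: sm_cst.
exists (fun n t => (s n t : K) *: x); split.
- by move=> n; apply: (simple_comp HT (fun c : K^o => (c : K) *: x)).
- rewrite [X in X @ \oo --> _](_ : _ =
    (fun n => (rnorm x)%:E * \int[m]_t enorm (h t - s n t)%R)%E).
    by rewrite -[X in _ --> X](mule0 (rnorm x)%:E); exact: cvgeZl.
  apply/funext => n; rewrite -ge0_integralZl_EFin ?rnorm_ge0//.
  + by apply: eq_integral => t _; rewrite -scalerBl /enorm rnormZ mulrC.
  + by move=> t _; rewrite lee_fin rnorm_ge0.
  + by apply: measurable_enorm; exact: sm_B.
- under eq_cvg do rewrite (simple_integralZr mfin _ (ss _)).
  by apply: cvgZ => //; exact: cvg_cst.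
Qed.

End bochner_integral_theory.

Section patch.
Context (T : Type) (V : zmodType).
Implicit Types (f g : T -> V) (C D : set T).

Lemma patchI C D f :
  patch (cst 0) D (patch (cst 0) C f) = patch (cst 0) (D `&` C) f.
Proof.
by apply/funext => t; rewrite /patch in_setI; case: (t \in D); case: (t \in C).
Qed.

Lemma patchB C f g :
  patch (cst 0) C (fun t => f t - g t) =
  (fun t => patch (cst 0) C f t - patch (cst 0) C g t).
Proof. by apply/funext => t; rewrite /patch; case: ifP; rewrite ?subr0. Qed.

End patch.

(** * Conditional expectations in Banach spaces *)

Section condexp_theory.
Context (R : realType) (k : scalar_kind) d (T : measurableType d).
Variable m : {measure set T -> \bar R}.
Hypothesis mfin : (m setT < +oo)%E.
Variable F : set (set T).
Hypothesis HF : sigma_algebra [set: T] F.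
Hypothesis F_sub : F `<=` measurable.
Local Notation K := (scalars R k).
Let HT := sigma_algebra_measurable T.
Local Notation sm := (strongly_measurable measurable).
Local Notation smF := (strongly_measurable F).

Section Banach.
Variable X : normedModType K.
Hypothesis cX : seq_complete X.
Implicit Types f g : T -> X.

(** On a level set [D] of [s], [m D] times the norm of the value of [s] is the
    norm of the integral of [s], and the integral of [g] over [D] is that of
    [f]. *)
Lemma integral_enorm_condexp_simple f g (s : T -> X) :
  bochner_integrable m f -> bochner_integrable m g -> simple_for F s ->
  (forall C, F C -> bochner_integral m (patch (cst 0) C g) =
                    bochner_integral m (patch (cst 0) C f)) ->
  (\int[m]_t enorm (s t) <=
   \int[m]_t enorm (f t) + \int[m]_t enorm (s t - g t)%R)%E.
Proof.
move=> fi gi ssF gf; have [sf fi'] := fi; have [sg gi'] := gi.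
have ss : simple_for measurable s.
  by case: ssF => fs Fs; split => // x; apply: F_sub.
have ssm : sm s := simple_sm ss.
have [fs ms] := ss.
rewrite (integral_simple mfin ss (@rnorm_ge0 _ _ X)) -fsumEFin//.
rewrite -(integral_partition m ss sf) -(integral_partition m ss (sm_B HT ssm sg)).
rewrite -fsbig_split//=; apply: lee_fsum => // x sx.
set D := s @^-1` [set x].
have mD : measurable D by exact: ms.
have FD : F D by case: ssF => _; apply.
have int_s : bochner_integrable m s.
  split => //; rewrite (integral_simple mfin ss (@rnorm_ge0 _ _ X)).
  exact: ltry.
have -> : fine (m D) * rnorm x =
    rnorm (bochner_integral m (patch (cst 0) D s)).
  by rewrite (bochner_integral_simple_patch mfin ss sx) rnormZr ger0_norm ?fine_ge0.
have Df := bochner_integrable_patch mD fi.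
have Dg := bochner_integrable_patch mD gi.
have Ds := bochner_integrable_patch mD int_s.
have Dsg : bochner_integrable m (patch (cst 0) D (fun t => s t - g t)).
  by apply: bochner_integrable_patch => //; exact: bochner_integrableB.
apply: (@le_trans _ _ ((rnorm (bochner_integral m (patch (cst 0) D f)))%:E +
  (rnorm (bochner_integral m (patch (cst 0) D (fun t => (s t - g t)%R))))%:E)%E).
  rewrite -gf// patchB (bochner_integralB mfin)// -EFinD lee_fin.
  by rewrite addrC ler_rnorm_sub.
by apply: leeD; exact: (bochner_integral_norm mfin).
Qed.

(** The [F]-simple approximations of [g] satisfy the inequality up to an error
    that tends to zero. *)
Lemma integral_enorm_condexp f g :
  bochner_integrable m f -> bochner_integrable m g -> smF g ->
  (forall C, F C -> bochner_integral m (patch (cst 0) C g) =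
                    bochner_integral m (patch (cst 0) C f)) ->
  (\int[m]_t enorm (g t) <= \int[m]_t enorm (f t))%E.
Proof.
move=> fi gi sFg gf; have [sf fi'] := fi; have [sg gi'] := gi.
have [s [ss s0]] := simple_approx_L1 HF F_sub sFg gi'.
have s0' : (\int[m]_t enorm (s n t - g t)%R)%E @[n --> \oo] --> (0 : \bar R).
  apply: cvg_trans s0; apply: near_eq_cvg; apply: nearW => n.
  by apply: eq_integral => t _; rewrite /enorm rnormB.
apply: (@lee_cvg0 _ _ _ (fun n => (\int[m]_t enorm (s n t - g t)%R +
  \int[m]_t enorm (g t - s n t)%R)%E)).
- exact: integral_enorm_ge0.
- move=> n; have ssm : sm (s n) by apply: (sm_sub F_sub); exact: simple_sm.
  apply: (@le_trans _ _ (\int[m]_t enorm (s n t) +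
    \int[m]_t enorm (g t - s n t)%R)%E).
    apply: integral_enormD => //; first exact: sm_B.
    by move=> t; rewrite addrC ler_rnorm_sub.
  rewrite [leRHS]addeA leeD2r//.
  exact: integral_enorm_condexp_simple.
- by rewrite -[X in _ --> X](adde0 0); apply: cvgeD.
Qed.

(** Conditional expectation contracts the [L^1] norm on every set of the
    sub-sigma-algebra; this is where strong [F]-measurability is used. *)
Lemma condexp_contraction f g C : bochner_integrable m f ->
  is_condexp m F f g -> F C ->
  (\int[m]_t enorm (patch (cst 0%R) C g t) <=
   \int[m]_t enorm (patch (cst 0%R) C f t))%E.
Proof.
move=> fi [gi sg gf] FC; apply: integral_enorm_condexp.
- by apply: bochner_integrable_patch => //; exact: F_sub.
- by apply: bochner_integrable_patch => //; exact: F_sub.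
- by apply: sm_patch => //; exact: sm_cst.
- by move=> D FD; rewrite !patchI gf//; exact: sa_setI.
Qed.

Lemma condexp_contractionT f g : bochner_integrable m f ->
  is_condexp m F f g ->
  (\int[m]_t enorm (g t) <= \int[m]_t enorm (f t))%E.
Proof.
move=> fi /(condexp_contraction fi)/(_ (sa_setT HF)).
by rewrite !patch_setT.
Qed.

Lemma is_condexp_lin (c : K) f f' g g' :
  bochner_integrable m f -> bochner_integrable m f' ->
  is_condexp m F f g -> is_condexp m F f' g' ->
  is_condexp m F (fun t => c *: f t + f' t) (fun t => c *: g t + g' t).
Proof.
move=> fi fi' [gi sg gf] [gi' sg' gf']; split.
- by apply: bochner_integrableD => //; exact: bochner_integrableZ.
- by apply: sm_D => //; exact: sm_cstZ.
- move=> C FC; have mC := F_sub FC.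
  have pE (a b : T -> X) : patch (cst 0) C (fun t => c *: a t + b t) =
      (fun t => c *: patch (cst 0) C a t + patch (cst 0) C b t).
    by apply/funext => t; rewrite /patch; case: ifP; rewrite ?scaler0 ?addr0.
  by rewrite !pE !(bochner_integral_lin mfin) ?gf ?gf'//; exact: bochner_integrable_patch.
Qed.

Lemma ae_eq_integral_enorm0 f g : sm f -> sm g ->
  (\int[m]_t enorm (f t - g t)%R = 0)%E -> \forall t \ae m, f t = g t.
Proof.
move=> sf sg fg0.
have mfg := measurable_enorm (sm_B HT sf sg).
have : (\int[m]_t `|enorm (f t - g t)%R| = 0)%E.
  rewrite -{}fg0; apply: eq_integral => t _.
  by rewrite gee0_abs// lee_fin rnorm_ge0.
move=> /(ae_eq_integral_abs _ measurableT mfg); apply: filterS => t /(_ I).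
by move=> [] /rnorm_eq0/subr0_eq.
Qed.

Lemma is_condexp_unique f g g' : bochner_integrable m f ->
  is_condexp m F f g -> is_condexp m F f g' -> \forall t \ae m, g t = g' t.
Proof.
move=> fi gf gf'.
have := is_condexp_lin (-1) fi fi gf' gf.
have ffi : bochner_integrable m (fun t => -1 *: f t + f t).
  by apply: bochner_integrableD => //; exact: bochner_integrableZ.
move=> /(condexp_contractionT ffi) gg.
have [[sg _] _ _] := gf; have [[sg' _] _ _] := gf'.
apply: ae_eq_integral_enorm0 => //; apply/eqP.
rewrite eq_le integral_enorm_ge0 andbT.
under eq_integral do rewrite addrC -scaleN1r.
rewrite (le_trans gg)//.
under eq_integral do rewrite /enorm scaleN1r addNr rnorm0.
by rewrite integral0.
Qed.

End Banach.
End condexp_theory.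

(** Series of functions with summable integrals converge almost everywhere. *)
Lemma ae_series_lty (R : realType) d (T : measurableType d)
    (m : {measure set T -> \bar R}) (u : nat -> T -> \bar R) :
  (forall n, measurable_fun setT (u n)) -> (forall n t, 0 <= u n t)%E ->
  (\sum_(n <oo) \int[m]_t u n t < +oo)%E ->
  \forall t \ae m, (\sum_(n <oo) u n t < +oo)%E.
Proof.
move=> mu u0 ufin.
have mS : measurable_fun setT (fun t => \sum_(n <oo) u n t)%E.
  by apply: ge0_emeasurable_sum => // n t _ _; exact: u0.
have S0 t : (0 <= \sum_(n <oo) u n t)%E by apply: nneseries_ge0 => n _ _.
have : m.-integrable setT (fun t => \sum_(n <oo) u n t)%E.
  apply/integrableP; split => //.
  under eq_integral do rewrite gee0_abs//.
  by rewrite integral_nneseries.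
move=> /(integrable_ae measurableT); apply: filterS => t /(_ I).
by rewrite ge0_fin_numE.
Qed.

Lemma geometric_lty (R : realType) (a : nat -> \bar R) :
  (forall n, 0 <= a n)%E ->
  (forall n, a n <= (1 / (2 ^ n.+1)%:R)%:E)%E ->
  (\sum_(n <oo) a n < +oo)%E.
Proof.
move=> a0 ale; apply: (@le_lt_trans _ _ (1%:E : \bar R)); last exact: ltry.
apply: le_trans (epsilon_trick0 xpredT ler01).
by apply: lee_nneseries => // n _ _.
Qed.

Lemma nneseries_cvg0 (R : realType) (a : nat -> \bar R) :
  (forall n, 0 <= a n)%E -> (\sum_(n <oo) a n < +oo)%E ->
  a n @[n --> \oo] --> (0 : \bar R).
Proof.
move=> a0 afin.
apply: (@squeeze_cvge _ _ _ _ (cst 0%E) _ (fun N => \sum_(N <= n <oo) a n)%E).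
- apply: nearW => n; rewrite a0/=.
  apply: le_trans (nneseries_lim_ge n.+1 _) => //.
  by rewrite big_nat1.
- exact: cvg_cst.
- exact: nneseries_tail_cvg.
Qed.

(** Borel-Cantelli: nonnegative functions whose integrals decrease
    geometrically tend to zero almost everywhere. *)
Lemma ae_cvg0_geometric (R : realType) d (T : measurableType d)
    (m : {measure set T -> \bar R}) (u : nat -> T -> \bar R) :
  (forall n, measurable_fun setT (u n)) -> (forall n t, 0 <= u n t)%E ->
  (forall n, \int[m]_t u n t <= (1 / (2 ^ n.+1)%:R)%:E)%E ->
  \forall t \ae m, u n t @[n --> \oo] --> (0 : \bar R).
Proof.
move=> mu u0 ule.
have : (\sum_(n <oo) \int[m]_t u n t < +oo)%E.
  by apply: geometric_lty => // n; exact: integral_ge0.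
move=> /(ae_series_lty mu u0); apply: filterS => t.
exact: nneseries_cvg0.
Qed.

Section condexp_existence.
Context (R : realType) (k : scalar_kind) d (T : measurableType d).
Variable m : {measure set T -> \bar R}.
Hypothesis mfin : (m setT < +oo)%E.
Variable F : set (set T).
Hypothesis HF : sigma_algebra [set: T] F.
Hypothesis F_sub : F `<=` measurable.
Local Notation K := (scalars R k).
Let HT := sigma_algebra_measurable T.
Local Notation sm := (strongly_measurable measurable).
Local Notation smF := (strongly_measurable F).

(** Where the inequality fails, rationals [a < b] separate the two norms; on the
    member [C a b] of [F] so obtained, [b * m (C a b) <= a * m (C a b)], so it is
    a null set. *)
Lemma ae_rnorm_le (X Y : normedModType K) (g : T -> X) (h : T -> Y) :
  smF g -> smF h ->
  (forall C, F C -> (\int[m]_t enorm (patch (cst 0%R) C g t) <=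
                    \int[m]_t enorm (patch (cst 0%R) C h t))%E) ->
  \forall t \ae m, rnorm (g t) <= rnorm (h t).
Proof.
move=> sg sh gh.
pose C (a b : rat) :=
  [set t | rnorm (h t) < ratr a] `\` [set t | rnorm (g t) < ratr b].
have FC a b : F (C a b) by apply: sa_setD => //; exact: sm_rnorm_lt.
have mC a b := F_sub (FC a b).
have C0 a b : 0 <= (ratr a : R) -> (ratr a : R) < ratr b -> m (C a b) = 0%E.
  move=> a0 ab; have b0 : 0 <= (ratr b : R) by rewrite (le_trans a0) ?ltW.
  have intC (r : R) : 0 <= r ->
      (\int[m]_t (r * \1_(C a b) t)%:E)%E = (r%:E * m (C a b))%E.
    move=> r0; under eq_integral do rewrite EFinM.
    rewrite ge0_integralZl_EFin//; last exact/measurable_EFinP.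
    by rewrite integral_indic// setIT.
  have smC (Z : normedModType K) (f : T -> Z) : smF f ->
      sm (patch (cst 0) (C a b) f).
    move=> sf; apply: (sm_sub F_sub); apply: sm_patch => //; exact: sm_cst.
  have mr (r : R) : measurable_fun setT (fun t => (r * \1_(C a b) t)%:E).
    by apply/measurable_EFinP; exact: measurable_funM.
  have : ((ratr b : R)%:E * m (C a b) <= (ratr a : R)%:E * m (C a b))%E.
    rewrite -!intC//; apply: (@le_trans _ _
      (\int[m]_t enorm (patch (cst 0%R) (C a b) g t))%E).
      apply: ge0_le_integral => //.
      - by move=> t _; rewrite lee_fin mulr_ge0.
      - by apply: measurable_enorm; exact: smC.
      - move=> t _; rewrite lee_fin /patch indicE; case: ifPn => tC.
          by rewrite mulr1; move: tC; rewrite inE => -[_ /= /negP]; rewrite -leNgt.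
        by rewrite mulr0 rnorm0.
    apply: le_trans (gh _ (FC a b)) _; apply: ge0_le_integral => //.
    - by move=> t _; rewrite lee_fin rnorm_ge0.
    - by apply: measurable_enorm; exact: smC.
    - move=> t _; rewrite lee_fin /patch indicE; case: ifPn => tC.
        by rewrite mulr1; move: tC; rewrite inE => -[/= /ltW].
      by rewrite mulr0 rnorm0.
  rewrite -(fineK (fin_mass mfin (mC a b))) -!EFinM lee_fin => ba.
  congr EFin; apply/eqP; rewrite eq_le fine_ge0// andbT leNgt.
  by apply/negP => C0; move: ba; rewrite leNgt ltr_pM2r// ab.
have : m.-negligible (\bigcup_i (if unpickle i is Some ab then
    if (0 <= (ratr ab.1 : R)) && ((ratr ab.1 : R) < ratr ab.2)
    then C ab.1 ab.2 else set0 else set0)).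
  apply: negligible_bigcup => i.
  case: unpickle => [ab|]; last exact: negligible_set0.
  case: ifP => [/andP[a0 ab']|_]; last exact: negligible_set0.
  by apply/negligibleP => //; exact: C0.
apply: negligibleS => t /= /negP; rewrite -ltNge => hg.
have [a] := rat_in_itvoo hg; rewrite in_itv/= => /andP[ha ag].
have [b] := rat_in_itvoo ag; rewrite in_itv/= => /andP[ab bg].
exists (pickle (a, b)); first exact: I.
rewrite pickleK/= ab andbT ifT; last by rewrite (le_trans _ (ltW ha)) ?rnorm_ge0.
by split => //=; apply/negP; rewrite -leNgt ltW.
Qed.

Section Banach.
Variable X : normedModType K.
Hypothesis cX : seq_complete X.

(** A sequence of strongly [F]-measurable functions that is rapidly Cauchy in
    [L^1] has a strongly [F]-measurable limit. *)
Lemma L1_complete (g : nat -> T -> X) : (forall n, smF (g n)) ->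
  (forall n, \int[m]_t enorm (g n.+1 t - g n t)%R <= (1 / (2 ^ n.+1)%:R)%:E)%E ->
  exists h, smF h /\
    (\int[m]_t enorm (h t - g n t)%R)%E @[n --> \oo] --> (0 : \bar R).
Proof.
move=> sg gg.
pose u n t := rnorm (g n.+1 t - g n t).
pose S n t := \sum_(i < n) u i t.
have S_ge0 n t : 0 <= S n t by apply: sumr_ge0 => i _; exact: rnorm_ge0.
have S_homo t n j : (n <= j)%N -> S n t <= S j t.
  move=> /subnK <-; elim: (j - n)%N => // i IH.
  by rewrite (le_trans IH)// /S addSn big_ord_recr/= lerDl rnorm_ge0.
have sS n : smF (fun t => of_real k (S n t) : K^o).
  elim: n => [|n IH].
    under eq_fun do rewrite /S big_ord0 of_real0; exact: sm_cst.
  under eq_fun do rewrite /S big_ord_recr/= of_realD; apply: sm_D => //.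
  by apply: sm_rnorm => //; exact: sm_B.
(* [N], where the series converges, is a member of [F]: off it the limit is 0 *)
pose N := \bigcup_M \bigcap_n [set t | S n t < M%:R].
have FN : F N.
  apply: sa_bigcup => // M; apply: sa_bigcap => // n.
  rewrite (_ : [set t | _] = [set t | rnorm (of_real k (S n t) : K^o) < M%:R]).
    exact: sm_rnorm_lt.
  apply/seteqP; split => t /=; rewrite /rnorm norm_of_real of_realK ger0_norm//.
have SS n t : S n.+1 t = S n t + rnorm (g n.+1 t - g n t).
  by rewrite /S big_ord_recr.
have gS n j t : (n <= j)%N -> rnorm (g j t - g n t) <= S j t - S n t.
  move=> /subnK <-; elim: (j - n)%N => [|i IH]; first by rewrite add0n !subrr rnorm0.
  have tri := rnorm_tri (g (i + n)%N t) (g (i + n).+1 t) (g n t).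
  by rewrite addSn SS; lra.
have N_cvg t : N t -> exists x : X, g n t @[n --> \oo] --> x.
  move=> [M _ HM]; apply: cX => e e0.
  have /cvg_ex[l Sl] : cvgn (S ^~ t).
    apply: nondecreasing_is_cvgn; first by move=> a b; exact: S_homo.
    by exists M%:R => _ [n _ <-]; rewrite ltW//; exact: HM.
  have e20 : 0 < e / 2 by rewrite divr_gt0.
  move/cvgrPdist_lt : Sl => /(_ _ e20)[N0 _ HN0]; exists N0.
  have lt_e n j : (N0 <= n)%N -> (N0 <= j)%N -> (n <= j)%N ->
      rnorm (g j t - g n t) < e.
    move=> N0n N0j nj; apply: le_lt_trans (gS n j t nj) _.
    have := HN0 n N0n; have := HN0 j N0j => /=.
    by rewrite !ltr_norml => /andP[h1 h2] /andP[h3 h4]; lra.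
  move=> n j N0n N0j; have [nj|/ltnW jn] := leqP n j; last exact: lt_e.
  by rewrite rnormB; exact: lt_e.
pose h_ n := patch (cst 0) N (g n).
have : forall t, exists x : X, h_ n t @[n --> \oo] --> x.
  move=> t; have [tN|tN] := pselect (N t).
    have [x gx] := N_cvg t tN; exists x.
    by under eq_cvg do rewrite /h_ /patch mem_set//.
  by exists 0; under eq_cvg do rewrite /h_ /patch memNset//; exact: cvg_cst.
move=> /choice[h hh].
have sh_ n : smF (h_ n) by apply: sm_patch => //; exact: sm_cst.
have sh : smF h by exact: sm_limit hh.
have smg n : sm (g n) by exact: (sm_sub F_sub).
exists h; split => //.
have mu n : measurable_fun setT (fun t => (u n t)%:E).
  by apply: measurable_enorm; exact: sm_B.
have u0 n t : (0 <= (u n t)%:E)%E by rewrite lee_fin rnorm_ge0.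
have ufin : (\sum_(n <oo) \int[m]_t (u n t)%:E < +oo)%E.
  by apply: geometric_lty => // n; apply: integral_ge0.
have SE n t : ((S n t)%:E = \sum_(0 <= i < n) (u i t)%:E)%E.
  by rewrite /S -sumEFin big_mkord.
have Slim n t : ((S n t)%:E <= \sum_(i <oo) (u i t)%:E)%E.
  by rewrite SE; apply: nneseries_lim_ge.
have aeN : \forall t \ae m, N t.
  apply: filterS (ae_series_lty mu u0 ufin) => t tfin.
  have tfin' : (\sum_(i <oo) (u i t)%:E)%E \is a fin_num.
    by rewrite ge0_fin_numE//; apply: nneseries_ge0 => n _ _.
  exists (Num.truncn (fine (\sum_(i <oo) (u i t)%:E)%E)).+1 => // n _ /=.
  apply: le_lt_trans (truncnS_gt _).
  by rewrite -lee_fin fineK.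
pose v t := fine (\sum_(i <oo) (u i t)%:E)%E.
have mS : measurable_fun setT (fun t => \sum_(i <oo) (u i t)%:E)%E.
  by apply: ge0_emeasurable_sum => // n t _ _.
have S0 t : (0 <= \sum_(i <oo) (u i t)%:E)%E.
  by apply: nneseries_ge0 => n _ _.
have mv : measurable_fun setT v by exact: measurableT_comp.
have v0 t : 0 <= v t by rewrite fine_ge0.
have h_v n t : rnorm (h t - h_ n t) <= v t.
  have [tN|tN] := pselect (N t); last first.
    have h_0 j : h_ j t = 0 by rewrite /h_ /patch memNset.
    suff -> : h t = 0 by rewrite h_0 subrr rnorm0.
    have c0 : h_ j t @[j --> \oo] --> (0 : X).
      by under eq_cvg do rewrite h_0; exact: cvg_cst.
    exact: (cvg_unique _ (hh t) c0).
  have h_g j : h_ j t = g j t by rewrite /h_ /patch mem_set.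
  have Sfin : (\sum_(i <oo) (u i t)%:E)%E \is a fin_num.
    rewrite ge0_fin_numE//; move: tN => [M _ HM].
    apply: (@le_lt_trans _ _ (M%:R)%:E); last exact: ltry.
    apply: lime_le; first by apply: is_cvg_nneseries.
    by apply: nearW => j; rewrite -SE lee_fin ltW//; exact: HM.
  rewrite -lee_fin; apply: (@lee_cvg0 _ _ _ (fun j =>
    (rnorm (h_ (j + n)%N t - h t))%:E)).
  - by rewrite lee_fin.
  - move=> j; rewrite -EFinD lee_fin rnormB.
    have tri := rnorm_tri (h_ (j + n)%N t) (h_ n t) (h t).
    have := gS n (j + n)%N t (leq_addl _ _); rewrite -!h_g => gj.
    have := Slim (j + n)%N t; rewrite -(fineK Sfin) lee_fin -/(v t) => Sv.
    have := S_ge0 n t; rewrite (rnormB (h_ n t) (h_ (j + n)%N t)) in tri.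
    by move=> ?; lra.
  - apply/fine_cvgP; split; first exact: nearW.
    have : rnorm (h_ (j + n)%N t - h t) @[j --> \oo] --> (0 : R).
      by have /cvg_rnormP := hh t; rewrite -(cvg_shiftn n).
    exact.
have : (\int[m]_t enorm (h t - h_ n t)%R)%E @[n --> \oo] --> (0 : \bar R).
  have smh : sm h by exact: (sm_sub F_sub).
  have smh_ n : sm (h_ n) by exact: (sm_sub F_sub).
  apply: (@integral_cvg0 _ _ _ _ _ v) => //.
  - by move=> n; apply: measurable_rnorm; exact: sm_B.
  - by move=> n t; rewrite rnorm_ge0 h_v.
  - rewrite (_ : \int[m]_t _ = \int[m]_t (v t)%:E)%E//.
    apply: (@le_lt_trans _ _ (\int[m]_t \sum_(i <oo) (u i t)%:E)%E).
      apply: ge0_le_integral => //; [|exact/measurable_EFinP|].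
        by move=> t _; rewrite lee_fin.
      by move=> t _; rewrite /v; case: (\sum_(i <oo) (u i t)%:E)%E (S0 t).
    by rewrite integral_nneseries.
  - apply: aeW => t; under eq_cvg do rewrite rnormB.
    by have /cvg_rnormP := hh t.
apply: cvg_trans; apply: near_eq_cvg; apply: nearW => n.
have smh : sm h by exact: (sm_sub F_sub).
have smh_ j : sm (h_ j) by exact: (sm_sub F_sub).
apply: ae_eq_integral => //.
- by apply: measurable_enorm; exact: sm_B.
- by apply: measurable_enorm; exact: sm_B.
- by apply: filterS aeN => t tN _; rewrite /h_ /patch mem_set.
Qed.

Lemma is_condexpZr (u h : T -> K^o) (x : X) :
  bochner_integrable m u -> is_condexp m F u h ->
  is_condexp m F (fun t => (u t : K) *: x) (fun t => (h t : K) *: x).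
Proof.
move=> ui [hi sh hu]; split.
- exact: bochner_integrableZr.
- by apply: sm_Z => //; exact: sm_cst.
- move=> C FC; have mC := F_sub FC.
  have pE (w : T -> K^o) : patch (cst 0) C (fun t => (w t : K) *: x) =
      (fun t => (patch (cst 0) C w t : K) *: x).
    by apply/funext => t; rewrite /patch; case: ifP; rewrite ?scale0r.
  by rewrite !pE !(bochner_integralZr mfin) ?hu//; exact: bochner_integrable_patch.
Qed.

Lemma is_condexp0 : is_condexp m F (fun _ : T => 0 : X) (fun _ => 0).
Proof.
split=> //; last exact: sm_cst.
split; first exact: sm_cst.
by under eq_integral do rewrite /enorm rnorm0; rewrite integral0 ltry.
Qed.

Lemma bochner_integrable_indic (E : set T) : measurable E ->
  bochner_integrable m (indicK R k E).
Proof.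
move=> mE; apply: bochner_integrable_patch => //.
by apply: (@bochner_integrable_bounded _ _ _ _ _ mfin _ _ (rnorm (1 : K^o))) => //; exact: sm_cst.
Qed.

Hypothesis condexp_indic : forall E, measurable E ->
  exists h : T -> K^o, is_condexp m F (indicK R k E) h.

Lemma condexp_simple (s : T -> X) : simple_for measurable s ->
  exists g, is_condexp m F s g.
Proof.
move=> [fs ms].
have Hh x : exists h : T -> K^o,
    is_condexp m F (indicK R k (s @^-1` [set x])) h by exact: condexp_indic.
have {Hh}[h Hh] := choice Hh.
pose e x : T -> K^o := indicK R k (s @^-1` [set x]).
have ei x : bochner_integrable m (e x) by exact: bochner_integrable_indic.
have [l0 rl0] : exists2 l : seq X, uniq l & range s = [set` l].
  have /finite_seqP[l rl] := fs; exists (undup l); first exact: undup_uniq.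
  by rewrite rl; apply/seteqP; split => x /=; rewrite mem_undup.
move=> rl; exists (fun t => \sum_(x <- l0) (h x t : K) *: x).
have -> : s = (fun t => \sum_(x <- l0) (e x t : K) *: x).
  apply/funext => t; rewrite (fsbig_seq _ _ rl0) -rl; apply/esym; etransitivity.
    apply: (@fsbig_single _ _ _ (s t)) => // x xs.
    by rewrite /e /indicK /patch memNset ?scale0r//= => E; move: xs; rewrite E eqxx.
  by rewrite /e /indicK /patch mem_set// scale1r.
have lin (l : seq X) :
    bochner_integrable m (fun t => \sum_(x <- l) (e x t : K) *: x) /\
    is_condexp m F (fun t => \sum_(x <- l) (e x t : K) *: x)
                   (fun t => \sum_(x <- l) (h x t : K) *: x).
  elim: l => [|x l [IHi IH]].
    have z (w : X -> T -> K^o) :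
        (fun t => \sum_(x <- [::]) (w x t : K) *: x) = (fun _ => 0 : X).
      by apply/funext => t; rewrite big_nil.
    by rewrite !z; split; [by case: is_condexp0|exact: is_condexp0].
  have exi : bochner_integrable m (fun t => (e x t : K) *: x).
    exact: bochner_integrableZr.
  have eE : (fun t => \sum_(y <- x :: l) (e y t : K) *: y) =
      (fun t => 1 *: ((e x t : K) *: x) + \sum_(y <- l) (e y t : K) *: y).
    by apply/funext => t; rewrite big_cons scale1r.
  have hE : (fun t => \sum_(y <- x :: l) (h y t : K) *: y) =
      (fun t => 1 *: ((h x t : K) *: x) + \sum_(y <- l) (h y t : K) *: y).
    by apply/funext => t; rewrite big_cons scale1r.
  rewrite eE hE; split.
    by apply: bochner_integrableD => //; exact: bochner_integrableZ.
  exact: (is_condexp_lin mfin HF F_sub cX 1 exi IHi (is_condexpZr x (ei x) (Hh x)) IH).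
by have [] := lin l0.
Qed.

(** In a Banach space every integrable function has a conditional expectation
    as soon as the indicators of measurable sets have one. *)
Lemma condexp_exists (f : T -> X) : bochner_integrable m f ->
  exists g, is_condexp m F f g.
Proof.
move=> fi; have [sf fi'] := fi.
have [s [ss s0]] := simple_approx_L1 HT (@subset_refl _ _) sf fi'.
have step n : exists g : (T -> X) * (T -> X),
    [/\ simple_for measurable g.1, is_condexp m F g.1 g.2 &
      (\int[m]_t enorm (f t - g.1 t)%R <= (1 / (2 ^ n.+2)%:R)%:E)%E].
  have e0 : (0 : R) < 1 / (2 ^ n.+2)%:R by rewrite divr_gt0// ltr0n expn_gt0.
  have /fine_cvgP[[N0 _ HN0] /cvgrPdist_lt/(_ _ e0)[N1 _ HN1]] := s0.
  have [g gs] := condexp_simple (ss (maxn N0 N1)).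
  exists (s (maxn N0 N1), g); split => //=.
  rewrite -(fineK (HN0 _ (leq_maxl _ _))) lee_fin ltW//.
  have := HN1 (maxn N0 N1) (leq_maxr _ _); rewrite /= sub0r normrN.
  by rewrite ger0_norm// fine_ge0// integral_enorm_ge0.
have {step}[g_ Hg] := choice step.
pose s_ n := (g_ n).1; pose g n := (g_ n).2.
have ss_ n : simple_for measurable (s_ n) by have [] := Hg n.
have gs_ n : is_condexp m F (s_ n) (g n) by have [] := Hg n.
have s_f n : (\int[m]_t enorm (f t - s_ n t)%R <= (1 / (2 ^ n.+2)%:R)%:E)%E.
  by have [] := Hg n.
have sms n : sm (s_ n) by exact: simple_sm.
have si n : bochner_integrable m (s_ n).
  split => //; rewrite (integral_simple mfin (ss_ n) (@rnorm_ge0 _ _ X)).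
  exact: ltry.
have diff (a b a' b' : T -> X) : bochner_integrable m a -> bochner_integrable m b ->
    is_condexp m F a a' -> is_condexp m F b b' ->
    (\int[m]_t enorm (a' t - b' t)%R <= \int[m]_t enorm (a t - b t)%R)%E.
  move=> ai bi aa bb.
  have := is_condexp_lin mfin HF F_sub cX (-1) bi ai bb aa.
  have abi : bochner_integrable m (fun t => -1 *: b t + a t).
    by apply: bochner_integrableD => //; exact: bochner_integrableZ.
  move=> /(condexp_contractionT mfin HF F_sub cX abi).
  under eq_integral do rewrite scaleN1r addrC.
  by under [X in (_ <= X)%E -> _]eq_integral do rewrite scaleN1r addrC.
have gF n : smF (g n) by have [] := gs_ n.
have smg n : sm (g n) by exact: (sm_sub F_sub).
have [|h [hF gh]] := @L1_complete g gF.
  move=> n; apply: le_trans (diff _ _ _ _ (si n.+1) (si n) (gs_ n.+1) (gs_ n)) _.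
  apply: le_trans (integral_enorm_tri _ (sms n.+1) sf (sms n)) _.
  apply: (@le_trans _ _ ((1 / (2 ^ n.+2)%:R)%:E + (1 / (2 ^ n.+2)%:R)%:E)%E).
    apply: leeD; last exact: s_f.
    under eq_integral do rewrite /enorm rnormB.
    apply: le_trans (s_f n.+1) _; rewrite lee_fin !div1r lef_pV2 ?posrE ?ltr0n ?expn_gt0//.
    by rewrite ler_nat leq_exp2l.
  have -> : 1 / (2 ^ n.+2)%:R = 1 / (2 ^ n.+1)%:R / 2 :> R.
    by rewrite expnS natrM invfM mulrCA mulrC.
  by rewrite -EFinD -splitr.
have smh : sm h by exact: (sm_sub F_sub).
exists h.
have hi : bochner_integrable m h.
  split => //.
  have /fine_cvgP[[N _ HN] _] := gh.
  have [[_ gi] _ _] := gs_ N.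
  apply: (@le_lt_trans _ _ (\int[m]_t enorm (h t - g N t)%R +
    \int[m]_t enorm (g N t))%E).
    apply: integral_enormD => //; first exact: sm_B.
    by move=> t; exact: ler_rnorm_sub.
  by apply: lte_add_pinfty => //; rewrite -ge0_fin_numE ?HN//= integral_enorm_ge0.
split; [by []|by []|move=> C FC]; have mC := F_sub FC.
apply: subr0_eq; apply: rnorm_eq0; apply/eqP; rewrite eq_le rnorm_ge0 andbT.
rewrite -lee_fin.
have pi (w : T -> X) : bochner_integrable m w ->
  bochner_integrable m (patch (cst 0) C w) by exact: bochner_integrable_patch.
have dist (a b : T -> X) : bochner_integrable m a -> bochner_integrable m b ->
    ((rnorm (bochner_integral m (patch (cst 0%R) C a) -
       bochner_integral m (patch (cst 0%R) C b))%R)%:E <=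
     \int[m]_t enorm (a t - b t)%R)%E.
  move=> ai bi.
  have -> : bochner_integral m (patch (cst 0) C a) -
      bochner_integral m (patch (cst 0) C b) =
      bochner_integral m (patch (cst 0) C (fun t => a t - b t)).
    by rewrite patchB (bochner_integralB mfin cX)//; exact: pi.
  have abi : bochner_integrable m (fun t => a t - b t) by exact: bochner_integrableB.
  apply: le_trans (bochner_integral_norm mfin cX (pi _ abi)) _.
  apply: integral_enorm_le; [by case: (pi _ abi)|by case: abi|].
  by move=> t; rewrite /patch; case: ifP => // _; rewrite rnorm0 rnorm_ge0.
apply: (@lee_cvg0 _ _ _ (fun n => (\int[m]_t enorm (h t - g n t)%R +
  \int[m]_t enorm (f t - s_ n t)%R)%E)) => //.
- move=> n; rewrite add0e; have [gi _ gsC] := gs_ n.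
  apply: (@le_trans _ _ (((rnorm (bochner_integral m (patch (cst 0%R) C h) -
       bochner_integral m (patch (cst 0%R) C (g n)))%R)%:E +
    (rnorm (bochner_integral m (patch (cst 0%R) C f) -
       bochner_integral m (patch (cst 0%R) C (s_ n)))%R)%:E)%E)).
    rewrite gsC// -EFinD lee_fin.
    exact: rnorm_tri_r.
  by apply: leeD; exact: dist.
- rewrite -[X in _ --> X](adde0 0); apply: cvgeD => //.
  apply: nneseries_cvg0; first by move=> n; exact: integral_enorm_ge0.
  apply: geometric_lty; first by move=> n; exact: integral_enorm_ge0.
  move=> n; apply: le_trans (s_f n) _.
  rewrite lee_fin !div1r lef_pV2 ?posrE ?ltr0n ?expn_gt0//.
  by rewrite ler_nat leq_exp2l.
Qed.

End Banach.
End condexp_existence.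

(** * Lebesgue norms of extended-valued functions and mixed norms *)

Section Lnorm_probability.
Context (R : realType) d (T : measurableType d) (m : probability T R).
Local Open Scope ereal_scope.
Implicit Types (f g : T -> \bar R) (p : \bar R).

Let mT : 0 < m setT. Proof. by rewrite probability_setT. Qed.

Lemma probability_lty : m setT < +oo.
Proof. by rewrite probability_setT ltry. Qed.

Lemma Lnormy f : (forall t, 0 <= f t) -> Lnorm m +oo f = ess_sup m f.
Proof.
move=> f0; rewrite unlock mT; congr (ess_sup m _).
by apply/funext => t /=; rewrite gee0_abs.
Qed.

Lemma le_Lnorm p f g : 1 <= p -> measurable_fun setT f ->
  measurable_fun setT g -> (forall t, 0 <= f t) -> (forall t, 0 <= g t) ->
  (\forall t \ae m, f t <= g t) -> Lnorm m p f <= Lnorm m p g.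
Proof.
case: p => [r r1 mf mg f0 g0 fg|_ _ _ f0 g0 fg|//]; last first.
  by rewrite !Lnormy//; exact: le_ess_sup.
have r0 : (0 < r)%R by rewrite (lt_le_trans ltr01).
have mp (h : T -> \bar R) : measurable_fun setT h -> measurable_fun setT (fun t => `|h t| `^ r).
  move=> mh; have mah : measurable_fun setT (abse \o h).
    exact: measurableT_comp.
  exact: (measurableT_comp (measurable_poweR r) mah).
have I0 (h : T -> \bar R) : 0 <= \int[m]_x `|h x| `^ r.
  by apply: integral_ge0 => t _; exact: poweR_ge0.
rewrite unlock; apply: gt0_ler_poweR; rewrite ?in_itv/= ?I0 ?leey//.
  by rewrite invr_ge0 ltW.
apply: ae_ge0_le_integral => //.
- by move=> t _; exact: poweR_ge0.
- exact: mp.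
- by move=> t _; exact: poweR_ge0.
- exact: mp.
apply: filterS fg => t fg _; apply: gt0_ler_poweR; rewrite ?in_itv/= ?leey ?abse_ge0//.
  exact: ltW.
by rewrite !gee0_abs.
Qed.

Lemma eq_ae_Lnorm p f g : 1 <= p -> measurable_fun setT f ->
  measurable_fun setT g -> (forall t, 0 <= f t) -> (forall t, 0 <= g t) ->
  (\forall t \ae m, f t = g t) -> Lnorm m p f = Lnorm m p g.
Proof.
move=> p1 mf mg f0 g0 fg; apply/eqP; rewrite eq_le; apply/andP; split.
  by apply: le_Lnorm => //; apply: filterS fg => t ->.
by apply: le_Lnorm => //; apply: filterS fg => t ->.
Qed.

Lemma Lnorm1_probability p : 1 <= p -> Lnorm m p (cst 1) = 1.
Proof.
case: p => [r r1|_|//]; last by rewrite Lnormy// ess_sup_cst.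
by rewrite Lnorm_cst1 (_ : _ setT = 1) ?poweR1r//; exact: probability_setT.
Qed.

Lemma Lnorm_lty_ae p f : 1 <= p -> measurable_fun setT f ->
  (forall t, 0 <= f t) -> Lnorm m p f < +oo -> \forall t \ae m, f t < +oo.
Proof.
case: p => [r r1 mf f0|_ mf f0|//]; last first.
  rewrite Lnormy// => fy; apply: filterS (ess_sup_ge m f) => t ft.
  exact: le_lt_trans fy.
have r0 : (0 < r)%R by rewrite (lt_le_trans ltr01).
have mp : measurable_fun setT (fun t => `|f t| `^ r).
  have maf : measurable_fun setT (abse \o f) by exact: measurableT_comp.
  exact: (measurableT_comp (measurable_poweR r) maf).
rewrite unlock => /lty_poweRy; rewrite invr_neq0 ?gt_eqF// => /(_ isT) fi.
have : m.-integrable setT (fun t => `|f t| `^ r).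
  apply/integrableP; split => //.
  by under eq_integral do rewrite gee0_abs ?poweR_ge0//.
move=> /(integrable_ae measurableT); apply: filterS => t /(_ I).
rewrite ge0_fin_numE ?poweR_ge0// => /lty_poweRy; rewrite gt_eqF// => /(_ isT).
by rewrite gee0_abs.
Qed.

Lemma hoelder_conjugate_gt1 p : 1 < p -> exists r : R,
  [/\ hoelder_conjugate p = r%:E, (1 <= r)%R &
   forall s, p = s%:E -> (s^-1 + r^-1 = 1)%R].
Proof.
move=> p1; have p0 : p != 0 by rewrite gt_eqF// (lt_trans lte01).
have pNy : -oo < p by rewrite (lt_trans (ltNyr 1)).
have := hoelder_conj_ge1 (ltW p1).
have := hoelder_conjugate_eq1 pNy p0.
case E : (hoelder_conjugate p) => [r| |]; last by [].
- rewrite lee_fin => prE r1; exists r; split => // s ps; move: prE.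
  rewrite ps !inver !gt_eqF//; first by rewrite -EFinD => -[].
  + exact: lt_le_trans r1.
  + by rewrite -lte_fin -ps (lt_trans _ p1)// lte01.
- by have /eqP := hoelder_conjugate_eqy E; rewrite gt_eqF.
Qed.

(** Hoelder's inequality for the conjugate pairs [(p, p')] with [1 < p <= oo]
    and extended-valued functions. *)
Lemma ge0_hoelder p f g : 1 < p -> measurable_fun setT f ->
  measurable_fun setT g -> (forall t, 0 <= f t) -> (forall t, 0 <= g t) ->
  Lnorm m p f < +oo -> Lnorm m (hoelder_conjugate p) g < +oo ->
  \int[m]_t (f t * g t) <= Lnorm m p f * Lnorm m (hoelder_conjugate p) g.
Proof.
move=> p1 mf mg f0 g0 fy gy.
have [r [pr r1 prs]] := hoelder_conjugate_gt1 p1.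
rewrite pr in gy *.
have fae := Lnorm_lty_ae (ltW p1) mf f0 fy.
have gae := Lnorm_lty_ae (r1 : 1 <= r%:E) mg g0 gy.
case: p => [s| |] in p1 pr prs fy fae *; last by [].
- have s1 : (1 < s)%R by [].
  have s0 : (0 < s)%R by rewrite (lt_trans ltr01).
  have r0 : (0 < r)%R by rewrite (lt_le_trans ltr01).
  have sf : measurable_fun setT (fine \o f) by exact: measurableT_comp.
  have sg : measurable_fun setT (fine \o g) by exact: measurableT_comp.
  have aef : \forall t \ae m, f t = (fine (f t))%:E.
    by apply: filterS fae => t ft; rewrite fineK// ge0_fin_numE.
  have aeg : \forall t \ae m, g t = (fine (g t))%:E.
    by apply: filterS gae => t gt; rewrite fineK// ge0_fin_numE.
  have -> : Lnorm m s%:E f = Lnorm m s%:E (EFin \o (fine \o f)).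
    apply: eq_ae_Lnorm => //; [exact: ltW|exact/measurable_EFinP|].
    by move=> t; rewrite lee_fin fine_ge0.
  have -> : Lnorm m r%:E g = Lnorm m r%:E (EFin \o (fine \o g)).
    apply: eq_ae_Lnorm => //; [exact/measurable_EFinP|].
    by move=> t; rewrite lee_fin fine_ge0.
  apply: le_trans (hoelder m sf sg s0 r0 (prs s erefl)).
  rewrite Lnorm1; apply: ae_ge0_le_integral => //.
  + by move=> t _; exact: mule_ge0.
  + exact: emeasurable_funM.
  + by apply: measurableT_comp => //; apply/measurable_EFinP; exact: measurable_funM.
  + apply: filterS2 aef aeg => t ft gt _ /=.
    by rewrite {1}ft {1}gt -EFinM lee_fin ler_norm.
- have {}r1 : r = 1%R by move: pr; rewrite hoelder_conjugatey => -[].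
  rewrite r1 in gy *; rewrite Lnorm1 Lnormy//.
  have s0 : 0 <= ess_sup m f by apply: ess_sup_gee => //; exact: aeW.
  apply: (@le_trans _ _ (\int[m]_t (ess_sup m f * g t))).
    apply: ae_ge0_le_integral => //.
    + by move=> t _; exact: mule_ge0.
    + exact: emeasurable_funM.
    + by move=> t _; exact: mule_ge0.
    + exact: emeasurable_funM.
    + apply: filterS (ess_sup_ge m f) => t ft _.
      exact: lee_wpmul2r.
  rewrite ge0_integralZl//.
  by under [X in _ <= _ * X]eq_integral do rewrite gee0_abs//.
Qed.

End Lnorm_probability.

Section mixed_norm_theory.
Context (R : realType) dA dB (A : measurableType dA) (B : measurableType dB).
Variables (mu : probability A R) (nu : probability B R).
Local Open Scope ereal_scope.

Lemma prod_probability_lty : (mu \x nu) setT < +oo.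
Proof. by rewrite probability_setT ltry. Qed.

(** A property that holds almost everywhere on the product holds for almost
    every point of almost every section. *)
Lemma ae_sections (P : A * B -> Prop) :
  (\forall z \ae (mu \x nu), P z) -> \forall a \ae mu, \forall b \ae nu, P (a, b).
Proof.
move=> [N [mN N0 PN]].
have mphi := measurable_fun_xsection nu mN.
have : \int[mu]_a `|(nu \o xsection N) a| = 0.
  by rewrite -N0; apply: eq_integral => a _; rewrite gee0_abs.
move=> /(ae_eq_integral_abs _ measurableT mphi); apply: filterS => a /(_ I) Na.
exists (xsection N a); split => //; first exact: measurable_xsection.
by move=> b /= nP; rewrite /xsection/= inE; exact: PN.
Qed.

Lemma measurable_Lnorm_section q (f : A * B -> \bar R) : 1 <= q ->
  measurable_fun setT f -> (forall z, 0 <= f z) ->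
  measurable_fun setT (fun a => Lnorm nu q (fun b => f (a, b))).
Proof.
case: q => [r r1 mf f0|_ mf f0|//]; last first.
  apply: (measurability _ (ErealGenOInfty.measurableE R)) => //.
  move=> _ [_ [r ->] <-]; rewrite setTI.
  have mr : measurable [set z | r%:E < f z].
    rewrite -[X in measurable X]setTI; exact: emeasurable_fun_o_infty.
  have mphi := measurable_fun_xsection nu mr.
  rewrite (_ : _ @^-1` _ = [set a | 0 < (nu \o xsection [set z | r%:E < f z]) a]).
    rewrite -[X in measurable X]setTI; exact: emeasurable_fun_o_infty.
  apply/seteqP; split => a /=; rewrite in_itv/= andbT Lnormy//.
    move=> rf; rewrite lt0e measure_ge0 andbT; apply/eqP => nu0.
    move: rf; apply/negP; rewrite -leNgt; apply/ess_supP.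
    exists (xsection [set z | r%:E < f z] a); split => //.
      exact: measurable_xsection.
    by move=> b /= /negP; rewrite -ltNge /xsection/= inE.
  move=> nu0; rewrite ltNge; apply/negP => /ess_supP.
  have mfa : measurable_fun setT (fun b => f (a, b)) by exact: measurableT_comp.
  move=> /(ae_le_measureP _ _ mfa) nu0'; move: nu0; rewrite (_ : xsection _ a =
    (fun b => f (a, b)) @^-1` `]r%:E, +oo[); first by rewrite nu0' ltxx.
  apply/seteqP; split => b; rewrite /xsection/= inE/= in_itv/= andbT//.
rewrite unlock.
have mafr : measurable_fun setT (fun z => `|f z| `^ r).
  have maf : measurable_fun setT (abse \o f) by exact: measurableT_comp.
  exact: (measurableT_comp (measurable_poweR r) maf).
have mF : measurable_fun setT (fun a => \int[nu]_b `|f (a, b)| `^ r).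
  apply: (measurable_fun_fubini_tonelli_F (fun z => `|f z| `^ r)) => // z.
  exact: poweR_ge0.
exact: (measurableT_comp (measurable_poweR r^-1) mF).
Qed.

Section vector_valued.
Context (k : scalar_kind).
Local Notation K := (scalars R k).
Local Notation sm := (strongly_measurable measurable).

Lemma enorm_ge0 (X : normedModType K) (x : X) : 0 <= enorm x.
Proof. by rewrite lee_fin rnorm_ge0. Qed.

Lemma sm_section (X : normedModType K) (f : A * B -> X) a : sm f ->
  sm (fun b => f (a, b)).
Proof. by move=> sf; apply: (sm_comp_measurable (pair1_measurable a) sf). Qed.

Lemma measurable_Lnorm_enorm (X : normedModType K) q (f : A * B -> X) :
  1 <= q -> sm f ->
  measurable_fun setT (fun a => Lnorm nu q (fun b => enorm (f (a, b)))).
Proof.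
move=> q1 sf; apply: (measurable_Lnorm_section (f := fun z => enorm (f z))) => //.
  exact: measurable_enorm.
by move=> z; exact: enorm_ge0.
Qed.

Lemma mixed_norm_ge0 (X : normedModType K) p q (f : A * B -> X) :
  0 <= mixed_norm mu nu p q f.
Proof. exact: Lnorm_ge0. Qed.

Lemma le_mixed_norm (X Y : normedModType K) p q (f : A * B -> X)
    (g : A * B -> Y) : 1 <= p -> 1 <= q -> sm f -> sm g ->
  (\forall z \ae (mu \x nu), (rnorm (f z) <= rnorm (g z))%R) ->
  mixed_norm mu nu p q f <= mixed_norm mu nu p q g.
Proof.
move=> p1 q1 sf sg fg; apply: le_Lnorm => //.
- exact: measurable_Lnorm_enorm.
- exact: measurable_Lnorm_enorm.
- by move=> a; exact: Lnorm_ge0.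
- by move=> a; exact: Lnorm_ge0.
apply: filterS (ae_sections fg) => a fga; apply: le_Lnorm => //.
- exact/measurable_enorm/sm_section.
- exact/measurable_enorm/sm_section.
- by move=> b; exact: enorm_ge0.
- by move=> b; exact: enorm_ge0.
Qed.

Lemma eq_mixed_norm (X Y : normedModType K) p q (f : A * B -> X)
    (g : A * B -> Y) : (forall z, rnorm (f z) = rnorm (g z)) ->
  mixed_norm mu nu p q f = mixed_norm mu nu p q g.
Proof.
move=> fg; rewrite /mixed_norm; congr Lnorm; apply/funext => a.
by congr Lnorm; apply/funext => b; rewrite /enorm fg.
Qed.

Lemma mixed_norm_le1 (X : normedModType K) p q (f : A * B -> X) :
  1 <= p -> 1 <= q -> sm f -> (forall z, (rnorm (f z) <= 1)%R) ->
  mixed_norm mu nu p q f <= 1.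
Proof.
move=> p1 q1 sf f1; rewrite -(Lnorm1_probability mu p1).
apply: le_Lnorm => //; first exact: measurable_Lnorm_enorm.
  by move=> a; exact: Lnorm_ge0.
apply: aeW => a; rewrite -[leRHS](Lnorm1_probability nu q1).
apply: le_Lnorm => //; first exact/measurable_enorm/sm_section.
  by move=> b; exact: enorm_ge0.
by apply: aeW => b; rewrite lee_fin.
Qed.

Lemma mixed_norm_lty_ae (X : normedModType K) p q (f : A * B -> X) :
  1 <= p -> 1 <= q -> sm f -> mixed_norm mu nu p q f < +oo ->
  \forall a \ae mu, Lnorm nu q (fun b => enorm (f (a, b))) < +oo.
Proof.
move=> p1 q1 sf; apply: Lnorm_lty_ae => //.
  exact: measurable_Lnorm_enorm.
by move=> a; exact: Lnorm_ge0.
Qed.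

(** Hoelder's inequality for mixed norms. *)
Lemma mixed_hoelder (X Y : normedModType K) p q (f : A * B -> X)
    (g : A * B -> Y) : 1 < p -> 1 < q -> sm f -> sm g ->
  mixed_norm mu nu p q f < +oo ->
  mixed_norm mu nu (hoelder_conjugate p) (hoelder_conjugate q) g < +oo ->
  \int[mu \x nu]_z (enorm (f z) * enorm (g z)) <=
  mixed_norm mu nu p q f *
  mixed_norm mu nu (hoelder_conjugate p) (hoelder_conjugate q) g.
Proof.
move=> p1 q1 sf sg fy gy.
have p'1 := hoelder_conj_ge1 (ltW p1); have q'1 := hoelder_conj_ge1 (ltW q1).
have mf := measurable_enorm sf; have mg := measurable_enorm sg.
have mNf := measurable_Lnorm_enorm (ltW q1) sf.
have mNg := measurable_Lnorm_enorm q'1 sg.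
have NF0 a : 0 <= Lnorm nu q (fun b => enorm (f (a, b))) by exact: Lnorm_ge0.
have NG0 a : 0 <= Lnorm nu (hoelder_conjugate q) (fun b => enorm (g (a, b))).
  exact: Lnorm_ge0.
apply: le_trans (ge0_hoelder p1 mNf mNg NF0 NG0 fy gy).
rewrite fubini_tonelli1//; last 2 first.
- exact: emeasurable_funM.
- by move=> z; rewrite mule_ge0// enorm_ge0.
apply: ae_ge0_le_integral => //.
- by move=> a _; apply: integral_ge0 => b _; rewrite mule_ge0// enorm_ge0.
- apply: (measurable_fun_fubini_tonelli_F (fun z => enorm (f z) * enorm (g z)));
    by [exact: emeasurable_funM|move=> z; apply: mule_ge0; exact: enorm_ge0].
- by move=> a _; exact: mule_ge0.
- exact: emeasurable_funM.
have := mixed_norm_lty_ae (ltW p1) (ltW q1) sf fy.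
have := mixed_norm_lty_ae p'1 q'1 sg gy.
apply: filterS2 => a ga fa _; apply: ge0_hoelder => //.
- exact/measurable_enorm/sm_section.
- exact/measurable_enorm/sm_section.
- by move=> b; exact: enorm_ge0.
- by move=> b; exact: enorm_ge0.
Qed.

End vector_valued.
End mixed_norm_theory.

(** * Strong measurability of the sections *)

Section separable_sections.
Context (R : realType) (k : scalar_kind).
Context dA dB (A : measurableType dA) (B : measurableType dB).
Variables (mu : probability A R) (nu : probability B R).
Local Notation K := (scalars R k).
Local Notation sm := (strongly_measurable measurable).

Let HA := sigma_algebra_measurable A.
Let HB := sigma_algebra_measurable B.
Let HAB := sigma_algebra_measurable (A * B)%type.

Section normed_space.
Variable X : normedModType K.
Implicit Types (f g : A * B -> X) (u v w : B -> X).

(** The [L^q] norm of a section. *)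
Local Notation Nq q u := (Lnorm nu q (fun b => enorm (u b))).

Lemma Lnorm_enormD q u v w : (1 <= q)%E -> sm u -> sm v -> sm w ->
  (forall b, rnorm (u b) <= rnorm (v b) + rnorm (w b)) ->
  (Nq q u <= Nq q v + Nq q w)%E.
Proof.
move=> q1 su sv sw uvw.
have mv := measurable_rnorm sv; have mw := measurable_rnorm sw.
apply: le_trans (eminkowski nu mv mw q1).
apply: le_Lnorm => //.
- exact: measurable_enorm.
- by apply/measurable_EFinP; exact: measurable_funD.
- by move=> b; rewrite lee_fin rnorm_ge0.
- by move=> b; rewrite lee_fin addr_ge0 ?rnorm_ge0.
- by apply: aeW => b; rewrite lee_fin.
Qed.

(** Almost all sections of [f] lie in the [L^q]-closure of a sequence. *)
Definition separable_sections q f := forall e : R, 0 < e ->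
  exists w : nat -> B -> X, (forall i, in_Lq nu q (w i)) /\
    \forall a \ae mu, exists i, (Nq q (fun b => (f (a, b) - w i b)%R) <= e%:E)%E.

Lemma in_Lq0 q : (1 <= q)%E -> in_Lq nu q (fun _ : B => 0 : X).
Proof.
move=> q1; split; first exact: sm_cst.
under eq_Lnorm do rewrite /enorm rnorm0.
by rewrite Lnorm0 ?ltry// gt_eqF// (lt_le_trans _ q1)// lte01.
Qed.

(** Off a set of measure at most [e n], every section of [f] is within [e n] of
    one of the first [M n] functions [w n i], and a simple map selects such a
    function.  Since the [e n] are summable, almost every point eventually
    avoids these exceptional sets, by Borel-Cantelli. *)
Lemma separable_sections_sm q f : (1 <= q)%E -> sm f ->
  separable_sections q f -> strongly_measurable_sections mu nu q f.
Proof.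
move=> q1 sf sep.
pose e n : R := 1 / (2 ^ n.+1)%:R.
have e0 n : 0 < e n by rewrite divr_gt0// ltr0n expn_gt0.
have /choice[w Hw] := fun n => sep (e n) (e0 n).
have wq n i : in_Lq nu q (w n i) by have [] := Hw n.
pose C n i := [set a | (Nq q (fun b => (f (a, b) - w n i b)%R) <= (e n)%:E)%E].
have mC n i : measurable (C n i).
  rewrite -[X in measurable X]setTI.
  apply: emeasurable_fun_infty_c => //.
  apply: (measurable_Lnorm_enorm nu (f := fun z => f z - w n i z.2)) => //.
  have [swi _] := wq n i.
  apply: (sm_B (sigma_algebra_measurable _) sf).
  exact: (sm_comp_measurable measurable_snd swi).
pose D n M := ~` \bigcup_(i < M) C n i.
have mD n M : measurable (D n M).
  by apply: measurableC; apply: bigcup_measurable.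
have D0 n : mu (D n M) @[M --> \oo] --> (0 : \bar R).
  have H : mu (\bigcap_M D n M) = 0%E.
    have [_ [N [mN N0 CN]]] := Hw n.
    apply: (@subset_measure0 _ _ _ _ _ N) => //; first exact: bigcapT_measurable.
    move=> a Da; apply: CN => /= -[i ai]; apply: (Da i.+1) => //.
    by exists i => //=.
  rewrite -H; apply: nonincreasing_cvg_mu => //.
  - by rewrite (le_lt_trans (probability_le1 _ _)) ?ltry.
  - exact: bigcapT_measurable.
  - move=> i j ij; apply/subsetPset; apply: subsetC => a [l /= li al].
    by exists l => //=; exact: leq_trans li ij.
have /choice[M HM] n : exists M, (mu (D n M) <= (e n)%:E)%E.
  have /fine_cvgP[_ /cvgrPdist_lt/(_ _ (e0 n))[M _ HM]] := D0 n.
  exists M; have := HM M (leqnn _); rewrite /= sub0r normrN => h.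
  rewrite -(fineK (fin_mass (probability_lty mu) (mD n M))) lee_fin ltW//.
  exact: le_lt_trans (ler_norm _) h.
pose fix sel n j : A -> B -> X :=
  if j is i.+1 then patch (sel n i) (C n i) (fun _ => w n i)
  else fun _ _ => 0.
have sel_simple n j : simple_for measurable (sel n j).
  elim: j => [|j IH] /=; first exact: simple_cst.
  by apply: simple_patch => //; exact: simple_cst.
have sel_Lq n j a : in_Lq nu q (sel n j a).
  elim: j => [|j IH] /=; first exact: in_Lq0.
  by rewrite /patch; case: ifP.
have sel_close n j a : ~ D n j a ->
    (Nq q (fun b => (f (a, b) - sel n j a b)%R) <= (e n)%:E)%E.
  move=> /contrapT; elim: j => [[i //]|j IH] [i /= ij ai].
  rewrite /patch; case: ifPn => [/set_mem//|aj]; apply: IH; exists i => //=.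
  move: ij; rewrite ltnS leq_eqVlt => /predU1P[ij|//].
  by move: aj; rewrite -ij mem_set.
exists (fun n => sel n (M n)); split => //.
have [|||N [mN N0 HN]] := @ae_cvg0_geometric R _ A mu (fun n a => (\1_(D n (M n)) a)%:E).
- by move=> n; exact/measurable_EFinP.
- by move=> n a; rewrite lee_fin.
- by move=> n; rewrite integral_indic// setIT; exact: HM.
exists N; split => // a /= na; apply: HN => /= a0; apply: na.
have [n0 _ Hn0] : \forall n \near \oo, ~ D n (M n) a.
  move/fine_cvgP : a0 => [_ /cvgrPdist_lt/(_ _ ltr01)].
  apply: filterS => n /=; rewrite sub0r normrN indicE.
  by case: (boolP (a \in D n (M n))) => [|/negP + _ Da]; rewrite ?normr1 ?ltxx// mem_set.
apply: (@squeeze_cvge _ _ _ _ (cst 0%E) _ (fun n => (e n)%:E)).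
- exists n0 => // n nn0; rewrite Lnorm_ge0/=.
  by apply: sel_close; exact: Hn0.
- exact: cvg_cst.
- apply: nneseries_cvg0; first by move=> n; rewrite lee_fin ltW.
  by apply: geometric_lty => // n; rewrite lee_fin ltW.
Qed.

Lemma separable_sectionsD q f g : (1 <= q)%E -> sm f -> sm g ->
  separable_sections q f -> separable_sections q g ->
  separable_sections q (fun z => f z + g z).
Proof.
move=> q1 sf sg sepf sepg e e0.
have e20 : 0 < e / 2 by rewrite divr_gt0.
have [u [uq uf]] := sepf _ e20; have [v [vq vg]] := sepg _ e20.
pose w n := if unpickle n is Some (i, j) then (fun b => u i b + v j b)
  else (fun _ : B => 0 : X).
exists w; split.
  move=> n; rewrite /w; case: unpickle => [[i j]|]; last exact: in_Lq0.
  have [su ui] := uq i; have [sv vi] := vq j; split; first exact: sm_D.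
  apply: (@le_lt_trans _ _ (Nq q (u i) + Nq q (v j))%E); last exact: lte_add_pinfty.
  by apply: Lnorm_enormD => //; [exact: sm_D|move=> b; exact: ler_rnormD].
apply: filterS2 uf vg => a [i ui] [j vj]; exists (pickle (i, j)).
rewrite /w pickleK [e]splitr EFinD.
have [su _] := uq i; have [sv _] := vq j.
have sfa := sm_section a sf; have sga := sm_section a sg.
apply: le_trans (leeD ui vj); apply: Lnorm_enormD => //.
- by apply: sm_B => //; exact: sm_D.
- exact: sm_B.
- exact: sm_B.
- by move=> b; rewrite opprD addrACA ler_rnormD.
Qed.

(** Separability passes to limits: almost every section of [f] need only be
    approximated by the sections of the [s n], with no uniformity in [a]. *)
Lemma separable_sections_lim q f (s : nat -> A * B -> X) : (1 <= q)%E ->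
  sm f -> (forall n, sm (s n)) -> (forall n, separable_sections q (s n)) ->
  (\forall a \ae mu, forall e : R, 0 < e -> exists n,
     (Nq q (fun b => (f (a, b) - s n (a, b))%R) <= e%:E)%E) ->
  separable_sections q f.
Proof.
move=> q1 sf ss seps sf0 e e0.
have e20 : 0 < e / 2 by rewrite divr_gt0.
have /choice[u Hu] := fun n => seps n _ e20.
exists (fun n => if unpickle n is Some (i, j) then u i j else (fun _ => 0)).
split.
  move=> n; case: unpickle => [[i j]|]; last exact: in_Lq0.
  by have [] := Hu i.
have aeu : \forall a \ae mu, forall n, exists i,
    (Nq q (fun b => (s n (a, b) - u n i b)%R) <= (e / 2)%:E)%E.
  by apply: ae_foralln => n; have [] := Hu n.
apply: filterS2 sf0 aeu => a /(_ _ e20)[n Hn] Ha; have [i ui] := Ha n.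
exists (pickle (n, i)); rewrite pickleK [e]splitr EFinD.
have [[su _] _] : in_Lq nu q (u n i) /\ True by have [] := Hu n.
have sfa := sm_section a sf; have ssa := sm_section a (ss n).
apply: (@le_trans _ _ (Nq q (fun b => (f (a, b) - s n (a, b))%R) +
   Nq q (fun b => (s n (a, b) - u n i b)%R))%E).
  apply: Lnorm_enormD => //; try exact: sm_B.
  by move=> b; exact: rnorm_tri.
exact: leeD.
Qed.

Lemma Lnorm_powR (r : R) u : 0 < r -> Nq r%:E u =
  ((\int[nu]_b (rnorm (u b) `^ r)%:E) `^ r^-1)%E.
Proof.
move=> r0; rewrite unlock.
by under eq_integral do rewrite gee0_abs ?lee_fin ?rnorm_ge0//.
Qed.

Lemma Lnorm_le_powR (r e : R) u : 0 < r -> 0 <= e ->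
  (\int[nu]_b (rnorm (u b) `^ r)%:E <= (e `^ r)%:E)%E -> (Nq r%:E u <= e%:E)%E.
Proof.
move=> r0 e0 ue; rewrite Lnorm_powR//.
have -> : e%:E = ((e `^ r)%:E `^ r^-1)%E.
  by rewrite poweR_EFin -powRrM divff ?gt_eqF// powRr1.
apply: gt0_ler_poweR; last exact: ue.
- by rewrite invr_ge0 ltW.
- rewrite in_itv/= leey andbT.
  by apply: integral_ge0 => b _; rewrite lee_fin powR_ge0.
- by rewrite in_itv/= leey andbT lee_fin powR_ge0.
Qed.

End normed_space.

(** Up to [nu]-measure [e], the sections of [E] are taken from a sequence of
    measurable sets. *)
Definition separable_set_sections (E : set (A * B)) := forall e : R, 0 < e ->
  exists V : nat -> set B, (forall i, measurable (V i)) /\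
    forall a, exists i,
      (nu ((xsection E a `\` V i) `|` (V i `\` xsection E a)) <= e%:E)%E.

(** The sets with this property form a sigma-algebra that contains the
    measurable rectangles. *)
Lemma separable_set_sections_measurable E : measurable E ->
  separable_set_sections E.
Proof.
suff: measurable `<=` [set E | measurable E /\ separable_set_sections E].
  by move=> H /H[].
clear E; rewrite {1}measurable_prod_measurableType; apply: smallest_sub; last first.
  move=> _ [P mP [Q mQ <-]]; split; first exact: measurableX.
  move=> e e0; exists (fun i => if i is 0%N then Q else set0); split.
    by case.
  move=> a; have [aP|aP] := pselect (P a).
    exists 0%N; rewrite in_xsectionX ?inE// setDv setU0 measure0.
    by rewrite lee_fin ltW.
  exists 1%N; rewrite notin_xsectionX ?setDv ?setU0 ?measure0 ?lee_fin ?ltW//.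
  by rewrite memNset.
split.
- split => // e e0; exists (fun _ => set0); split => // a; exists 0%N.
  by rewrite xsection0 setDv setU0 measure0 lee_fin ltW.
- move=> E [mE sE]; rewrite setTD; split; first exact: measurableC.
  move=> e /sE[V [mV HV]]; exists (fun i => ~` V i); split.
    by move=> i; exact: measurableC.
  move=> a; have [i Hi] := HV a; exists i.
  rewrite (_ : _ `|` _ = (xsection E a `\` V i) `|` (V i `\` xsection E a))//.
  by rewrite !xsectionE preimage_setC !setDE !setCK setUC setIC (setIC _ (V i)).
- move=> E HE; have mE n : measurable (E n) by have [] := HE n.
  split; first exact: bigcupT_measurable.
  move=> e e0.
  pose d n : R := (e / 2) / (2 ^ n.+1)%:R.
  have e20 : 0 < e / 2 by rewrite divr_gt0.
  have d0 n : 0 < d n by rewrite divr_gt0// ltr0n expn_gt0.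
  have /choice[V HV] : forall n, exists V : nat -> set B,
      (forall i, measurable (V i)) /\ forall a, exists i,
      (nu ((xsection (E n) a `\` V i) `|` (V i `\` xsection (E n) a)) <= (d n)%:E)%E.
    by move=> n; have [_] := HE n; apply.
  have mV n i : measurable (V n i) by have [] := HV n.
  pose W (l : seq nat) := \bigcup_(n < size l) V n (nth 0%N l n).
  have mW l : measurable (W l) by apply: bigcup_measurable.
  exists (fun n => if unpickle n is Some l then W l else set0); split.
    by move=> n; case: unpickle.
  move=> a; have mEa n : measurable (xsection (E n) a) by exact: measurable_xsection.
  have /choice[c Hc] : forall n, exists i, (nu ((xsection (E n) a `\` V n i) `|`
      (V n i `\` xsection (E n) a)) <= (d n)%:E)%E.
    by move=> n; have [_] := HV n; apply.
  (* the first [N] sets cost at most [d n] each, the others [e / 2] together *)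
  have [N HN] : exists N, (nu (\bigcup_n xsection (E n) a `\`
      \bigcup_(n < N) xsection (E n) a) <= (e / 2)%:E)%E.
    pose D N := \bigcup_n xsection (E n) a `\` \bigcup_(n < N) xsection (E n) a.
    have mD N : measurable (D N).
      by apply: measurableD; [exact: bigcupT_measurable|exact: bigcup_measurable].
    have D0 : \bigcap_N D N = set0.
      apply/seteqP; split => b //= Db.
      have [[n _ nb] _] := Db 0%N I; have [_] := Db n.+1 I; apply.
      by exists n => //=.
    have : nu (D N) @[N --> \oo] --> (0 : \bar R).
      rewrite -(measure0 nu) -D0; apply: nonincreasing_cvg_mu => //.
      - by rewrite (le_lt_trans (probability_le1 _ _)) ?ltry.
      - exact: bigcapT_measurable.
      - move=> i j ij; apply/subsetPset => b [bU bN]; split => // -[n /= ni nb].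
        by apply: bN; exists n => //=; exact: leq_trans ij.
    move=> /fine_cvgP[_ /cvgrPdist_lt/(_ _ e20)[N _ HN]]; exists N.
    have := HN N (leqnn _); rewrite /= sub0r normrN => h.
    rewrite -(fineK (fin_mass (probability_lty nu) (mD N))) lee_fin ltW//.
    exact: le_lt_trans (ler_norm _) h.
  exists (pickle (mkseq c N)); rewrite pickleK.
  pose S n := (xsection (E n) a `\` V n (c n)) `|` (V n (c n) `\` xsection (E n) a).
  have mS n : measurable (S n) by apply: measurableU; exact: measurableD.
  apply: (@le_trans _ _ (nu ((\bigcup_n xsection (E n) a `\`
      \bigcup_(n < N) xsection (E n) a) `|` \bigcup_n S n))).
    apply: le_measure; rewrite ?inE.
    + apply: measurableU; apply: measurableD => //; apply: measurable_xsection;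
        exact: bigcupT_measurable.
    + apply: measurableU; last exact: bigcupT_measurable.
      by apply: measurableD; [exact: bigcupT_measurable|exact: bigcup_measurable].
    + rewrite xsection_bigcup /W size_mkseq => b [[bE bV]|[[n /= nN]]].
        have [[n nN nb]|nb] := pselect ((\bigcup_(n < N) xsection (E n) a) b).
          right; exists n => //; left; split => // nV; apply: bV.
          by exists n => //=; rewrite nth_mkseq.
        by left.
      rewrite nth_mkseq// => nV bE; right; exists n => //; right; split => // nb.
      by apply: bE; exists n.
  apply: le_trans (measureU2 _ _ _) _.
  + by apply: measurableD; [exact: bigcupT_measurable|exact: bigcup_measurable].
  + exact: bigcupT_measurable.
  rewrite [e]splitr EFinD; apply: leeD => //.
  apply: (@le_trans _ _ (\sum_(n <oo) nu (S n))%E).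
    by apply: measure_sigma_subadditive => //; exact: bigcupT_measurable.
  apply: le_trans (epsilon_trick0 xpredT (ltW e20)).
  by apply: lee_nneseries => // n _; exact: Hc.
Qed.

Section finite_exponent.
Variable X : normedModType K.
Implicit Types (f : A * B -> X).
Variable r : R.
Hypothesis r1 : 1 <= r.
Let r0 : 0 < r. Proof. exact: lt_le_trans r1. Qed.

Lemma separable_sections_indic (E : set (A * B)) (x : X) : measurable E ->
  separable_sections r%:E (fun z => (indicK R k E z : K) *: x).
Proof.
move=> mE e e0.
pose d := (e / (rnorm x + 1)) `^ r.
have x1 : 0 < rnorm x + 1 by rewrite ltr_wpDl// rnorm_ge0.
have d0 : 0 < d by rewrite powR_gt0// divr_gt0.
have [V [mV HV]] := separable_set_sections_measurable mE d0.
have intE (u v : B -> K^o) (D : set B) : measurable D -> (nu D <= d%:E)%E ->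
    (forall b, rnorm ((u b : K) *: x - (v b : K) *: x) `^ r =
       rnorm x `^ r * \1_D b) ->
    (Lnorm nu r%:E (fun b => enorm ((u b : K) *: x - (v b : K) *: x)%R) <= e%:E)%E.
  move=> mD Dd uvD; apply: Lnorm_le_powR => //; first exact: ltW.
  under eq_integral do rewrite uvD EFinM.
  rewrite ge0_integralZl_EFin ?powR_ge0//; last exact/measurable_EFinP.
  rewrite integral_indic// setIT.
  apply: (@le_trans _ _ ((rnorm x `^ r)%:E * d%:E)%E).
    by apply: lee_wpmul2l; rewrite ?lee_fin ?powR_ge0.
  rewrite -EFinM lee_fin /d -powRM ?rnorm_ge0//; last by rewrite divr_ge0// ltW.
  apply: ge0_ler_powR; rewrite ?nnegrE//; [exact: ltW| |exact: ltW|].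
    by rewrite mulr_ge0 ?rnorm_ge0// divr_ge0// ltW.
  rewrite mulrCA ler_piMr//; first exact: ltW.
  by rewrite ler_pdivrMr// mul1r lerDl.
exists (fun i b => (indicK R k (V i) b : K) *: x); split.
  move=> i; split.
    by apply: sm_Z => //; [exact: sm_indic|exact: sm_cst].
  have le1 b : rnorm ((indicK R k (V i) b : K) *: x) <= rnorm x.
    rewrite /indicK /patch; case: ifP => _; first by rewrite scale1r.
    by rewrite scale0r rnorm0 rnorm_ge0.
  apply: (@le_lt_trans _ _ (rnorm x)%:E); last exact: ltry.
  apply: Lnorm_le_powR => //; first exact: rnorm_ge0.
  apply: (@le_trans _ _ (\int[nu]_b (cst (rnorm x `^ r)%:E) b)%E).
    apply: ge0_le_integral => //.
    - by move=> b _; rewrite lee_fin powR_ge0.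
    - apply/measurable_EFinP.
      apply: (@measurableT_comp _ _ _ _ _ _ (fun y : R => y `^ r)) => //.
      by apply: measurable_rnorm; apply: sm_Z => //; [exact: sm_indic|exact: sm_cst].
    - move=> b _; rewrite lee_fin; apply: ge0_ler_powR; rewrite ?nnegrE ?rnorm_ge0//.
      exact: ltW.
  by rewrite integral_cst// (_ : _ setT = 1%E) ?mule1//; exact: probability_setT.
apply: aeW => a; have [i Hi] := HV a; exists i.
apply: intE Hi _.
  by apply: measurableU; apply: measurableD => //; exact: measurable_xsection.
move=> b; rewrite indicE in_setU !in_setD mem_xsection /indicK /patch.
case: ((a, b) \in E); case: (b \in V i); rewrite /= ?subrr ?scale1r ?scale0r;
  rewrite ?subr0 ?sub0r ?rnormN ?rnorm0 ?powR0 ?gt_eqF// ?mulr1 ?mulr0//.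
Qed.

Lemma separable_sections_simple (s : A * B -> X) : simple_for measurable s ->
  separable_sections r%:E s.
Proof.
move=> [fs ms].
have [l0 rl0] : exists2 l : seq X, uniq l & range s = [set` l].
  have /finite_seqP[l rl] := fs; exists (undup l); first exact: undup_uniq.
  by rewrite rl; apply/seteqP; split => x /=; rewrite mem_undup.
move=> rl.
pose e x : A * B -> K^o := indicK R k (s @^-1` [set x]).
have -> : s = (fun t => \sum_(x <- l0) (e x t : K) *: x).
  apply/funext => t; rewrite (fsbig_seq _ _ rl0) -rl; apply/esym; etransitivity.
    apply: (@fsbig_single _ _ _ (s t)) => // x xs.
    by rewrite /e /indicK /patch memNset ?scale0r//= => E; move: xs; rewrite E eqxx.
  by rewrite /e /indicK /patch mem_set// scale1r.
have ex x : sm (fun t => (e x t : K) *: x).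
  by apply: sm_Z => //; [exact: sm_indic|exact: sm_cst].
suff /(_ l0)[] : forall l : seq X, sm (fun t => \sum_(x <- l) (e x t : K) *: x) /\
  separable_sections r%:E (fun t => \sum_(x <- l) (e x t : K) *: x) by [].
elim=> [|x l [IHs IH]].
  have -> : (fun t => \sum_(x <- [::]) (e x t : K) *: x) = (fun _ => 0 : X).
    by apply/funext => t; rewrite big_nil.
  split; first exact: sm_cst.
  move=> d d0; exists (fun _ _ => 0); split; first by move=> _; exact: in_Lq0.
  apply: aeW => a; exists 0%N; under eq_Lnorm do rewrite /enorm subrr rnorm0.
  by rewrite Lnorm0 ?lee_fin ?ltW// gt_eqF// lte_fin.
have -> : (fun t => \sum_(y <- x :: l) (e y t : K) *: y) =
    (fun t => (e x t : K) *: x + \sum_(y <- l) (e y t : K) *: y).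
  by apply/funext => t; rewrite big_cons.
split; first exact: sm_D.
apply: separable_sectionsD => //; exact: separable_sections_indic.
Qed.

(** For a finite exponent the sections of every strongly measurable function
    are, when almost all of them are in [L^q], automatically separably valued. *)
Lemma sm_separable_sections f : sm f ->
  (\forall a \ae mu, (Lnorm nu r%:E (fun b => enorm (f (a, b))) < +oo)%E) ->
  separable_sections r%:E f.
Proof.
move=> sf fq; have [s [ss sc sb]] := sm_dominated_approx HAB sf.
have sms n : sm (s n) by exact: simple_sm.
apply: (@separable_sections_lim _ _ _ s) => //.
  by move=> n; exact: separable_sections_simple.
apply: filterS fq => a; rewrite Lnorm_powR// => /lty_poweRy.
rewrite invr_neq0 ?gt_eqF// => /(_ isT) fi e e0.
have sfa := sm_section a sf.
have mp (u : B -> X) : sm u -> measurable_fun setT (fun b => rnorm (u b) `^ r).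
  move=> su; apply: (@measurableT_comp _ _ _ _ _ _ (fun y : R => y `^ r)) => //.
  exact: measurable_rnorm.
have ssa n : sm (fun b => f (a, b) - s n (a, b)).
  by apply: sm_B => //; exact: (sm_section a (sms n)).
have : (\int[nu]_b (rnorm (f (a, b) - s n (a, b)) `^ r)%:E)%E @[n --> \oo]
    --> (0 : \bar R).
  apply: (@integral_cvg0 _ _ _ _ _ (fun b => rnorm (f (a, b)) `^ r)) => //.
- by move=> n; exact: mp (ssa n).
- exact: mp.
- move=> n b; rewrite powR_ge0/=; apply: ge0_ler_powR; rewrite ?nnegrE ?rnorm_ge0//.
  exact: ltW.
- apply: aeW => b.
  have /cvg_rnormP h := sc (a, b).
  apply: (@squeeze_cvgr _ _ _ _ (cst 0) (fun n => rnorm (s n (a, b) - f (a, b)))) => //.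
    move/cvgrPdist_lt : h => /(_ _ ltr01); apply: filterS => n.
    rewrite sub0r normrN ger0_norm ?rnorm_ge0// => n1.
    rewrite powR_ge0/= rnormB; set y := rnorm _.
    have [->|y0] := eqVneq y 0; first by rewrite powR0 ?gt_eqF.
    apply: ge1r_powR => //.
    by rewrite lt0r y0 rnorm_ge0/= ltW.
  exact: cvg_cst.
move=> /fine_cvgP[[N0 _ HN0]].
have er : 0 < e `^ r by rewrite powR_gt0.
move=> /cvgrPdist_lt/(_ _ er)[N1 _ HN1].
pose n := maxn N0 N1; exists n; apply: Lnorm_le_powR => //; first exact: ltW.
have := HN1 n (leq_maxr _ _); rewrite /= sub0r normrN => h.
rewrite -(fineK (HN0 n (leq_maxl _ _))) lee_fin ltW//.
exact: le_lt_trans (ler_norm _) h.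
Qed.

End finite_exponent.
End separable_sections.

(** * Essentially countably many sections *)

Section colouring.
Context (R : realType) d (T : measurableType d) (m : {measure set T -> \bar R}).
Hypothesis mfin : (m setT < +oo)%E.
Variable e : nat -> nat -> set T.
Hypothesis me : forall n j, measurable (e n j).

(** The points of [T] are viewed as (infinite) graphs on [nat], and [e n j] is
    the set of graphs having an edge from [n] to [j].  Orientations are
    forgotten in [edge]. *)
Definition edge n j : set T := e n j `|` e j n.

(** The graphs with an edge from [j] to a smaller vertex whose colour for [c] is
    not [x]. *)
Definition killed (c : nat -> bool) (j : nat) (x : bool) : set T :=
  \bigcup_(n in [set n | (n < j)%N /\ c n != x]) edge n j.

(** The graphs with an edge from [j] to a smaller vertex. *)
Definition has_edge j : set T := \bigcup_(n < j) edge n j.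

(** The graphs that survive up to [j]: for them [c] is constant along the edges
    between vertices smaller than [j]. *)
Definition alive c j : set T := ~` \bigcup_(i < j) killed c i (c i).

Lemma measurable_edge n j : measurable (edge n j).
Proof. exact: measurableU. Qed.

Lemma measurable_killed c j x : measurable (killed c j x).
Proof. by apply: bigcup_measurable => n _; exact: measurable_edge. Qed.

Lemma measurable_has_edge j : measurable (has_edge j).
Proof. by apply: bigcup_measurable => n _; exact: measurable_edge. Qed.

Lemma measurable_alive c j : measurable (alive c j).
Proof.
apply: measurableC; apply: bigcup_measurable => n _; exact: measurable_killed.
Qed.

Lemma eq_killed c c' j x : (forall n, (n < j)%N -> c n = c' n) ->
  killed c j x = killed c' j x.
Proof.
move=> cc; apply/seteqP; split => t [n [/= nj cx] nt]; exists n => //=.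
  by rewrite -cc.
by rewrite cc.
Qed.

Lemma eq_alive c c' j : (forall n, (n < j)%N -> c n = c' n) ->
  alive c j = alive c' j.
Proof.
move=> cc; rewrite /alive; congr (~` _); apply: eq_bigcupr => i /= ij.
rewrite cc//; apply: eq_killed => n ni; apply: cc; exact: ltn_trans ij.
Qed.

(** The colour of [j] is chosen so as to kill at least half of the surviving
    graphs in [has_edge j]. *)
Definition greedy (c : nat -> bool) j : bool :=
  `[< (m (alive c j `&` killed c j false) <= m (alive c j `&` killed c j true))%E >].

(** The greedy colours of the vertices smaller than [j]; the others get the
    immaterial colour [false]. *)
Fixpoint greedy_prefix j : nat -> bool :=
  if j is i.+1 then
    fun n => if n == i then greedy (greedy_prefix i) i else greedy_prefix i n
  else fun _ => false.

(** The colouring obtained by applying [greedy] to one vertex after another. *)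
Definition greedy_colouring n : bool := greedy_prefix n.+1 n.

Lemma greedy_prefixE n j : (n < j)%N -> greedy_prefix j n = greedy_colouring n.
Proof.
elim: j => // j IH; rewrite ltnS leq_eqVlt => /predU1P[->|nj].
  by rewrite /greedy_colouring.
by rewrite /= ltn_eqF// IH.
Qed.

Lemma greedy_colouringE j : greedy_colouring j = greedy greedy_colouring j.
Proof.
rewrite {1}/greedy_colouring/= eqxx /greedy.
have cc n : (n < j)%N -> greedy_prefix j n = greedy_colouring n.
  exact: greedy_prefixE.
by rewrite (eq_alive cc) !(eq_killed _ cc).
Qed.

Local Notation c := greedy_colouring.

Lemma aliveS j : alive c j.+1 = alive c j `\` killed c j (c j).
Proof.
apply/seteqP; split => t /=.
  move=> tN; split; first by move=> [i /= ij it]; apply: tN; exists i => //=; exact: ltnW.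
  by move=> it; apply: tN; exists j => /=.
move=> [tj tk] [i /=]; rewrite ltnS leq_eqVlt => /predU1P[->//|ij it].
by apply: tj; exists i.
Qed.

(** A graph of [has_edge j] is killed by at least one of the two colours, and
    the greedy choice kills the larger part. *)
Lemma alive_has_edge_le j :
  (m (alive c j `&` has_edge j) <=
   m (alive c j `&` killed c j (c j)) + m (alive c j `&` killed c j (c j)))%E.
Proof.
have mk x : measurable (alive c j `&` killed c j x).
  by apply: measurableI; [exact: measurable_alive|exact: measurable_killed].
apply: (@le_trans _ _ (m ((alive c j `&` killed c j true) `|`
    (alive c j `&` killed c j false)))).
  apply: le_measure; rewrite ?inE.
  - by apply: measurableI; [exact: measurable_alive|exact: measurable_has_edge].
  - exact: measurableU.
  - move=> t [ta [n /= nj nt]]; case E : (c n).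
      by right; split => //; exists n => //=; rewrite E.
    by left; split => //; exists n => //=; rewrite E.
apply: le_trans (measureU2 _ (mk _) (mk _)) _.
case E : (c j).
  apply: leeD => //; move: E; rewrite greedy_colouringE => /asboolP; exact.
apply: leeD => //; move: E; rewrite greedy_colouringE => /asboolPn/negP.
by rewrite -ltNge => /ltW.
Qed.

(** The sum telescopes: at each step twice the mass of the killed graphs is
    lost. *)
Lemma sum_alive_has_edge N :
  (\sum_(0 <= j < N) m (alive c j `&` has_edge j) +
     (m (alive c N) + m (alive c N)) <= m setT + m setT)%E.
Proof.
elim: N => [|N IH].
  by rewrite big_geq// add0e /alive bigcup0// setC0.
apply: le_trans IH; rewrite big_nat_recr//= -addeA leeD2l//.
have H : m (alive c N) =
    (m (alive c N `&` killed c N (c N)) + m (alive c N.+1))%E.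
  rewrite aliveS addeC -measureDI//; [exact: measurable_alive|exact: measurable_killed].
apply: le_trans (leeD (alive_has_edge_le N) (lexx _)) _.
rewrite H; set x := m (_ `&` _); set y := m (alive c N.+1).
by rewrite addeACA.
Qed.

(** Almost every graph with infinitely many edges has an edge between two
    vertices of different colours: a graph that is never killed belongs to
    [alive c j] for all [j], and the masses of the [alive c j `&` has_edge j]
    are summable. *)
Lemma ae_greedy_colouring : \forall t \ae m,
  (forall j, ~ killed c j (c j) t) ->
  exists N, forall j, (N <= j)%N -> ~ has_edge j t.
Proof.
pose u j t : \bar R := (\1_(alive c j `&` has_edge j) t)%:E.
have mu' j : measurable (alive c j `&` has_edge j).
  by apply: measurableI; [exact: measurable_alive|exact: measurable_has_edge].
have := @ae_series_lty R _ T m u.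
case.
- by move=> j; exact/measurable_EFinP.
- by move=> j t; rewrite lee_fin.
- apply: (@le_lt_trans _ _ (m setT + m setT)%E); last exact: lte_add_pinfty.
  apply: lime_le.
    by apply: is_cvg_nneseries => j _ _; apply: integral_ge0 => t _; rewrite lee_fin.
  apply: nearW => N; apply: le_trans (sum_alive_has_edge N).
  rewrite -[leLHS]adde0; apply: leeD; last by rewrite adde_ge0.
  by apply: lee_sum => j _; rewrite integral_indic// setIT.
move=> N0 [mN0 N00 HN0]; exists N0; split => // t /= nt; apply: HN0 => /= tfin.
apply: nt => alive_t.
have u0 j : (0 <= u j t)%E by rewrite lee_fin.
have /fine_cvgP[_ /cvgrPdist_lt/(_ _ ltr01)[N _ HN]] := nneseries_cvg0 u0 tfin.
exists N => j Nj tj; have := HN j Nj; rewrite /u /= sub0r normrN indicE mem_set.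
  by rewrite normr1 ltxx.
by split => //; move=> [i _]; exact: alive_t.
Qed.

End colouring.

Section countable_sections.
Context (R : realType).
Context dA dB (A : measurableType dA) (B : measurableType dB).
Variables (mu : probability A R) (nu : probability B R).

(** Modulo [nu]-null sets, almost all sections of [E] belong to a sequence of
    measurable sets. *)
Definition countable_sections (E : set (A * B)) :=
  exists V : nat -> set B, (forall i, measurable (V i)) /\
    \forall a \ae mu, exists i, \forall b \ae nu, (E (a, b) <-> V i b).

Variable idx : A * B -> nat.
Hypothesis midx : forall S : set nat, measurable (idx @^-1` S).

(** The pair [(a, a')] stands for the graph in which [n] and [j] are joined when
    the section of [pairs n j] at [(a, a')] is not a null set. *)
Let pairs n j : set ((A * A) * B) :=
  [set z | idx (z.1.1, z.2) = n /\ idx (z.1.2, z.2) = j].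

Let measurable_pairs n j : measurable (pairs n j).
Proof.
have m1 : measurable_fun setT (fun z : (A * A) * B => (z.1.1, z.2)).
  apply: measurable_fun_pair; last exact: measurable_snd.
  exact: (measurableT_comp measurable_fst measurable_fst).
have m2 : measurable_fun setT (fun z : (A * A) * B => (z.1.2, z.2)).
  apply: measurable_fun_pair; last exact: measurable_snd.
  exact: (measurableT_comp measurable_snd measurable_fst).
have -> : pairs n j =
    (fun z => (z.1.1, z.2)) @^-1` (idx @^-1` [set n]) `&`
    (fun z => (z.1.2, z.2)) @^-1` (idx @^-1` [set j]) by [].
by apply: measurableI; rewrite -[X in measurable X]setTI; [apply: m1|apply: m2].
Qed.

Let e n j : set (A * A) := [set aa | (0 < nu (xsection (pairs n j) aa))%E].

Let me n j : measurable (e n j).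
Proof.
rewrite -[X in measurable X]setTI; apply: emeasurable_fun_o_infty => //.
exact: (measurable_fun_xsection nu (measurable_pairs n j)).
Qed.

Let e_ae n j a a' : ~ e n j (a, a') ->
  \forall b \ae nu, ~ (idx (a, b) = n /\ idx (a', b) = j).
Proof.
rewrite /e/= => /negP; rewrite -leNgt measure_le0 => /eqP H.
exists (xsection (pairs n j) (a, a')); split => //.
  exact: measurable_xsection.
by move=> b /= /contrapT h; rewrite /xsection/= inE.
Qed.

Let ae_e n j a a' : (\forall b \ae nu, ~ (idx (a, b) = n /\ idx (a', b) = j)) ->
  ~ e n j (a, a').
Proof.
move=> H; rewrite /e/=; apply/negP; rewrite -leNgt measure_le0; apply/eqP.
apply: measure_negligible; first exact: measurable_xsection.
apply: negligibleS H => b; rewrite /xsection/= inE => h; exact.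
Qed.

(** If no edge of the graph of [(a, a')] has an end at or beyond [N], the
    sections of [idx] at [a] and [a'] differ only where both are below [N]. *)
Lemma ae_tail N a a' : (forall j, (N <= j)%N -> ~ has_edge e j (a, a')) ->
  \forall b \ae nu, (idx (a, b) = idx (a', b) \/
    (idx (a, b) < N)%N /\ (idx (a', b) < N)%N).
Proof.
move=> HN.
have H n j : \forall b \ae nu, n <> j -> (N <= maxn n j)%N ->
    ~ (idx (a, b) = n /\ idx (a', b) = j).
  have [->|/eqP nj] := eqVneq n j; first exact: aeW.
  have [Nnj|Nnj] := leqP N (maxn n j); last first.
    by apply: aeW => b.
  suff nE : ~ e n j (a, a') by apply: filterS (e_ae nE).
  move=> ee; apply: (HN _ Nnj).
  have [lt|gt|//] := ltngtP n j.
    by exists n => //=; left.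
  by exists j => //=; right.
have {}H : \forall b \ae nu, forall n j, n <> j -> (N <= maxn n j)%N ->
    ~ (idx (a, b) = n /\ idx (a', b) = j).
  by apply: ae_foralln => n; apply: ae_foralln => j; exact: H.
apply: filterS H => b Hb.
have [->|/eqP nE] := eqVneq (idx (a, b)) (idx (a', b)); first by left.
right; have := Hb _ _ nE.
have [//|] := leqP N (maxn (idx (a, b)) (idx (a', b))); first by move=> _ /(_ isT)[].
by rewrite gtn_max => /andP[].
Qed.

(** The function-valued version of countability: if for every set [S] of
    indices the set [idx @^-1` S] has countably many sections, then so has the
    function [idx] itself.  The colouring turns the (a priori uncountable)
    family of all [S] into a single one. *)
Lemma countable_sections_index :
  (forall S : set nat, countable_sections (idx @^-1` S)) ->
  exists W : nat -> B -> nat,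
    \forall a \ae mu, exists i, \forall b \ae nu, idx (a, b) = W i b.
Proof.
move=> HS.
have mfin : ((mu \x mu) setT < +oo)%E by exact: prod_probability_lty.
pose c := greedy_colouring (mu \x mu)%E e.
have Hc := ae_greedy_colouring mfin me.
have [V [mV HV]] := HS [set n | c n].
pose K i := [set a | \forall b \ae nu, (c (idx (a, b)) <-> V i b)].
(* [a0 i] is a representative of the class [K i] of points with section [V i] *)
have /choice[a0 Ha0] i : exists a0, \forall a \ae mu, K i a ->
    exists N, \forall b \ae nu, (idx (a0, b) = idx (a, b) \/
      (idx (a0, b) < N)%N /\ (idx (a, b) < N)%N).
  have [[a0 [Ka0 Ha0]]|nK] := pselect (exists a0, K i a0 /\
      \forall a \ae mu, (forall j, ~ killed e c j (c j) (a0, a)) ->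
         exists N, forall j, (N <= j)%N -> ~ has_edge e j (a0, a)).
    exists a0; apply: filterS Ha0 => a Ha Ka.
    have [|N HN] := Ha; last by exists N; exact: ae_tail.
    move=> j [n /= [nj /eqP cn]]; have cE : \forall b \ae nu,
        c (idx (a0, b)) = c (idx (a, b)).
      by apply: filterS2 Ka0 Ka => b h0 h; apply/idP/idP => [/h0/h|/h/h0].
    case; apply: ae_e; apply: filterS cE => b cb [h0 h]; apply: cn.
      by rewrite -h0 -h.
    by rewrite -h0 -h.
  exists point; apply: filterS (ae_sections Hc) => a Ha Ka.
  by exfalso; apply: nK; exists a.
have /choice[U HU] n := HS [set n].
(* [W] codes the index [i] of the class and the list [l] of the indices of the
   sections of [idx @^-1` [set n]] for [n < size l]; beyond, [a0 i] is used *)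
pose W k b := if unpickle k is Some (i, l) then
    let n := find (fun n => `[< U n (nth 0%N l n) b >]) (iota 0 (size l)) in
    if (n < size l)%N then n else idx (a0 i, b)
  else 0%N.
exists W.
have aeU : \forall a \ae mu, forall n, exists j, \forall b \ae nu,
    (idx (a, b) = n <-> U n j b).
  by apply: ae_foralln => n; have [_] := HU n.
have aeA : \forall a \ae mu, forall i, K i a -> exists N, \forall b \ae nu,
    (idx (a0 i, b) = idx (a, b) \/
      (idx (a0 i, b) < N)%N /\ (idx (a, b) < N)%N).
  exact: ae_foralln.
apply: filterS3 HV aeU aeA => a [i Kia] /choice[u Hu] /(_ i Kia)[N HN].
exists (pickle (i, mkseq u N)).
have {}Hu : \forall b \ae nu, forall n, idx (a, b) = n <-> U n (u n) b.
  exact: ae_foralln.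
apply: filterS2 Hu HN => b ub Nb; rewrite /W pickleK size_mkseq.
set p := (fun n => _); have pE n : (n < N)%N -> p n = (idx (a, b) == n).
  move=> nN; rewrite /p nth_mkseq//; apply/asboolP/eqP => h; exact/ub.
have [aN|Na] := ltnP (idx (a, b)) N.
  have hp : has p (iota 0 N).
    by apply/hasP; exists (idx (a, b)); rewrite ?mem_iota ?add0n// pE.
  have fN : (find p (iota 0 N) < N)%N by rewrite has_find size_iota in hp.
  rewrite fN; have := nth_find 0%N hp.
  by rewrite nth_iota// add0n pE// => /eqP.
have hp : ~~ has p (iota 0 N).
  apply/hasPn => n; rewrite mem_iota add0n /= => nN; rewrite pE//.
  by apply/eqP => E; move: nN; rewrite -E ltnNge Na.
rewrite ifF; last first.
  by apply/negbTE; rewrite -leqNgt; move: hp; rewrite has_find size_iota -leqNgt.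
by case: Nb => [->//|[_]]; rewrite ltnNge Na.
Qed.

End countable_sections.

Section infinite_exponent.
Context (R : realType) (k : scalar_kind).
Context dA dB (A : measurableType dA) (B : measurableType dB).
Variables (mu : probability A R) (nu : probability B R).
Local Notation K := (scalars R k).
Local Notation sm := (strongly_measurable measurable).
Let HA := sigma_algebra_measurable A.
Let HB := sigma_algebra_measurable B.
Let HAB := sigma_algebra_measurable (A * B)%type.

Lemma rnorm1 : rnorm (1 : K^o) = 1.
Proof. by rewrite /rnorm normr1 -(of_real1 R k) of_realK. Qed.

(** An indicator at [L^oo] distance less than [2^-1] from [w] is, almost
    everywhere, that of the set where [w] is closer than [2^-1] to 1. *)
Lemma indic_countable_sections (E : set (A * B)) : measurable E ->
  strongly_measurable_sections mu nu +oo%E (indicK R k E) ->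
  countable_sections mu nu E.
Proof.
move=> mE [s [ss sq sE]].
have /choice[l Hl] n : exists l : seq (B -> K^o), range (s n) = [set` l].
  by have [/finite_seqP[l rl] _] := ss n; exists l.
pose w n j := nth (fun=> 0) (l n) j.
have sw n j : sm (w n j).
  have [jl|jl] := ltnP j (size (l n)); last by rewrite /w nth_default//; exact: sm_cst.
  have : range (s n) (w n j) by rewrite Hl/=; exact: mem_nth.
  by move=> [a _ <-]; have [] := sq n a.
pose V i := if unpickle i is Some (n, j) then
  [set b | rnorm (w n j b - 1) < 2^-1] else set0.
exists V; split.
  move=> i; rewrite /V; case: unpickle => [[n j]|]; last exact: measurable0.
  apply: (sm_rnorm_lt HB); apply: (sm_B HB (sw n j)); exact: sm_cst.
apply: filterS sE => a /fine_cvgP[[N0 _ HN0]].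
have h0 : (0 : R) < 2^-1 by rewrite invr_gt0.
move=> /cvgrPdist_lt/(_ _ h0)[N1 _ HN1].
pose n := maxn N0 N1.
have : s n a \in l n by have : range (s n) (s n a) by []; rewrite Hl.
move=> /(nthP (fun=> 0))[j _ sj].
exists (pickle (n, j)); rewrite /V pickleK /w sj.
have : (Lnorm nu +oo%E (fun b => enorm (indicK R k E (a, b) - s n a b)%R) < (2^-1)%:E)%E.
  rewrite -(fineK (HN0 n (leq_maxl _ _))) lte_fin.
  have := HN1 n (leq_maxr _ _); rewrite /= sub0r normrN.
  exact: le_lt_trans (ler_norm _).
rewrite Lnormy; last by move=> b; exact: enorm_ge0.
move=> h; apply: filterS (ess_sup_ge nu _) => b /le_lt_trans/(_ h).
rewrite lte_fin /indicK /patch => hb; split => /= [Eb|sb].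
  by move: hb; rewrite mem_set// rnormB.
apply: contrapT => nEb; move: hb; rewrite memNset// /= sub0r rnormN => hb.
have tri := ler_rnorm_sub (1 : K^o) (s n a b).
by rewrite rnorm1 rnormB in tri; lra.
Qed.

Variable F : set (set (A * B)).
Hypothesis HF : sigma_algebra [set: A * B] F.
Hypothesis F_sub : F `<=` measurable.

(** For the exponent [oo] the sections of a strongly [F]-measurable function
    are separably valued as soon as those of the indicators of the members of
    [F] are: approximating [g] by a countably valued function reduces this to
    [countable_sections_index]. *)
Lemma countable_separable_sections (X : normedModType K) (g : A * B -> X) :
  (forall C, F C -> countable_sections mu nu C) ->
  strongly_measurable F g ->
  (\forall a \ae mu, (Lnorm nu +oo%E (fun b => enorm (g (a, b))) < +oo)%E) ->
  separable_sections mu nu +oo%E g.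
Proof.
move=> HC sFg gq e e0.
have sg : sm g by exact: (sm_sub F_sub).
have [x gx] := sm_separable_range sFg.
have e20 : 0 < e / 2 by rewrite divr_gt0.
have gx' z : exists n, rnorm (g z - x n) < e / 2 by exact: gx.
(* [x \o idx] is within [e / 2] of [g] and takes countably many values *)
pose idx z := ex_minn (gx' z).
have idxE n : idx @^-1` [set n] = [set z | rnorm (g z - x n) < e / 2] `\`
    \bigcup_(i < n) [set z | rnorm (g z - x i) < e / 2].
  apply/seteqP; split => z /=; rewrite /idx; case: ex_minnP => j jx jmin.
    move=> <-; split => // -[i /= ij ix].
    by have := jmin i ix; rewrite leqNgt ij.
  move=> [nx ni]; apply/eqP; rewrite eqn_leq jmin//= leqNgt; apply/negP => jn.
  by apply: ni; exists j.
have Fidx S : F (idx @^-1` S).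
  rewrite (_ : idx @^-1` S = \bigcup_n (if n \in S then idx @^-1` [set n] else set0)).
    apply: (sa_bigcup HF) => n; case: ifP => _; last exact: sa_set0.
    rewrite idxE; apply: sa_setD => //; first exact: sm_ball_measurable.
    by apply: sa_fin_bigcup => // i _; exact: sm_ball_measurable.
  apply/seteqP; split => z /=.
    move=> Sz; exists (idx z); first exact: I.
    by rewrite mem_set.
  by move=> [n _]; case: ifPn => // /set_mem Sn /= ->.
have [|S|W HW] := @countable_sections_index R _ _ A B mu nu idx.
- by move=> S; apply: F_sub.
- exact: HC.
pose good i a := (\forall b \ae nu, idx (a, b) = W i b) /\
  (Lnorm nu +oo%E (fun b => enorm (g (a, b))) < +oo)%E.
(* the approximants are sections of [g] itself *)
have /choice[w Hw] i : exists w : B -> X, in_Lq nu +oo%E w /\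
    forall a, good i a -> exists a0, good i a0 /\ w = fun b => g (a0, b).
  have [[a0 ga]|nga] := pselect (exists a0, good i a0).
    exists (fun b => g (a0, b)); split; last by move=> a _; exists a0.
    by split; [exact: sm_section|have [] := ga].
  exists (fun=> 0); split; first by apply: in_Lq0; rewrite leey.
  by move=> a ga; exfalso; apply: nga; exists a.
exists w; split; first by move=> i; have [] := Hw i.
apply: filterS2 HW gq => a [i Wi] ga; exists i.
have [_ /(_ a)] := Hw i; case; first by [].
move=> a0 [[W0 _] ->]; rewrite Lnormy; last by move=> b; exact: enorm_ge0.
apply/ess_supP; apply: filterS2 Wi W0 => b <- idxb.
rewrite lee_fin.
have near_x z : rnorm (g z - x (idx z)) < e / 2.
  by rewrite /idx; case: ex_minnP.
have h1 := near_x (a, b); have h2 := near_x (a0, b); rewrite idxb in h2.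
have tri := rnorm_tri (x (idx (a, b))) (g (a, b)) (g (a0, b)).
by rewrite (rnormB (x _)) in tri; lra.
Qed.

End infinite_exponent.

(** * The duality argument *)

Section bochner_comparison.
Context (R : realType) (k : scalar_kind) d (T : measurableType d).
Variable m : {measure set T -> \bar R}.
Hypothesis mfin : (m setT < +oo)%E.
Local Notation K := (scalars R k).
Local Notation sm := (strongly_measurable measurable).
Let HT := sigma_algebra_measurable T.
Let cK := @scalars_seq_complete R k.

Lemma bochner_integral_ae_eq (X : normedModType K) (f g : T -> X) :
  seq_complete X -> bochner_integrable m f -> bochner_integrable m g ->
  (\forall t \ae m, f t = g t) -> bochner_integral m f = bochner_integral m g.
Proof.
move=> cX fi gi fg; apply: subr0_eq; apply: rnorm_eq0; apply/eqP.
rewrite eq_le rnorm_ge0 andbT -lee_fin -(bochner_integralB mfin cX)//.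
apply: le_trans (bochner_integral_norm mfin cX (bochner_integrableB fi gi)) _.
have [sf _] := fi; have [sg _] := gi.
rewrite (ae_eq_integral (cst 0%E)) ?integral0//.
  by apply: measurable_enorm; exact: sm_B.
by apply: filterS fg => t -> _; rewrite /enorm subrr rnorm0.
Qed.

Lemma bochner_integrable_rnorm (X : normedModType K) (f : T -> X) :
  bochner_integrable m f ->
  bochner_integrable m (fun t => of_real k (rnorm (f t)) : K^o).
Proof.
move=> [sf fi]; split; first exact: sm_rnorm.
apply: le_lt_trans fi; apply: integral_enorm_le => //; first exact: sm_rnorm.
by move=> t; rewrite {1}/rnorm norm_of_real of_realK ger0_norm// rnorm_ge0.
Qed.

Lemma rnorm_of_real (r : R) : 0 <= r -> rnorm (of_real k r : K^o) = r.
Proof. by move=> r0; rewrite /rnorm norm_of_real of_realK ger0_norm. Qed.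

(** The scalar Bochner integral of a nonnegative function is its Lebesgue
    integral; only this inequality is needed. *)
Lemma integral_le_bochner (X : normedModType K) (f : T -> X) :
  bochner_integrable m f ->
  (\int[m]_t enorm (f t) <=
   enorm (bochner_integral m (fun t => of_real k (rnorm (f t)) : K^o)))%E.
Proof.
move=> fi; have [sf fi'] := fi.
have [s [ss s0]] := simple_approx_L1 HT (@subset_refl _ _) sf fi'.
pose n_ (h : T -> X) t : K^o := of_real k (rnorm (h t)).
apply: (@lee_cvg0 _ _ _ (fun n => (\int[m]_t enorm (f t - s n t)%R +
  \int[m]_t enorm (f t - s n t)%R)%E)).
- by rewrite lee_fin rnorm_ge0.
- move=> n; have sms : sm (s n) by exact: simple_sm.
  have si : bochner_integrable m (s n).
    split => //; rewrite (integral_simple mfin (ss n) (@rnorm_ge0 _ _ X)).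
    exact: ltry.
  have nfi := bochner_integrable_rnorm fi.
  have nsi := bochner_integrable_rnorm si.
  have sE : (\int[m]_t enorm (s n t))%E = enorm (bochner_integral m (n_ (s n))).
    rewrite (integral_simple mfin (ss n) (@rnorm_ge0 _ _ X)).
    have sns : simple_for measurable (n_ (s n)).
      exact: (simple_comp HT (fun x : X => of_real k (rnorm x) : K^o) (ss n)).
    rewrite (bochner_integral_simple mfin sns).
    rewrite (simple_integral_comp mfin (fun x : X => of_real k (rnorm x) : K^o) (ss n)).
    have -> : \sum_(y \in range (s n)) of_real k (fine (m (s n @^-1` [set y]))) *:
        (of_real k (rnorm y) : K^o) =
        of_real k (\sum_(y \in range (s n)) fine (m (s n @^-1` [set y])) * rnorm y).
      rewrite of_real_sum; last by case: (ss n).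
      by apply: eq_fsbigr => y _; rewrite of_realM.
    rewrite /enorm rnorm_of_real// fsbig_finite/=; last by case: (ss n).
    by apply: sumr_ge0 => x _; rewrite mulr_ge0 ?fine_ge0 ?rnorm_ge0.
  apply: (@le_trans _ _ (\int[m]_t enorm (s n t) +
      \int[m]_t enorm (f t - s n t)%R)%E).
    apply: integral_enormD => //; first exact: sm_B.
    by move=> t; rewrite addrC ler_rnorm_sub.
  rewrite [leRHS]addeA leeD2r// sE.
  apply: (@le_trans _ _ (enorm (bochner_integral m (n_ f)) +
    enorm (bochner_integral m (fun t => n_ f t - n_ (s n) t)%R))%E).
    rewrite (bochner_integralB mfin cK)// -EFinD lee_fin rnormB addrC.
    exact: ler_rnorm_sub.
  apply: leeD => //.
  apply: le_trans (bochner_integral_norm mfin cK (bochner_integrableB nfi nsi)) _.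
  apply: integral_enorm_le.
  + by case: (bochner_integrableB nfi nsi).
  + exact: sm_B.
  move=> t; rewrite /n_.
  have -> : of_real k (rnorm (f t)) - of_real k (rnorm (s n t)) =
      of_real k (rnorm (f t) - rnorm (s n t)).
    apply/eqP; rewrite subr_eq -of_realD subrK//.
  rewrite {1}/rnorm norm_of_real of_realK ler_norml.
  have h1 := ler_rnorm_sub (f t) (s n t); have h2 := ler_rnorm_sub (s n t) (f t).
  by rewrite rnormB in h2; apply/andP; split; lra.
- by rewrite -[X in _ --> X](adde0 0); apply: cvgeD.
Qed.

End bochner_comparison.

Section duality.
Context (R : realType) (k : scalar_kind).
Context dA dB (A : measurableType dA) (B : measurableType dB).
Variables (mu : probability A R) (nu : probability B R).
Variable F : set (set (A * B)).
Hypothesis HF : sigma_algebra [set: A * B] F.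
Hypothesis F_sub : F `<=` measurable.
Variables p q : \bar R.
Hypothesis hp : (1 < p)%E.
Hypothesis hq : (1 < q)%E.
Local Notation K := (scalars R k).
Local Notation sm := (strongly_measurable measurable).
Local Notation m := (mu \x nu)%E.
Local Notation p' := (hoelder_conjugate p).
Local Notation q' := (hoelder_conjugate q).
Let HAB := sigma_algebra_measurable (A * B)%type.
Let mfin : (m setT < +oo)%E. Proof. exact: prod_probability_lty. Qed.
Let p1 : (1 <= p)%E. Proof. exact: ltW. Qed.
Let q1 : (1 <= q)%E. Proof. exact: ltW. Qed.
Let p'1 : (1 <= p')%E. Proof. exact: hoelder_conj_ge1. Qed.
Let q'1 : (1 <= q')%E. Proof. exact: hoelder_conj_ge1. Qed.
Let cK := @scalars_seq_complete R k.

Lemma mixed_norm_integrable (X : normedModType K) (f : A * B -> X) : sm f ->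
  (mixed_norm mu nu p q f < +oo)%E -> bochner_integrable m f.
Proof.
move=> sf fy; split => //.
have s1 : sm (fun _ : A * B => 1 : K^o) by exact: sm_cst.
have n1 : (mixed_norm mu nu p' q' (fun _ : A * B => 1%R : K^o) <= 1)%E.
  by apply: mixed_norm_le1 => // z; rewrite rnorm1.
have n1y := le_lt_trans n1 (ltry 1).
have e1 : enorm (1 : K^o) = 1%E by rewrite /enorm rnorm1.
have -> : (\int[m]_z enorm (f z) =
    \int[m]_z (enorm (f z) * enorm (1%R : K^o)))%E.
  by apply: eq_integral => z _; rewrite e1 mule1.
apply: le_lt_trans (mixed_hoelder hp hq sf s1 fy n1y) _.
apply: lte_mul_pinfty => //.
  exact: mixed_norm_ge0.
by rewrite ge0_fin_numE// mixed_norm_ge0.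
Qed.

Lemma pairing_integrable (u g : A * B -> K^o) : sm u -> sm g ->
  (mixed_norm mu nu p q u < +oo)%E -> (mixed_norm mu nu p' q' g < +oo)%E ->
  bochner_integrable m (fun z => (u z * g z : K^o)) /\
  (\int[m]_z enorm (u z * g z : K^o)%R <=
     mixed_norm mu nu p q u * mixed_norm mu nu p' q' g)%E.
Proof.
move=> su sg uy gy.
have H := mixed_hoelder hp hq su sg uy gy.
have E : (\int[m]_z enorm (u z * g z : K^o)%R =
    \int[m]_z (enorm (u z) * enorm (g z)))%E.
  apply: eq_integral => z _.
  by rewrite /enorm -EFinM -(rnormZ (u z) (g z)).
rewrite E; split => //; split; first exact: sm_M.
rewrite E; apply: le_lt_trans H _; apply: lte_mul_pinfty => //.
  exact: mixed_norm_ge0.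
by rewrite ge0_fin_numE// mixed_norm_ge0.
Qed.

Lemma pairing_norm (u g : A * B -> K^o) : sm u -> sm g ->
  (mixed_norm mu nu p q u < +oo)%E -> (mixed_norm mu nu p' q' g < +oo)%E ->
  (enorm (pairing mu nu u g) <=
     mixed_norm mu nu p q u * mixed_norm mu nu p' q' g)%E.
Proof.
move=> su sg uy gy; have [ui ule] := pairing_integrable su sg uy gy.
exact: le_trans (bochner_integral_norm mfin cK ui) ule.
Qed.

(** Only the finiteness of the mixed norm of [u] matters, not the strong
    measurability of its sections nor any measurability with respect to [F]. *)
Lemma pairing_in_dual (u : A * B -> K^o) : sm u ->
  (mixed_norm mu nu p q u < +oo)%E ->
  in_dual mu nu F p' q' (pairing mu nu u).
Proof.
move=> su uy; split.
  move=> c g h [[sg _ gy] _] [[sh _ hy] _].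
  have [gi _] := pairing_integrable su sg uy gy.
  have [hi _] := pairing_integrable su sh uy hy.
  rewrite /pairing; etransitivity; last exact: (bochner_integral_lin mfin cK c gi hi).
  congr bochner_integral.
  apply/funext => z; rewrite mulrDr; congr (_ + _).
  by rewrite -[c *: _]/(c * _) -[c *: _]/(c * _) mulrCA.
exists (fine (mixed_norm mu nu p q u)) => g [[sg _ gy] _].
by rewrite fineK ?ge0_fin_numE ?mixed_norm_ge0//; exact: pairing_norm.
Qed.

Lemma in_LpqF_indic C : F C -> in_LpqF mu nu F p' q' (indicK R k C).
Proof.
move=> FC; have mC := F_sub FC.
have sC : sm (indicK R k C) by exact: sm_indic.
have C1 : (mixed_norm mu nu p' q' (indicK R k C) <= 1)%E.
  apply: mixed_norm_le1 => // z; rewrite /indicK /patch.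
  by case: ifP => _; rewrite ?rnorm1// rnorm0.
have Cy := le_lt_trans C1 (ltry 1).
have [r [qr r1 _]] := hoelder_conjugate_gt1 hq.
split; last by exists (indicK R k C); split; [exact: sm_indic|exact: aeW].
split => //; rewrite qr; apply: separable_sections_sm => //.
apply: sm_separable_sections => //.
by have := mixed_norm_lty_ae p'1 q'1 sC Cy; rewrite qr.
Qed.

Lemma pairing_indic (u : A * B -> K^o) C :
  pairing mu nu u (indicK R k C) = bochner_integral m (patch (cst 0) C u).
Proof.
rewrite /pairing; congr bochner_integral; apply/funext => z.
by rewrite /indicK /patch; case: ifP => _; rewrite ?mulr1 ?mulr0.
Qed.

Hypothesis Hiso : canonical_isomorphism k mu nu F p q.

(** Every scalar function of finite mixed norm has a conditional expectation,
    namely the function representing the functional it induces on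
    [L^p'_F(L^q')]; its norm is controlled by the inverse of the canonical
    isomorphism. *)
Lemma dual_representer : exists2 C : R, 0 <= C &
  forall u : A * B -> K^o, sm u -> (mixed_norm mu nu p q u < +oo)%E ->
  exists h g : A * B -> K^o,
    [/\ in_LpqF mu nu F p q h, \forall z \ae m, h z = g z,
        is_condexp m F u g &
        (mixed_norm mu nu p q h <= C%:E * mixed_norm mu nu p q u)%E].
Proof.
have [_ _ _ rep [C0 HC0]] := Hiso.
exists (Num.max C0 0); first by rewrite le_max lexx orbT.
move=> u su uy.
have [h hF uh] := rep _ (pairing_in_dual su uy).
have [[sh _ hy] [g [sFg hg]]] := hF.
exists h, g; split; [exact: hF|exact: hg| |].
  have ui := mixed_norm_integrable su uy.
  have hi := mixed_norm_integrable sh hy.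
  have sg : sm g by exact: (sm_sub F_sub).
  have gi : bochner_integrable m g.
    split => //; have [_ hi'] := hi.
    rewrite (ae_eq_integral (fun z => enorm (h z))) //.
    - exact: measurable_enorm.
    - exact: measurable_enorm.
    - by apply: filterS hg => z -> _.
  split; [exact: gi|exact: sFg|move=> C FC]; have mC := F_sub FC.
  rewrite -(pairing_indic u) uh; last exact: in_LpqF_indic.
  rewrite pairing_indic; apply: (bochner_integral_ae_eq mfin cK).
  - exact: bochner_integrable_patch.
  - exact: bochner_integrable_patch.
  - by apply: filterS hg => z hz; rewrite /patch; case: ifP.
have [_ hle] := HC0 h hF; apply: le_trans hle _.
have D0 : (0 <= dual_norm mu nu F p' q' (pairing mu nu h))%E.
  apply: (@le_trans _ _ (enorm (pairing mu nu h (indicK R k set0)))).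
    by rewrite lee_fin rnorm_ge0.
  apply: ereal_sup_ubound; exists (indicK R k set0) => //; split.
    by apply: in_LpqF_indic; exact: sa_set0.
  apply: mixed_norm_le1 => //; first exact: sm_indic.
  by move=> z; rewrite /indicK /patch in_set0 rnorm0.
apply: (@le_trans _ _ ((Num.max C0 0)%:E * dual_norm mu nu F p' q' (pairing mu nu h))%E).
  by apply: lee_wpmul2r => //; rewrite lee_fin le_max lexx.
apply: lee_wpmul2l; first by rewrite lee_fin le_max lexx orbT.
apply: ge_ereal_sup => _ [g' [g'F g'1] <-].
rewrite -uh//; have [[sg' _ g'y] _] := g'F.
apply: le_trans (pairing_norm su sg' uy g'y) _.
by rewrite -[leRHS]mule1; apply: lee_wpmul2l => //; exact: mixed_norm_ge0.
Qed.

Lemma condexp_indic_exists E : measurable E ->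
  exists h : A * B -> K^o, is_condexp m F (indicK R k E) h.
Proof.
move=> mE; have [C _ HC] := dual_representer.
have sE : sm (indicK R k E) by exact: sm_indic.
have E1 : (mixed_norm mu nu p q (indicK R k E) <= 1)%E.
  apply: mixed_norm_le1 => // z; rewrite /indicK /patch.
  by case: ifP => _; rewrite ?rnorm1// rnorm0.
have [h [g [_ _ ug _]]] := HC _ sE (le_lt_trans E1 (ltry 1)).
by exists g.
Qed.

(** The indicator of [C] agrees almost everywhere with the member of
    [L^p_F(L^oo)] representing its functional, hence inherits the strong
    measurability of its sections. *)
Lemma canonical_countable_sections C : q = +oo%E -> F C ->
  countable_sections mu nu C.
Proof.
move=> qy FC; have mC := F_sub FC.
apply: (@indic_countable_sections R k) => //.
have [c _ Hc] := dual_representer.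
have sC : sm (indicK R k C) by exact: sm_indic.
have C1 : (mixed_norm mu nu p q (indicK R k C) <= 1)%E.
  apply: mixed_norm_le1 => // z; rewrite /indicK /patch.
  by case: ifP => _; rewrite ?rnorm1// rnorm0.
have Cy := le_lt_trans C1 (ltry 1).
have Ci := mixed_norm_integrable sC Cy.
have [h [g [[[sh sech _] _] hg Cg _]]] := Hc _ sC Cy.
have CC : is_condexp m F (indicK R k C) (indicK R k C).
  by split => //; exact: sm_indic.
have hC : \forall z \ae m, h z = indicK R k C z.
  by apply: filterS2 hg (is_condexp_unique mfin HF F_sub cK Ci Cg CC) => z -> ->.
move: sech; rewrite qy => -[s [ss sq sech]]; exists s; split => //.
apply: filterS2 sech (ae_sections hC) => a + hCa.
have sa n : sm (s n a) by have [] := sq n a.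
apply: cvg_trans; apply: near_eq_cvg; apply: nearW => n.
have sB := sigma_algebra_measurable B.
apply: eq_ae_Lnorm.
- exact: leey.
- by apply: measurable_enorm; apply: (sm_B sB _ (sa n)); exact: sm_section.
- by apply: measurable_enorm; apply: (sm_B sB _ (sa n)); exact: sm_section.
- by move=> b; exact: enorm_ge0.
- by move=> b; exact: enorm_ge0.
- by apply: filterS hCa => b ->.
Qed.

Section Banach.
Variable X : completeNormedModType K.
Let cX : seq_complete X := @Banach_seq_complete R k X.
Implicit Types f g : A * B -> X.

Lemma condexpP f : bochner_integrable m f ->
  is_condexp m F f (condexp m F f).
Proof.
move=> fi; rewrite /condexp; apply: xgetPex.
exact: (condexp_exists mfin HF F_sub cX condexp_indic_exists).
Qed.

Lemma patch_rnorm (Y : normedModType K) (f : A * B -> Y) C :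
  patch (cst 0) C (fun t => of_real k (rnorm (f t)) : K^o) =
  (fun t => of_real k (rnorm (patch (cst 0) C f t))).
Proof.
by apply/funext => t; rewrite /patch; case: ifP => // _; rewrite rnorm0 of_real0.
Qed.

(** The norm of a conditional expectation of [f] is dominated by that of a
    conditional expectation of the scalar function [rnorm f]. *)
Lemma condexp_rnorm_le f g (g' : A * B -> K^o) : bochner_integrable m f ->
  is_condexp m F f g ->
  is_condexp m F (fun t => of_real k (rnorm (f t)) : K^o) g' ->
  \forall z \ae m, rnorm (g z) <= rnorm (g' z).
Proof.
move=> fi fg [gi' sg' ug']; have [_ sg _] := fg.
apply: (ae_rnorm_le mfin HF F_sub sg sg') => C FC; have mC := F_sub FC.
apply: le_trans (condexp_contraction mfin HF F_sub cX fi fg FC) _.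
have Cfi := bochner_integrable_patch mC fi.
apply: le_trans (integral_le_bochner mfin Cfi) _.
rewrite -patch_rnorm -ug'//.
exact: (bochner_integral_norm mfin cK (bochner_integrable_patch mC gi')).
Qed.

(** [rnorm f] has the same mixed norm as [f], so the bound of
    [dual_representer] applies. *)
Lemma condexp_bounded : exists2 C : R, 0 <= C & forall f g, sm f ->
  (mixed_norm mu nu p q f < +oo)%E -> is_condexp m F f g ->
  (mixed_norm mu nu p q g <= C%:E * mixed_norm mu nu p q f)%E.
Proof.
have [C C0 HC] := dual_representer; exists C => // f g sf fy fg.
have su : sm (fun z => of_real k (rnorm (f z)) : K^o) by exact: sm_rnorm.
have uE : mixed_norm mu nu p q (fun z => of_real k (rnorm (f z)) : K^o) =
    mixed_norm mu nu p q f.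
  by apply: eq_mixed_norm => z; rewrite rnorm_of_real// rnorm_ge0.
have uy : (mixed_norm mu nu p q (fun z => of_real k (rnorm (f z)) : K^o) < +oo)%E.
  by rewrite uE.
have [h [g' [[[sh _ _] _] hg' ug' hC]]] := HC _ su uy.
rewrite -uE; apply: le_trans hC; have [[sg _] _ _] := fg.
apply: le_mixed_norm => //.
have fi := mixed_norm_integrable sf fy.
by apply: filterS2 hg' (condexp_rnorm_le fi fg ug') => z ->.
Qed.

(** The separability of the sections comes from [sm_separable_sections] when
    [q] is finite, and from the duality when it is infinite. *)
Lemma condexp_in_Lpq f g : sm f -> (mixed_norm mu nu p q f < +oo)%E ->
  is_condexp m F f g -> in_Lpq mu nu p q g.
Proof.
move=> sf fy fg; have [[sg _] sFg _] := fg.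
have gy : (mixed_norm mu nu p q g < +oo)%E.
  have [C C0 HC] := condexp_bounded; apply: le_lt_trans (HC _ _ sf fy fg) _.
  by apply: lte_mul_pinfty; rewrite ?lee_fin.
have gsec := mixed_norm_lty_ae p1 q1 sg gy.
split => //; apply: separable_sections_sm => //.
move: gsec; case E : q => [r| |].
- by move=> gsec; apply: sm_separable_sections => //; rewrite -lee_fin -E.
- move=> gsec; apply: (countable_separable_sections HF F_sub _ sFg gsec) => C FC.
  exact: canonical_countable_sections.
- by move: hq; rewrite E.
Qed.

Lemma condexp_restricts :
  restricts_to_bounded_projection mu nu
    (condexp m F : (A * B -> X) -> (A * B -> X)) p q.
Proof.
have int f : in_Lpq mu nu p q f -> bochner_integrable m f.
  by move=> [sf _ fy]; exact: mixed_norm_integrable.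
split.
- move=> f fL; have [sf _ fy] := fL.
  exact: (condexp_in_Lpq sf fy (condexpP (int _ fL))).
- move=> c f g fL gL; have fi := int _ fL; have gi := int _ gL.
  have cfg : bochner_integrable m (fun z => c *: f z + g z).
    by apply: bochner_integrableD => //; exact: bochner_integrableZ.
  apply: (is_condexp_unique mfin HF F_sub cX cfg (condexpP cfg)).
  exact: (is_condexp_lin mfin HF F_sub cX c fi gi (condexpP fi) (condexpP gi)).
- move=> f fL; have [gi sg _] := condexpP (int _ fL).
  apply: (is_condexp_unique mfin HF F_sub cX gi (condexpP gi)).
  by split.
- have [C _ HC] := condexp_bounded; exists C => f fL.
  by have [sf _ fy] := fL; exact: (HC _ _ sf fy (condexpP (int _ fL))).
Qed.

End Banach.
End duality.

Theorem theorem2p1 (R : realType) (k : scalar_kind)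
    (dA dB : measure_display) (A : measurableType dA) (B : measurableType dB)
    (mu : probability A R) (nu : probability B R)
    (F : set (set (A * B)))
    (HF : sigma_algebra [set: A * B] F) (F_sub : F `<=` measurable)
    (p q : \bar R) (hp : (1 < p)%E) (hq : (1 < q)%E)
    (Hiso : canonical_isomorphism k mu nu F p q) :
  forall X : completeNormedModType (scalars R k),
    (forall f : A * B -> X, bochner_integrable (mu \x nu)%E f ->
       is_condexp (mu \x nu)%E F f (condexp (mu \x nu)%E F f)) /\
    restricts_to_bounded_projection mu nu
      (condexp (mu \x nu)%E F : (A * B -> X) -> (A * B -> X)) p q.
Proof.
move=> X; split; last exact: condexp_restricts.
by move=> f; exact: (condexpP HF F_sub hp hq Hiso).
Qed.
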